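(* Let $V_\delta,\varepsilon,n,\delta,\beta,T$ satisfy the standing assumptions. Let $\rho_\varepsilon$ be the solution of $(MF^\varepsilon)$ on $[0,T]$ with initial condition $\rho_\varepsilon^\circ\in\mathcal P(\Lambda_{\varepsilon,\pm})$. Fix $\mathbf b\in\{\pm1\}^n$, let $I^\pm=\{i:b_i=\pm1\}$, $n^\pm=\#I^\pm$, and let $$\kappa:=\Big|\int\rho_\varepsilon^{\circ,+}-\frac{n^+}n\Big|.$$ Let $\mathbf X_\varepsilon^\circ=\{X_{i,\varepsilon}^\circ\}_{1\le i\le n}$ be independent random variables in $\Lambda_\varepsilon$ with law proportional to $\rho_\varepsilon^{\circ,+}$ for $i\in I^+$ and to $\rho_\varepsilon^{\circ,-}$ for $i\in I^-$. Let $\{\mathbf X_{\varepsilon,t}\}_{0\le t\le T}$ be the stochastic process defined by $(RW_n^\varepsilon)$ with initial datum $\mathbf X_\varepsilon^\circ$ and Burgers vectors $\mathbf b$. Then $$\mathbb E\|\rho_{\varepsilon,n}^\pm(t)-\rho_\varepsilon^\pm(t)\|^*_{1,\infty}\le\kappa+C''\frac{\log n}{\sqrt n}+C'\Big(\frac1{\sqrt n}+\kappa\Big)\frac t\delta e^{C\delta^{-2}t}\qquad\text{for all }t\in[0,T],$$ where $\rho_{\varepsilon,n}^\pm(t)=\frac1n\sum_{i\in I^\pm}\delta_{X_{\varepsilon,i}(t)}$ are the (random) components of the empirical measure of $(\mathbf X_{\varepsilon,t},\mathbf b)$, and $C,C',C''>0$ depend only on the initial data and on the constants $C_V,c_\beta,C_\beta$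 of the standing assumptions.
   Context: $\mathbb T^2=\mathbb R^2/\mathbb Z^2$, $\Lambda_\varepsilon=(\varepsilon\mathbb Z^2)/\mathbb Z^2\subset\mathbb T^2$, $\Lambda_{\varepsilon,\pm}=\Lambda_\varepsilon\times\{\pm1\}$. A probability measure $\rho$ on $\Lambda_{\varepsilon,\pm}$ is decomposed as $\rho=\rho^+\otimes\delta_{+1}+\rho^-\otimes\delta_{-1}$ with nonnegative measures $\rho^\pm$ on $\Lambda_\varepsilon$ (also viewed as measures on $\mathbb T^2$). Standing assumptions on the parameters, with fixed constants $C_V,c_\beta,C_\beta>0$: $\varepsilon>0$ with $1/\varepsilon\in\mathbb N$; $\varepsilon\le\delta\le1$; $n\ge2$ an integer; $\beta>0$; $T\ge1$; $c_\beta\le\beta\le C_\beta\,\delta/\varepsilon$; and $V_\delta\in C^5(\mathbb T^2)$ satisfies $\|V_\delta\|_\infty\le C_V\log\frac1\delta$ and $\|d^kV_\delta\|_\infty\le C_V\delta^{-k}$ for $k=1,\dots,5$, where $\|d^kg\|_\infty=\sup_x\sup\{d^kg(x)[y_1,\dots,y_k]:|y_i|\le1\}$ (Euclidean norm on $\mathbb R^2$). Dual bounded-Lipschitz norm: for a finite signed measure $\mu$ on $\mathbb T^2$, $\|\mu\|^*_{1,\infty}=\sup\{\int\varphi\,d\mu:\varphi\in W^{1,\infty}(\mathbb T^2),\ \|\varphi\|_\infty+\|d\varphi\|_\infty\le1\}$. $(RW_n^\varepsilon)$: the continuous-time Markov jump process on $\Lambda_\varepsilon^n$ that jumps from $\boldsymbol\ell$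 to $\boldsymbol\ell+\mathbf h$ with rate $\mathcal R^\varepsilon_{n,\mathbf h}(\boldsymbol\ell,\mathbf b)=\frac1{\beta\varepsilon^2}\exp\big(\tfrac12\beta\,\mathbf h\cdot\mathbf F(\boldsymbol\ell,\mathbf b)\big)$ for each $\mathbf h\in\mathcal N_\varepsilon^n$, where $\mathcal N_\varepsilon^n$ is the set of vectors $(0,\dots,0,h,0,\dots,0)\in\varepsilon\mathbb Z^{2n}$ with one nonzero entry $h\in\mathcal N_\varepsilon=\{\pm\varepsilon e_1,\pm\varepsilon e_2\}$ in one of the $n$ slots, and $\mathbf F=(F_i)_{i=1}^n$, $F_i(\mathbf x,\mathbf b)=-\frac{b_i}n\sum_{j\ne i}b_j\nabla V_\delta(x_i-x_j)$. $(MF^\varepsilon)$: $\partial_t\rho^\pm_\varepsilon=\varepsilon\sum_{h\in\mathcal N_\varepsilon}D_{-h}\big(\mathcal R^\varepsilon_h(\cdot,\pm1;\rho_\varepsilon)\rho^\pm_\varepsilon\big)$ on $\Lambda_\varepsilon\times(0,T)$, with $D_hf(\ell)=\frac{f(\ell+h)-f(\ell)}\varepsilon$, $\mathcal R^\varepsilon_h(x,b;\rho)=\frac1{\varepsilon^2\beta}\exp\big(\tfrac12\beta h\cdot F(x,b;\rho)\big)$, $F(x,b;\rho)=-b\,\big(\nabla V_\delta*(\rho^+-\rho^-)\big)(x)$ and $(\nabla V_\delta*\sigma)(x)=\int\nabla V_\delta(x-y)\,\sigma(dy)$. *)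

(* Defs.v *)
From mathcomp Require Import all_boot all_order all_algebra.
From mathcomp Require Import all_classical all_reals all_analysis.
From mathcomp Require Import ess_sup_inf.

Set Implicit Arguments.
Unset Strict Implicit.
Unset Printing Implicit Defensive.

Import Order.TTheory GRing.Theory Num.Theory.
Import numFieldNormedType.Exports.

Local Open Scope classical_set_scope.
Local Open Scope ring_scope.

(** ** Functions on the torus

    T^2 = R^2/Z^2: a function on T^2 is a Z^2-periodic function on the plane. *)

Notation plane R := (R * R)%type.

Section Torus.
Context {R : realType}.
Implicit Types (f V : plane R -> R) (g : plane R -> plane R) (x y v : plane R).

Definition dot x y : R := x.1 * y.1 + x.2 * y.2.

(* Euclidean norm; the library norm on R * R is the sup norm. *)
Definition enorm x : R := Num.sqrt (dot x x).

Definition periodic {W : Type} (f : plane R -> W) :=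
  forall x (k l : int), f (x.1 + k%:~R, x.2 + l%:~R) = f x.

Fixpoint Ck (k : nat) f : Prop :=
  if k is k'.+1 then
    (forall x, differentiable f x) /\ forall v, Ck k' (fun x => 'd f x v)
  else continuous f.

Definition smooth f := forall k, Ck k f.

(* d^k f(x)[v_1, ..., v_k] for vs = [:: v_1; ...; v_k] *)
Definition diffk (vs : seq (plane R)) f : plane R -> R :=
  foldr (fun v df x => 'd df x v) f vs.

Definition supnorm f : \bar R := ereal_sup [set `|f x|%:E | x in setT].

(* sup_x sup {d^k f(x)[v_1, ..., v_k] : |v_i| <= 1} *)
Definition dk_norm (k : nat) f : \bar R :=
  ereal_sup [set r | exists x (vs : k.-tuple (plane R)),
    (forall i, enorm (tnth vs i) <= 1) /\ r = (diffk vs f x)%:E].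

Definition grad V x : plane R := ('d V x (1, 0), 'd V x (0, 1)).

Definition plane_lebesgue := (@lebesgue_measure R \x @lebesgue_measure R)%E.

Definition unit_cell : set (measurableTypeR R * measurableTypeR R) :=
  `[0, 1[ `*` `[0, 1[.

(* g is a weak gradient of f on T^2, with g in L^oo *)
Definition weak_gradient f g :=
  [/\ periodic g,
      measurable_fun setT
        (g : measurableTypeR R * measurableTypeR R ->
             measurableTypeR R * measurableTypeR R),
      (ess_sup plane_lebesgue (fun x => (enorm (g x))%:E) < +oo)%E &
      forall (psi : plane R -> R) v, periodic psi -> smooth psi ->
        \int[plane_lebesgue]_(x in unit_cell) (f x * 'd psi x v) =
        - \int[plane_lebesgue]_(x in unit_cell) (dot (g x) v * psi x)].

(* The phi in W^{1,oo}(T^2) with ||phi||_oo + ||d phi||_oo <= 1. Elements of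
   W^{1,oo} are represented by their continuous versions, since they are
   integrated against atomic measures; the L^oo norm of such a version is its
   sup norm. *)
Definition bl_test f :=
  [/\ periodic f, continuous f &
      exists2 g, weak_gradient f g &
        (supnorm f + ess_sup plane_lebesgue (fun x => (enorm (g x))%:E)
           <= 1)%E].

End Torus.

(** ** The lattice (eps Z^2)/Z^2 with eps = 1 / (m + 1)

    The site (i, j) is the class of (eps i, eps j); the addition of sites is
    that of (Z/(m + 1))^2. *)

Definition site (m : nat) := ('I_m.+1 * 'I_m.+1)%type.

(* eps h for h in [nbrs] are the four elements of N_eps, taken in eps Z^2:
   they stay distinct when their classes modulo Z^2 coincide. *)
Definition nbrs : seq (int * int) := [:: (1, 0); (-1, 0); (0, 1); (0, -1)].

(* class modulo Z^2 of eps h *)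
Definition step (m : nat) (h : int * int) : site m := (Zp1 *~ h.1, Zp1 *~ h.2).

Section Lattice.
Context {R : realType} (m : nat).

Definition mesh : R := m.+1%:R^-1.

Definition pos (l : site m) : plane R := (mesh * l.1%:R, mesh * l.2%:R).

Definition hvec (h : int * int) : plane R := (mesh * h.1%:~R, mesh * h.2%:~R).

(* A signed measure sigma on the lattice is given by its masses sigma l; its
   integral is the finite sum below. The set is nonempty and bounded by the
   total variation of sigma. *)
Definition bl_dual_norm (sigma : site m -> R) : R :=
  sup [set \sum_l sigma l * phi (pos l) | phi in @bl_test R].

(* A measure rho on the lattice times {+1, -1}: rho true is the component
   rho^+, rho false is the component rho^-. *)
Definition is_probability (rho : bool -> site m -> R) :=
  (forall s l, 0 <= rho s l) /\ \sum_s \sum_l rho s l = 1.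

End Lattice.
Arguments mesh R m : clear implicits.
Arguments hvec R m h : clear implicits.

Definition sgn {R : realType} (b : bool) : R := if b then 1 else -1.

(** ** Mean-field equation *)

Section MeanField.
Context {R : realType} (m : nat).
Variables (beta : R) (V : plane R -> R).
Implicit Types (rho : bool -> site m -> R) (l : site m) (s : bool).

Let eps := mesh R m.

(* (grad V * sigma)(x) *)
Definition convol_grad (sigma : site m -> R) (x : plane R) : plane R :=
  \sum_y sigma y *: grad V (x - pos y).

Definition mf_force rho (x : plane R) s : plane R :=
  - sgn s *: convol_grad (fun y => rho true y - rho false y) x.

Definition mf_rate (h : int * int) rho l s : R :=
  (eps ^+ 2 * beta)^-1 *
  expR (2^-1 * beta * dot (hvec R m h) (mf_force rho (pos l) s)).

Definition Dh (h : int * int) (f : site m -> R) l : R :=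
  (f (l + step m h) - f l) / eps.

Definition mf_solution (T : R) (rho0 : bool -> site m -> R)
    (rho : R -> bool -> site m -> R) :=
  [/\ rho 0 = rho0,
      forall s l, {within `[0, T], continuous (fun t => rho t s l)} &
      forall t s l, 0 < t < T ->
        is_derive t 1 (fun u => rho u s l)
          (eps * \sum_(h <- nbrs)
             Dh (- h) (fun l' => mf_rate h (rho t) l' s * rho t s l') l)].

End MeanField.

(** ** Continuous-time Markov jump processes on a finite state space *)

Section JumpProcess.
Context {R : realType} (S : finType).
Implicit Types (Q : S -> S -> R) (p : R -> S -> S -> R).

Definition transition_semigroup Q p :=
  [/\ forall t x y, 0 <= t -> 0 <= p t x y,
      forall t x, 0 <= t -> \sum_y p t x y = 1,
      forall x y, p 0 x y = (x == y)%:R,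
      forall s t x z, 0 <= s -> 0 <= t ->
        p (s + t) x z = \sum_y p s x y * p t y z &
      forall x y, (p t x y - (x == y)%:R) / t @[t --> 0^'+] --> Q x y].

(* X is, on [0, T], a pure jump process with right-continuous paths that is
   Markov, with generator matrix Q, for its natural filtration; the events of
   the past of time s are generated by the finite histories
   X_(u_1) = z_1, ..., X_(u_k) = z_k with u_i <= s. *)
Definition markov_jump_process (T : R) Q (d : measure_display)
    (Omega : measurableType d) (P : probability Omega R) (X : R -> Omega -> S) :=
  [/\ forall t x, 0 <= t <= T -> measurable [set w | X t w = x],
      forall w t, 0 <= t < T -> \forall u \near t^'+, X u w = X t w,
      forall w t, 0 < t <= T -> exists x, \forall u \near t^'-, X u w = x &
      exists2 p, transition_semigroup Q p &
        forall (hist : seq (R * S)) s t x y,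
          all (fun uz => 0 <= uz.1 <= s) hist ->
          0 <= s -> 0 <= t -> s + t <= T ->
          let past := [set w | all (fun uz => X uz.1 w == uz.2) hist] in
          P (past `&` [set w | X s w = x] `&` [set w | X (s + t) w = y]) =
          (P (past `&` [set w | X s w = x]) * (p t x y)%:E)%E].

End JumpProcess.

(** ** Independence and laws of random variables in a finite set *)

Section DiscreteVariables.
Context {R : realType} (S : finType) (d : measure_display).
Context (Omega : measurableType d) (P : probability Omega R).

Definition mutually_independent (n : nat) (Y : 'I_n -> Omega -> S) :=
  forall B : 'I_n -> {set S},
    fine (P [set w | forall i, Y i w \in B i]) =
    \prod_i fine (P [set w | Y i w \in B i]).

Definition law_proportional_to (mu : S -> R) (Y : Omega -> S) :=
  exists c : R, forall x, fine (P [set w | Y w = x]) = c * mu x.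

End DiscreteVariables.

(** ** Random walk of n interacting particles *)

Section RandomWalk.
Context {R : realType} (m n : nat).
Variables (beta : R) (V : plane R -> R) (b : 'I_n -> bool).

Definition config := {ffun 'I_n -> site m}.
Implicit Types (l : config) (i : 'I_n) (h : int * int).

Let eps := mesh R m.

Definition rw_force l i : plane R :=
  - (sgn (b i) / n%:R) *:
    \sum_(j | j != i) sgn (b j) *: grad V (pos (l i) - pos (l j)).

(* The jump vector with entry eps h in slot i and zeros elsewhere is indexed by
   the pair (i, h). *)
Definition rw_rate i h l : R :=
  (beta * eps ^+ 2)^-1 *
  expR (2^-1 * beta * dot (hvec R m h) (rw_force l i)).

Definition jump i h l : config :=
  [ffun j => if j == i then l j + step m h else l j].

(* The matrix of f |-> sum_(i, h) rw_rate i h * (f \o jump i h - f); rates of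
   jumps with the same target add up. *)
Definition rw_generator l l' : R :=
  \sum_i \sum_(h <- nbrs)
    rw_rate i h l * ((l' == jump i h l)%:R - (l' == l)%:R).

(* Component of sign s of the empirical measure of (l, b) *)
Definition empirical l (s : bool) (x : site m) : R :=
  n%:R^-1 * \sum_(i | b i == s) (l i == x)%:R.

End RandomWalk.

Record standing_assumptions {R : realType} (CV cbeta Cbeta eps delta : R)
    (n : nat) (beta T : R) (V : plane R -> R) : Prop := {
  sa_eps : 0 < eps;
  sa_delta : eps <= delta <= 1;
  sa_n : (2 <= n)%N;
  sa_beta0 : 0 < beta;
  sa_T : 1 <= T;
  sa_beta : cbeta <= beta <= Cbeta * delta / eps;
  sa_V_periodic : periodic V;
  sa_V_C5 : Ck 5 V;
  sa_V_sup : (supnorm V <= (CV * ln (delta^-1))%:E)%E;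
  sa_V_dk : forall k, (1 <= k <= 5)%N ->
    (dk_norm k V <= (CV * delta ^- k)%:E)%E
}.

(* Main.v *)
Require Import Defs.
From mathcomp Require Import all_boot all_order all_algebra.
From mathcomp Require Import all_classical all_reals all_analysis.
From mathcomp Require Import measurable_realfun ess_sup_inf.
From mathcomp Require Import ring lra zify.
Set Implicit Arguments.
Unset Strict Implicit.
Unset Printing Implicit Defensive.

Import Order.TTheory GRing.Theory Num.Theory.
Import numFieldNormedType.Exports.

Local Open Scope classical_set_scope.
Local Open Scope ring_scope.

(** Only the law of the configuration at one time matters, and that law evolves
    by the semigroup P_t of the generator [rw_generator] on a finite set. It is
    compared with the law [flow_law t] of independent particles, particle i
    having the law rho_t^(b_i) normalized to mass one. Both laws agree at time 0.

    Let f be the dual norm of the error at time t, as a function of the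
    configuration, and let Phi(u) be the mean of P_(t-u) f under [flow_law u].
    Then Phi(0) is the expectation to be bounded, and Phi(t) is its analogue for
    independent particles. The derivative of Phi ([interpolation_derive]) is the
    mean of the sum over all jumps of
      (mean-field rate - pair rate) * (increment of P_(t-u) f along the jump).
    The rates differ by a constant times the difference of the forces. For
    independent particles that difference is, up to the imbalance kappa and a
    term in 1/n, a normalized sum of centred independent terms, so its mean is
    of order (1/sqrt n + kappa) / delta ([mean_force_error]).

    The increments are bounded because P_t propagates Lipschitz bounds
    ([rw_semigroup_lipschitz]). Let two copies of the walk jump together at the
    minimum of their rates: their distance grows only through the differences
    of the rates, which the second derivative of V bounds by C delta^-2 times the
    distance. A coupled process is not constructed: its generator appears only
    inside a maximum principle on pairs of configurations
    ([semigroup_lipschitz]). Integrating the derivative of Phi gives the last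
    term of the estimate ([law_comparison]).

    For independent particles, a Lipschitz test function is expanded along dyadic
    partitions of the torus ([dyadic_chaining]). The 4^k cells of level k cost
    2^-k times the total fluctuation 2^k / sqrt n of their masses, hence
    1 / sqrt n per level, and about log n levels reach the scale 1/n. The mass
    defect of each sign contributes kappa ([mean_dual_norm]).

    All this uses test functions through their values and increments only, while
    [bl_test] controls a weak gradient. Tested against the difference of two
    translates of a Fejer kernel, which is the derivative of a trigonometric
    polynomial whose L^1 norm is the length of the translation, the weak gradient
    gives the Lipschitz bound ([bl_test_lipschitz]). *)

(** * Finite sums and products of limits and derivatives *)

Lemma cvg_sum (T I : Type) (K : numFieldType) (F : set_system T) (FF : Filter F) (r : seq I)
    (P : pred I) (f : I -> T -> K) (l : I -> K) :
  (forall i, P i -> f i t @[t --> F] --> l i) ->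
  \sum_(i <- r | P i) f i t @[t --> F] --> \sum_(i <- r | P i) l i.
Proof.
move=> fl; elim: r => [|i r IH].
  by rewrite big_nil; under eq_fun do rewrite big_nil; exact: cvg_cst.
rewrite big_cons; under eq_fun do rewrite big_cons.
by case: ifP => Pi //; apply: cvgD => //; exact: fl.
Qed.

Lemma is_derive_bigsum (R : realType) (I : Type) (r : seq I) (P : pred I)
    (f : I -> R -> R) (l : I -> R) (x : R) :
  (forall i, P i -> is_derive x 1 (f i) (l i)) ->
  is_derive x 1 (fun t => \sum_(i <- r | P i) f i t) (\sum_(i <- r | P i) l i).
Proof.
move=> fl; elim: r => [|i r IH].
  by rewrite big_nil; under eq_fun do rewrite big_nil; exact: is_derive_cst.
rewrite big_cons; under eq_fun do rewrite big_cons.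
by case: ifP => Pi //; apply: is_deriveD => //; exact: fl.
Qed.

Lemma cvg_prod (T I : Type) (K : numFieldType) (F : set_system T) (FF : Filter F) (r : seq I)
    (f : I -> T -> K) (l : I -> K) :
  (forall i, f i t @[t --> F] --> l i) ->
  \prod_(i <- r) f i t @[t --> F] --> \prod_(i <- r) l i.
Proof.
move=> fl; elim: r => [|i r IH].
  by rewrite big_nil; under eq_fun do rewrite big_nil; exact: cvg_cst.
by rewrite big_cons; under eq_fun do rewrite big_cons; apply: cvgM.
Qed.

Lemma is_derive_bigprod (R : realType) (I : eqType) (r : seq I) (f : I -> R -> R)
    (l : I -> R) (x : R) : uniq r ->
  (forall i, is_derive x 1 (f i) (l i)) ->
  is_derive x 1 (fun t => \prod_(i <- r) f i t)
    (\sum_(i <- r) l i * \prod_(k <- r | k != i) f k x).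
Proof.
move=> + fl; elim: r => [_|i r IH /= /andP[ir ur]].
  rewrite big_nil; under eq_fun do rewrite big_nil; exact: is_derive_cst.
under eq_fun do rewrite big_cons.
have D := is_deriveM (fl i) (IH ur).
apply: is_derive_eq; rewrite big_cons big_cons eqxx /= /GRing.scale /= addrC; congr (_ + _).
  rewrite mulrC; congr (_ * _); rewrite big_seq [RHS]big_seq_cond.
  apply: eq_bigl => k; case: (boolP (k \in r)) => //= kr.
  by apply/esym; apply: contraNneq ir => <-.
rewrite mulr_sumr; apply: eq_big_seq => j jr.
rewrite big_cons; case: eqP => [ij|_ /=]; last by ring.
by move: ir; rewrite ij jr.
Qed.

(** * A maximum principle for finite families of functions *)

(** Unlike the usual criterion at an extremum, this one looks to the left only, so
    that it applies at the right end of the interval on which a minimum is taken. *)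
Lemma derive_gt0_decr_left (R : realType) (f : R -> R) (c l a : R) :
  is_derive c 1 f l -> 0 < l -> a < c -> exists2 s, a < s < c & f s < f c.
Proof.
move=> fl l0 ac.
have [/cvg_ex[l' Hl'] fE] := fl.
have l'E : l' = l by rewrite -fE /derive; apply/esym/cvg_lim.
subst l'.
have : \forall h \near 0^', 0 < h^-1 *: ((f \o shift c) (h *: 1) - f c).
  by apply: (cvgr_gt l Hl') => //.
case/nbhs_ballP => e /= e0 He.
pose h := Num.min (e / 2) ((c - a) / 2).
have h0 : 0 < h by rewrite lt_min !divr_gt0 ?subr_gt0.
have he : h < e by rewrite gt_min; apply/orP; left; lra.
have hc : h < c - a by rewrite gt_min; apply/orP; right; lra.
have hN0 : - h != 0 by rewrite oppr_eq0 gt_eqF.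
have bh : ball (0 : R) e (- h).
  by rewrite /ball /= sub0r opprK ger0_norm // ltW.
exists (c - h); first by apply/andP; split; lra.
have /= := He _ bh hN0.
rewrite /GRing.scale /= mulr1 [- h + c]addrC => H.
have : - h * ((- h)^-1 * (f (c - h) - f c)) < 0 by rewrite pmulr_llt0 // oppr_lt0.
by rewrite mulVKf // subr_lt0.
Qed.

(** If some [u t0 i0] were negative, then [expR (- (K + 1) * t) * u t i] would have a
    negative minimum over [0, t0] and all i, at a positive time. There the
    hypothesis makes its derivative positive, so it was smaller just before. *)
Lemma max_principle_oo (R : realType) (I : finType) (T K : R) (u du : R -> I -> R) :
  (forall i, {within `[0, T], continuous (fun t => u t i)}) ->
  (forall (t : R) i, 0 < t < T -> is_derive t 1 (fun t => u t i) (du t i)) ->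
  (forall i, 0 <= u 0 i) ->
  (forall (t : R) i, 0 < t < T -> u t i < 0 -> (forall j, u t i <= u t j) ->
     K * u t i <= du t i) ->
  forall (t : R) i, 0 <= t < T -> 0 <= u t i.
Proof.
move=> uc uD u0 uK t0 i0 /andP[t00 t0T]; rewrite leNgt; apply/negP => ut0.
pose e (t : R) := expR (- (K + 1) * t).
pose v t i := e t * u t i.
have ec : continuous e.
  by move=> x; apply: continuous_comp; [exact: mulrl_continuous|exact: continuous_expR].
have eD (t : R) : is_derive t (1 : R) e (- (K + 1) * e t).
  rewrite /e; apply: is_derive_eq.
  by rewrite /GRing.scale /= mulr1 mulrC.
have vc i : {within `[0, t0], continuous (fun t => v t i)}.
  apply: (@continuous_subspaceW _ _ _ `[0, T]).
    by apply: subset_itvl; rewrite bnd_simp ltW.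
  by move=> x; apply: continuousM; [exact: continuous_subspaceT|exact: uc].
have H i : exists c, c \in `[0, t0] /\ forall t, t \in `[0, t0] -> v c i <= v t i.
  by have [c] := EVT_min t00 (vc i); exists c.
have [c Hc] := choice H.
pose i := [arg min_(i < i0) v (c i) i]%O.
have imin j : v (c i) i <= v (c j) j by rewrite /i; case: arg_minP => // k _; exact.
have [ci _] := Hc i.
have cmin t j : t \in `[0, t0] -> v (c i) i <= v t j.
  by move=> tt; apply: le_trans (imin j) _; have [_] := Hc j; exact.
have vneg : v (c i) i < 0.
  apply: le_lt_trans (cmin t0 i0 _) _; first by rewrite in_itv /= t00 lexx.
  by rewrite pmulr_rlt0 ?expR_gt0.
have uneg : u (c i) i < 0 by move: vneg; rewrite pmulr_rlt0 ?expR_gt0.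
move: ci; rewrite in_itv /= => /andP[c0 ct0].
have cpos : 0 < c i.
  rewrite lt_neqAle c0 andbT eq_sym; apply/negP => /eqP cE.
  by move: uneg; rewrite cE ltNge u0.
have cT : 0 < c i < T by rewrite cpos (le_lt_trans ct0).
have umin j : u (c i) i <= u (c i) j.
  have := cmin (c i) j; rewrite in_itv /= c0 ct0 => /(_ isT).
  by rewrite ler_pM2l ?expR_gt0.
have duge := uK _ _ cT uneg umin.
have D := uD _ i cT.
have DM := is_deriveM (eD (c i)) D.
have [] := derive_gt0_decr_left DM _ cpos.
  rewrite /GRing.scale /=; have := expR_gt0 (- (K+1) * c i); rewrite -/(e _) => epos.
  rewrite (_ : _ + _ = e (c i) * (du (c i) i - (K + 1) * u (c i) i)); last by ring.
  rewrite mulr_gt0 //; lra.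
move=> s /andP[s0 sc] /=; rewrite ltNge => /negP; apply.
by apply: cmin; rewrite in_itv /= (ltW s0) (le_trans (ltW sc)).
Qed.

(** The differential inequality is required only where [u t] attains a negative
    minimum over the index; this suits generators, whose off-diagonal
    part is nonnegative at a minimum. *)
Lemma max_principle (R : realType) (I : finType) (T K : R) (u du : R -> I -> R) :
  (forall i, {within `[0, T], continuous (fun t => u t i)}) ->
  (forall (t : R) i, 0 < t < T -> is_derive t 1 (fun t => u t i) (du t i)) ->
  (forall i, 0 <= u 0 i) ->
  (forall (t : R) i, 0 < t < T -> u t i < 0 -> (forall j, u t i <= u t j) ->
     K * u t i <= du t i) ->
  forall (t : R) i, 0 <= t <= T -> 0 <= u t i.
Proof.
move=> uc uD u0 uK t i /andP[t0]; rewrite le_eqVlt => /predU1P[tT|tT]; last first.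
  by apply: (max_principle_oo uc uD u0 uK); rewrite t0.
move: t0; rewrite le_eqVlt => /predU1P[<-//|t0].
have T0 : 0 < T by rewrite -tT.
have [_ _ /= cl] := (continuous_within_itvP _ T0).1 (uc i).
rewrite tT -(cvg_lim _ cl) //.
apply: limr_ge; first by apply/cvg_ex; eexists; exact: cl.
near=> s; apply: (max_principle_oo uc uD u0 uK); apply/andP; split=> //.
by near: s; exact: nbhs_left_ge.
Unshelve. all: by end_near.
Qed.

(** * Semigroups on finite sets *)

Section Semigroup.
Context (R : realType) (S : finType) (Q : S -> S -> R) (p : R -> S -> S -> R).
Hypothesis pS : transition_semigroup Q p.

Let p0 t x y : 0 <= t -> 0 <= p t x y. Proof. by have [H _ _ _ _] := pS; exact: H. Qed.
Let p1 t x : 0 <= t -> \sum_y p t x y = 1. Proof. by have [_ H _ _ _] := pS; exact: H. Qed.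
Let pid x y : p 0 x y = (x == y)%:R. Proof. by have [_ _ H _ _] := pS; exact: H. Qed.
Let pD s t x z : 0 <= s -> 0 <= t -> p (s + t) x z = \sum_y p s x y * p t y z.
Proof. by have [_ _ _ H _] := pS; exact: H. Qed.
Let pQ x y : (p t x y - (x == y)%:R) / t @[t --> 0^'+] --> Q x y.
Proof. by have [_ _ _ _ H] := pS; exact: H. Qed.

Let p_le1 t x y : 0 <= t -> p t x y <= 1.
Proof.
by move=> t0; rewrite -(p1 x t0) (bigD1 y) //= lerDl sumr_ge0 // => z _; exact: p0.
Qed.

Let increment h t x y : 0 <= h -> 0 <= t ->
  p (h + t) x y - p t x y = \sum_z (p h x z - (x == z)%:R) * p t z y.
Proof.
move=> h0 t0; rewrite pD // -(eq_bigr _ (fun _ _ => esym (mulrBl _ _ _))) sumrB.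
congr (_ - _); rewrite (bigD1 x) //= eqxx mul1r big1 ?addr0 // => z zx.
by rewrite eq_sym (negbTE zx) mul0r.
Qed.

(* by [increment], this modulus controls p (h + t) x y - p t x y uniformly in t *)
Let osc h x := \sum_z `|p h x z - (x == z)%:R|.

Lemma semigroup_cvg0 x y : p t x y @[t --> 0^'+] --> p 0 x y.
Proof.
rewrite pid.
have : ((p t x y - (x == y)%:R) / t * t + (x == y)%:R) @[t --> 0^'+] -->
    Q x y * 0 + (x == y)%:R.
  apply: cvgD; last exact: cvg_cst.
  apply: cvgM; first exact: pQ.
  exact: cvg_at_right_filter.
rewrite mulr0 add0r; apply: cvg_trans.
apply: near_eq_cvg; near=> t.
have t0 : 0 < t by near: t; exact: nbhs_right_gt.
by rewrite divfK ?subrK // gt_eqF.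
Unshelve. all: by end_near. Qed.

Let osc_cvg0 x : osc t x @[t --> 0^'+] --> (0 : R).
Proof.
have : osc t x @[t --> 0^'+] --> \sum_(z : S) `|p 0 x z - (x == z)%:R|.
  apply: cvg_sum => z _; apply: cvg_norm.
  by apply: cvgB; [exact: semigroup_cvg0|exact: cvg_cst].
by rewrite big1 // => z _; rewrite pid subrr normr0.
Qed.

Let dist_osc s t x y : 0 <= s -> 0 <= t -> `|p s x y - p t x y| <= osc `|s - t| x.
Proof.
wlog st : s t / t <= s.
  move=> H s0 t0; have [|/ltW] := leP t s; first by move=> ?; exact: H.
  by move=> st; rewrite distrC [`|s - t|]distrC; exact: H.
move=> s0 t0; rewrite [`|s - t|]ger0_norm ?subr_ge0 //.
rewrite -{1}(subrK t s) increment ?subr_ge0 //.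
apply: le_trans (ler_norm_sum _ _ _) _; apply: ler_sum => z _.
rewrite normrM ler_piMr // ger0_norm ?p_le1 // p0 //.
Qed.

Let near_norm (P : R -> Prop) :
  (\forall k \near (0 : R)^'+, P k) -> \forall h \near (0 : R)^', P `|h|.
Proof.
case/nbhs_ballP => e /= e0 He; apply/nbhs_ballP; exists e => //= h hb h0.
apply: He; last by rewrite normr_gt0.
by move: hb; rewrite /ball /= !sub0r !normrN normr_id.
Qed.

Lemma semigroup_continuous (t : R) x y : 0 < t -> {for t, continuous (fun t => p t x y)}.
Proof.
move=> t0; apply/cvgrPdist_lt => e e0.
have : \forall k \near (0 : R)^'+, osc k x < e.
  have := @cvgr_lt _ _ _ _ (osc^~ x) _ (@osc_cvg0 x); exact.
case/nbhs_ballP => r /= r0 Hr; apply/nbhs_ballP.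
exists (Num.min r t); rewrite /= ?lt_min ?r0 // => s; rewrite /ball /= lt_min => /andP[sr st].
have [->|st'] := eqVneq s t; first by rewrite subrr normr0.
have s0 : 0 <= s by move: st; rewrite ltr_distlC => /andP[]; lra.
apply: le_lt_trans (dist_osc _ _ _ _) _; rewrite ?(ltW t0) //.
apply: Hr; rewrite ?normr_gt0 ?subr_eq0 1?eq_sym//.
by rewrite /ball /= sub0r normrN normr_id.
Qed.

(** The semigroup is only assumed right differentiable at 0. For every small h, the
    quotient at t is the quotient of p at 0 for the time |h|, applied to p at
    the time [Num.min t (t + h)]; continuity of p turns this into a two-sided
    derivative. *)
Lemma semigroup_derive (t : R) x y : 0 < t ->
  is_derive t 1 (fun t => p t x y) (\sum_z Q x z * p t z y).
Proof.
move=> t0.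
suff H : h^-1 *: (((fun t => p t x y) \o shift t) (h *: (1:R)) - p t x y) @[h --> (0 : R)^']
    --> \sum_z Q x z * p t z y.
  by split; [apply/cvg_ex; eexists; exact: H | apply/cvg_lim; [|exact: H]].
apply: (@cvg_trans _ (\sum_z ((p `|h| x z - (x == z)%:R) / `|h|) *
    p (Num.min t (t + h)) z y @[h --> (0 : R)^'])).
  apply: near_eq_cvg; near=> h.
  have h0 : h != 0 by near: h; exact: nbhs_dnbhs_neq.
  have ht : `|h| < t by near: h; apply: dnbhs0_lt.
  have th : 0 < t + h by move: ht; rewrite ltr_norml => /andP[]; lra.
  rewrite /= /GRing.scale /= mulr1.
  under eq_bigr do rewrite mulrAC.
  rewrite -mulr_suml -increment //; last by rewrite le_min !ltW.
  have [hp|hn] := ltP 0 h.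
    rewrite gtr0_norm // min_l; last by lra.
    by rewrite mulrC.
  rewrite ler0_norm // min_r; last by lra.
  by rewrite [h + t]addrC [t + h]addrC addKr addrC invrN mulrN -mulNr opprB mulrC.
apply: cvg_sum => z _; apply: cvgM.
  apply/cvgrPdist_lt => e e0.
  by apply: (near_norm (P := fun k => `|Q x z - (p k x z - (x == z)%:R) / k| < e));
   move/cvgrPdist_lt: (@pQ x z) => /(_ e e0).
have Hc : {for t, continuous (fun t => p t z y)} by exact: semigroup_continuous.
apply: (@cvg_comp _ _ _ (fun h => Num.min t (t + h)) (fun t => p t z y) _ (nbhs t)); last exact: Hc.
have : Num.min t (t + h) @[h --> (0 : R)^'] --> Num.min t (t + 0).
  apply: cvg_within_filter.
  apply: (@continuous_min _ _ (cst t) (fun h => t + h) 0); first exact: cvg_cst.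
  by apply: cvgD; [exact: cvg_cst|exact: cvg_id].
by rewrite addr0 minxx.
Unshelve. all: by end_near. Qed.

Definition semigroup_op (t : R) (f : S -> R) (x : S) : R := \sum_y p t x y * f y.

Lemma semigroup_op0 f x : semigroup_op 0 f x = f x.
Proof.
rewrite /semigroup_op (bigD1 x) //= pid eqxx mul1r big1 ?addr0 // => y yx.
by rewrite pid eq_sym (negbTE yx) mul0r.
Qed.

Lemma semigroup_op_derive f (t : R) x : 0 < t ->
  is_derive t 1 (fun t => semigroup_op t f x) (\sum_z Q x z * semigroup_op t f z).
Proof.
move=> t0; rewrite /semigroup_op.
rewrite [X in is_derive _ _ _ X](_ : _ =
    \sum_y f y * (\sum_z Q x z * p t z y)); last first.
  under eq_bigr do rewrite mulr_sumr.
  rewrite exchange_big /=; apply: eq_bigr => y _; rewrite mulr_sumr.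
  by apply: eq_bigr => z _; ring.
apply: is_derive_bigsum => y _.
have D := @semigroup_derive t x y t0.
by apply: is_derive_eq; rewrite /GRing.scale /= mulr0 add0r.
Qed.

Lemma semigroup_op_continuous f (T : R) x : 0 < T ->
  {within `[0, T], continuous (fun t => semigroup_op t f x)}.
Proof.
move=> T0; have C t : 0 < t -> {for t, continuous (fun t => semigroup_op t f x)}.
  move=> t0; apply: cvg_sum => y _; apply: cvgM; last exact: cvg_cst.
  exact: semigroup_continuous.
apply/continuous_within_itvP => //; split.
- by move=> t; rewrite in_itv /= => /andP[t0 _]; exact: C.
- apply: cvg_sum => y _; apply: cvgM; last exact: cvg_cst.
  exact: semigroup_cvg0.
- by apply: cvg_at_left_filter; exact: C.
Qed.

End Semigroup.

(** * Propagation of Lipschitz bounds by coupling *)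

Section CoupledJumps.
Context (R : realType) (S : finType) (J : eqType) (r : seq J).
Context (rate : J -> S -> R) (jmp : J -> S -> S).

Definition jump_generator (x y : S) : R :=
  \sum_(j <- r) rate j x * ((y == jmp j x)%:R - (y == x)%:R).

Lemma jump_generator_apply (g : S -> R) x :
  \sum_z jump_generator x z * g z = \sum_(j <- r) rate j x * (g (jmp j x) - g x).
Proof.
have pick a : \sum_z (z == a)%:R * g z = g a.
  rewrite (bigD1 a) //= eqxx mul1r big1 ?addr0 // => z za.
  by rewrite (negbTE za) mul0r.
under eq_bigr do rewrite mulr_suml.
rewrite exchange_big /=; apply: eq_bigr => j _.
under eq_bigr do rewrite -mulrA mulrBl.
by rewrite -mulr_sumr sumrB !pick.
Qed.

Hypothesis rate_ge0 : forall j x, 0 <= rate j x.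

(** One term of the coupled generator. The two copies jump together at the rate
    [Num.min (rate j x) (rate j y)], which cannot increase [d], and the faster copy
    jumps alone at the remaining rate [`|rate j x - rate j y|], which costs [e].
    The last hypothesis says that [D * d - (F x - F y)] is minimal at [(x, y)]. *)
Lemma coupled_jump (D e : R) (j : J) (d : S -> S -> R) (F : S -> R) x y :
  0 <= D ->
  d (jmp j x) (jmp j y) <= d x y ->
  d (jmp j x) y <= d x y + e -> d x (jmp j y) <= d x y + e ->
  (forall x' y', D * d x y - (F x - F y) <= D * d x' y' - (F x' - F y')) ->
  rate j x * (F (jmp j x) - F x) - rate j y * (F (jmp j y) - F y) <=
    D * (`|rate j x - rate j y| * e).
Proof.
move=> D0 dxy dx dy min.
set r1 := rate j x; set r2 := rate j y.
set A := F (jmp j x); set B := F (jmp j y).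
have r10 : 0 <= r1 by exact: rate_ge0.
have r20 : 0 <= r2 by exact: rate_ge0.
have h1 : A - B - (F x - F y) <= 0.
  have := min (jmp j x) (jmp j y); have := ler_wpM2l D0 dxy.
  by rewrite -/A -/B; lra.
have h2 : A - F x <= D * e.
  have := min (jmp j x) y; have := ler_wpM2l D0 dx; rewrite mulrDr.
  by rewrite -/A; lra.
have h3 : F y - B <= D * e.
  have := min x (jmp j y); have := ler_wpM2l D0 dy; rewrite mulrDr.
  by rewrite -/B; lra.
have [r12|r21] := leP r1 r2.
  rewrite ler0_norm ?subr_le0 // opprB.
  have := ler_wpM2l r10 h1; rewrite mulr0.
  have r120 : 0 <= r2 - r1 by rewrite subr_ge0.
  have := ler_wpM2l r120 h3; lra.
rewrite ger0_norm ?subr_ge0 ?(ltW r21) //.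
have := ler_wpM2l r20 h1; rewrite mulr0.
have r120 : 0 <= r1 - r2 by rewrite subr_ge0 ltW.
have := ler_wpM2l r120 h2; lra.
Qed.

(** The maximum principle on pairs, for the difference between the claimed bound and
    the increment of the semigroup. The hypothesis with [K] bounds the growth
    rate of [d] under the coupled generator. *)
Lemma semigroup_lipschitz (p : R -> S -> S -> R) (d : S -> S -> R) (f : S -> R)
    (K L e t : R) :
  transition_semigroup jump_generator p ->
  (forall j x y, j \in r -> d (jmp j x) (jmp j y) <= d x y) ->
  (forall j x y, j \in r -> d (jmp j x) y <= d x y + e) ->
  (forall j x y, j \in r -> d x (jmp j y) <= d x y + e) ->
  (forall x y, \sum_(j <- r) `|rate j x - rate j y| * e <= K * d x y) ->
  0 <= L -> (forall x y, f x - f y <= L * d x y) -> 0 <= t ->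
  forall x y, semigroup_op p t f x - semigroup_op p t f y <=
    L * expR (K * t) * d x y.
Proof.
move=> pS d2 dl dr dK L0 fL t0 x y.
pose F t := semigroup_op p t f.
pose u (s : R) (xy : S * S) := L * expR (K * s) * d xy.1 xy.2 - (F s xy.1 - F s xy.2).
suff : 0 <= u t (x, y) by rewrite /u /F /= subr_ge0.
pose gen g x := \sum_(j <- r) rate j x * (g (jmp j x) - g x).
pose du (s : R) (xy : S * S) := K * (L * expR (K * s)) * d xy.1 xy.2 -
  (gen (F s) xy.1 - gen (F s) xy.2).
have eD (s : R) : is_derive s (1 : R) (fun s => expR (K * s)) (K * expR (K * s)).
  by apply: is_derive_eq; rewrite /GRing.scale /= mulr1 mulrC.
have T0 : 0 < t + 1 by lra.
apply: (@max_principle R (S * S)%type (t + 1) 0 u du).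
- move=> [a b]; rewrite /u /= => z; apply: cvgB; last first.
    by apply: cvgB; exact: (semigroup_op_continuous pS).
  have Ec : continuous (fun s : R => L * expR (K * s) * d a b).
    move=> {}z; apply: (@continuousM R R (fun s => L * expR (K * s)) (cst (d a b)));
      last exact: cvg_cst.
    apply: (@continuousM R R (cst L) (fun s => expR (K * s))); first exact: cvg_cst.
    by apply: continuous_comp; [exact: mulrl_continuous|exact: continuous_expR].
  by move: z; exact: continuous_subspaceT.
- move=> s [a b] /andP[s0 _] /=; rewrite /u /=.
  apply: is_deriveB.
    have := eD s => {}eD.
    by apply: is_derive_eq; rewrite /GRing.scale /=; ring.
  apply: is_deriveB; rewrite /gen -jump_generator_apply;
  exact: (semigroup_op_derive pS).
- by move=> [a b]; rewrite /u /F /= !(semigroup_op0 pS) mulr0 expR0 mulr1 subr_ge0.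
- move=> s [a b] /andP[s0 _] _ min; rewrite mul0r /du /=.
  have D0 : 0 <= L * expR (K * s) by rewrite mulr_ge0 ?expR_ge0.
  rewrite subr_ge0 /gen -sumrB.
  apply: (@le_trans _ _ (\sum_(j <- r) L * expR (K * s) * (`|rate j a - rate j b| * e))).
    rewrite big_seq [leRHS]big_seq; apply: ler_sum => j jr.
    apply: (@coupled_jump _ _ _ d) => //; [exact: d2|exact: dl|exact: dr|].
    by move=> x' y'; have := min (x', y').
  rewrite -mulr_sumr; have := ler_wpM2l D0 (dK a b); lra.
- by rewrite t0 lerDl ler01.
Qed.

End CoupledJumps.

(** * Product measures *)

Section ProductMeasure.
Context (R : realType) (A : finType) (n : nat).
Implicit Types (q : 'I_n -> A -> R) (x : {ffun 'I_n -> A}).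

Definition product_weight q x : R := \prod_i q i (x i).

Definition product_mean q (phi : {ffun 'I_n -> A} -> R) : R :=
  \sum_x product_weight q x * phi x.

Definition update (j : 'I_n) (a : A) x : {ffun 'I_n -> A} :=
  [ffun k => if k == j then a else x k].

Lemma update_same j a x : update j a x j = a.
Proof. by rewrite ffunE eqxx. Qed.

Lemma update_other j a x k : k != j -> update j a x k = x k.
Proof. by move=> kj; rewrite ffunE (negbTE kj). Qed.

Lemma updateK j a x : update j (x j) (update j a x) = x.
Proof. by apply/ffunP => k; rewrite !ffunE; case: eqP => [->|]. Qed.

Lemma product_weight_update q j a x :
  product_weight q x * q j a = product_weight q (update j a x) * q j (x j).
Proof.
rewrite /product_weight (bigD1 j) //= [in RHS](bigD1 j) //= update_same.
have -> : \prod_(k | k != j) q k (update j a x k) = \prod_(k | k != j) q k (x k).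
  by apply: eq_bigr => k kj; rewrite update_other.
ring.
Qed.

Lemma product_weight_sum q : (forall i, \sum_a q i a = 1) -> \sum_x product_weight q x = 1.
Proof. by move=> q1; rewrite -bigA_distr_bigA big1. Qed.

(** Exchanging the coordinate j with an independent copy of it is an involution that
    preserves the weights. *)
Lemma product_mean_resample q j phi : \sum_a q j a = 1 ->
  product_mean q phi = product_mean q (fun x => \sum_a q j a * phi (update j a x)).
Proof.
move=> q1; rewrite /product_mean.
under [RHS]eq_bigr do rewrite mulr_sumr.
rewrite pair_big /=.
pose sw (xa : {ffun 'I_n -> A} * A) := (update j xa.2 xa.1, xa.1 j).
have swK : involutive sw by move=> [x a]; rewrite /sw /= updateK update_same.
rewrite (reindex_inj (inv_inj swK)) /=.
under [RHS]eq_bigr => xa _ do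
  rewrite updateK mulrA -product_weight_update -mulrA [_ * phi _]mulrC mulrA.
rewrite -(pair_big xpredT xpredT (fun x a => product_weight q x * phi x * q j a)) /=.
by apply: eq_bigr => x _; rewrite -mulr_sumr q1 mulr1.
Qed.

Lemma eq_product_mean q phi psi : phi =1 psi -> product_mean q phi = product_mean q psi.
Proof. by move=> e; apply: eq_bigr => x _; rewrite e. Qed.

Lemma product_mean_sum q (I : Type) (r : seq I) (P : pred I) (phi : I -> {ffun 'I_n -> A} -> R) :
  product_mean q (fun x => \sum_(i <- r | P i) phi i x) =
  \sum_(i <- r | P i) product_mean q (phi i).
Proof.
rewrite /product_mean; under eq_bigr do rewrite mulr_sumr.
by rewrite exchange_big.
Qed.

Lemma product_meanZ q c phi : product_mean q (fun x => c * phi x) = c * product_mean q phi.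
Proof. by rewrite /product_mean mulr_sumr; apply: eq_bigr => x _; ring. Qed.

Lemma product_meanD q phi psi :
  product_mean q (fun x => phi x + psi x) = product_mean q phi + product_mean q psi.
Proof. by rewrite /product_mean -big_split; apply: eq_bigr => x _; rewrite /= mulrDr. Qed.

Lemma product_mean_cst q c : (forall i, \sum_a q i a = 1) ->
  product_mean q (fun=> c) = c.
Proof. by move=> q1; rewrite /product_mean -mulr_suml product_weight_sum // mul1r. Qed.

Lemma product_mean_coord q j (psi : A -> R) : (forall i, \sum_a q i a = 1) ->
  product_mean q (fun x => psi (x j)) = \sum_a q j a * psi a.
Proof.
move=> q1; rewrite (@product_mean_resample _ j) //.
under eq_product_mean do under eq_bigr do rewrite update_same.
by rewrite product_mean_cst.
Qed.

Lemma ler_product_mean q phi psi : (forall i a, 0 <= q i a) ->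
  (forall x, phi x <= psi x) -> product_mean q phi <= product_mean q psi.
Proof.
move=> q0 pp; apply: ler_sum => x _; apply: ler_wpM2l (pp x).
by rewrite prodr_ge0.
Qed.

Lemma product_mean_centered q j phi psi : \sum_a q j a = 1 ->
  (forall x, \sum_a q j a * phi (update j a x) = 0) ->
  (forall a x, psi (update j a x) = psi x) ->
  product_mean q (fun x => phi x * psi x) = 0.
Proof.
move=> q1 phi0 psij; rewrite (@product_mean_resample _ j) //.
rewrite /product_mean big1 // => x _; under eq_bigr do rewrite psij mulrA.
by rewrite -mulr_suml phi0 mul0r mulr0.
Qed.

(** The hypotheses are invariant under resampling rather than independence, so that
    the terms may also depend on a common coordinate outside [P]. *)
Lemma product_variance q (P : pred 'I_n) (Z : 'I_n -> {ffun 'I_n -> A} -> R) :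
  (forall i, \sum_a q i a = 1) ->
  (forall j x, P j -> \sum_a q j a * Z j (update j a x) = 0) ->
  (forall j k a x, P j -> P k -> k != j -> Z k (update j a x) = Z k x) ->
  product_mean q (fun x => (\sum_(j | P j) Z j x) ^+ 2) =
  \sum_(j | P j) product_mean q (fun x => Z j x ^+ 2).
Proof.
move=> q1 Z0 Zk.
under eq_product_mean do rewrite expr2 mulr_suml.
rewrite product_mean_sum; apply: eq_bigr => j Pj.
under eq_product_mean do rewrite mulr_sumr.
rewrite product_mean_sum (bigD1 j) //= [X in _ + X]big1 ?addr0.
  by apply: eq_product_mean => x; rewrite expr2.
move=> k /andP[Pk kj]; apply: (product_mean_centered (j := j)) => //.
- by move=> x; exact: Z0.
- by move=> a x; exact: Zk.
Qed.

(** From 2 |z| <= lam z^2 + 1 / lam; keeping [lam] free postpones the optimization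
    until the bounds have been summed. *)
Lemma product_mean_norm_le q phi (lam v : R) : (forall i a, 0 <= q i a) ->
  (forall i, \sum_a q i a = 1) -> 0 < lam ->
  product_mean q (fun x => phi x ^+ 2) <= v ->
  product_mean q (fun x => `|phi x|) <= (lam * v + lam^-1) / 2.
Proof.
move=> q0 q1 l0 hv.
apply: (@le_trans _ _ (product_mean q (fun x => (lam / 2) * phi x ^+ 2 + lam^-1 / 2))).
  apply: ler_product_mean => // x; rewrite -(real_normK (num_real (phi x))).
  set z := `|phi x|; rewrite -subr_ge0.
  rewrite (_ : _ - _ = (lam * z - 1) ^+ 2 / (2 * lam)); last by field; rewrite gt_eqF.
  by rewrite divr_ge0 ?sqr_ge0 // mulr_ge0 // ltW.
rewrite product_meanD product_meanZ product_mean_cst //.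
have : lam / 2 * product_mean q (fun x => phi x ^+ 2) <= lam / 2 * v.
  by rewrite ler_wpM2l // divr_ge0 // ltW.
lra.
Qed.

End ProductMeasure.

Section ProductDynamics.
Context (R : realType) (A : finType) (n : nat) (H : Type) (hs : seq H).
Context (sh unsh : H -> A -> A).
Implicit Types (q : 'I_n -> A -> R) (x : {ffun 'I_n -> A}).

Definition move_coord (i : 'I_n) (f : A -> A) x : {ffun 'I_n -> A} :=
  [ffun j => if j == i then f (x j) else x j].

Hypothesis shK : forall h, cancel (sh h) (unsh h).

Lemma move_coordK i h : cancel (move_coord i (sh h)) (move_coord i (unsh h)).
Proof. by move=> x; apply/ffunP => j; rewrite !ffunE; case: eqP => // _; rewrite shK. Qed.

(** If each marginal solves its forward equation, the product solves the forward
    equation of the independent system; here tested against [F]. *)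
Lemma product_dual q (rr : 'I_n -> H -> A -> R) (F : {ffun 'I_n -> A} -> R) :
  \sum_(x : {ffun 'I_n -> A})
     (\sum_i (\sum_(h <- hs) (rr i h (unsh h (x i)) * q i (unsh h (x i))
                             - rr i h (x i) * q i (x i)))
          * \prod_(k | k != i) q k (x k)) * F x =
  product_mean q (fun x => \sum_i \sum_(h <- hs)
     rr i h (x i) * (F (move_coord i (sh h) x) - F x)).
Proof.
rewrite product_mean_sum; under eq_bigr do rewrite mulr_suml.
rewrite exchange_big /=; apply: eq_bigr => i _.
rewrite product_mean_sum; under eq_bigr do rewrite mulr_suml mulr_suml.
rewrite exchange_big /=; apply: eq_bigr => h _.
rewrite /product_mean; under eq_bigr do rewrite mulrBl mulrBl.
under [RHS]eq_bigr do rewrite mulrA mulrBr.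
rewrite !sumrB; congr (_ - _); last first.
  by apply: eq_bigr => x _; rewrite /product_weight [in RHS](bigD1 i) //=; ring.
rewrite (reindex_inj (can_inj (move_coordK i h))) /=.
apply: eq_bigr => x _; rewrite /product_weight [in RHS](bigD1 i) //= !ffunE eqxx shK.
have -> : \prod_(k | k != i) q k (move_coord i (sh h) x k) = \prod_(k | k != i) q k (x k).
  by apply: eq_bigr => k ki; rewrite ffunE (negbTE ki).
ring.
Qed.

End ProductDynamics.

(** * Integration on the unit cell *)

Section PlaneIntegral.
Context {R : realType}.
Local Notation mplane := (measurableTypeR R * measurableTypeR R)%type.
Implicit Types (f : plane R -> R).

(** An open set of the plane is a countable union of rectangles with rational
    corners, hence measurable for the product sigma-algebra. *)
Lemma open_measurable_plane (U : set (plane R)) : open U -> measurable (U : set mplane).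
Proof.
move=> oU.
pose F (q : rat * rat * (rat * rat)) : set mplane :=
  `]ratr q.1.1, ratr q.1.2[ `*` `]ratr q.2.1, ratr q.2.2[.
pose G q := if asbool (F q `<=` U) then F q else set0.
have -> : U = \bigcup_q G q.
  apply/seteqP; split => [[y1 y2] Uy|y [q _]]; last first.
    by rewrite /G; case: asboolP => // FU /FU.
  have /nbhs_ballP[e /= e0 He] := open_nbhs_nbhs (conj oU Uy).
  have [a /[!in_itv]/= /andP[a1 a2]] := @rat_in_itvoo R (y1 - e) y1 ltac:(lra).
  have [b /[!in_itv]/= /andP[b1 b2]] := @rat_in_itvoo R y1 (y1 + e) ltac:(lra).
  have [c /[!in_itv]/= /andP[c1 c2]] := @rat_in_itvoo R (y2 - e) y2 ltac:(lra).
  have [d /[!in_itv]/= /andP[d1 d2]] := @rat_in_itvoo R y2 (y2 + e) ltac:(lra).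
  exists ((a, b), (c, d)) => //; rewrite /G; case: asboolP => [_|].
    by split; rewrite /= in_itv /=; apply/andP.
  case=> -[z1 z2] [] /= /[!in_itv]/= /andP[z11 z12] /andP[z21 z22].
  by apply: He; split; rewrite /ball /= ltr_distlC; apply/andP; split; lra.
apply: countable_bigcupT_measurable; first exact: countableP.
move=> q; rewrite /G; case: asboolP => // _.
by apply: measurableX; exact: measurable_itv.
Qed.

Lemma continuous_measurable_plane f : continuous f ->
  measurable_fun setT (f : mplane -> measurableTypeR R).
Proof.
move=> /continuousP cf; apply: (measurability _ (RGenOpens.measurableE R)).
move=> _ [_ [a [b ->] <-]]; rewrite setTI; apply: open_measurable_plane.
exact/cf/interval_open.
Qed.

Lemma measurable_unit_cell : measurable (@unit_cell R).
Proof. by apply: measurableX; exact: measurable_itv. Qed.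

Lemma unit_cell_lebesgue : (@plane_lebesgue R) unit_cell = 1%E.
Proof.
rewrite /plane_lebesgue /unit_cell product_measure1E; try exact: measurable_itv.
have L : @lebesgue_measure R `[0%R, 1%R[%classic = 1%E.
  by rewrite lebesgue_measure_itv /= lte_fin ltr01 oppr0 adde0.
by apply: etrans (f_equal2 mule L L) _; rewrite mule1.
Qed.

Lemma continuous_bounded_cell f : continuous f ->
  exists M : R, forall y, unit_cell y -> `|f y| <= M.
Proof.
move=> cf.
have K : compact (`[(0:R), 1]%classic `*` `[(0:R), 1]%classic).
  by apply: compact_setX; exact: segment_compact.
have /compact_bounded[M [_ mrt]] := continuous_compact (continuous_subspaceT cf) K.
exists (M + 1) => y [/= y1 y2]; apply: (mrt (M + 1)); first by rewrite ltrDl.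
exists y => //; split => /=.
- by move: y1; rewrite !in_itv /= => /andP[-> /ltW].
- by move: y2; rewrite !in_itv /= => /andP[-> /ltW].
Qed.

Lemma continuous_integrable_cell f : continuous f ->
  plane_lebesgue.-integrable unit_cell (EFin \o (f : mplane -> R)).
Proof.
move=> cf; apply: measurable_bounded_integrable.
- exact: measurable_unit_cell.
- by apply: (@le_lt_trans _ _ 1%E); rewrite ?ltry // -unit_cell_lebesgue.
- by apply: measurable_funTS; exact: continuous_measurable_plane.
- have [M HM] := continuous_bounded_cell cf.
  exists M; split; rewrite ?num_real // => x Mx y cy.
  by apply: le_trans (HM _ cy) (ltW Mx).
Qed.

Lemma continuous_integrable_itv (a : R -> R) : continuous a ->
  lebesgue_measure.-integrable `[(0:R), 1[ (EFin \o a).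
Proof.
move=> ca.
have H : lebesgue_measure.-integrable `[(0:R), 1] (EFin \o a).
  by apply: continuous_compact_integrable; [exact: segment_compact|exact: continuous_subspaceT].
apply: integrableS H; [exact: measurable_itv|exact: measurable_itv|].
by apply: subset_itvl; rewrite bnd_simp.
Qed.

Lemma integral_unit_itv (a A : R -> R) : continuous a ->
  (forall u : R, is_derive u (1 : R) A (a u)) ->
  (\int[lebesgue_measure]_(u in `[0%R, 1%R[) (a u)%:E)%E = (A 1 - A 0)%:E.
Proof.
move=> ca dA.
have cA : continuous A by move=> u; apply/differentiable_continuous/derivable1_diffP.
rewrite integral_itv_bndo_bndc; last first.
  by apply/measurable_EFinP/measurable_funTS; exact: continuous_measurable_fun.
rewrite (@continuous_FTC2 _ _ A) //.
- exact: continuous_subspaceT.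
- split; last 2 first.
  + by apply: cvg_at_right_filter; exact: cA.
  + by apply: cvg_at_left_filter; exact: cA.
  + by move=> u _; have [] := dA u.
- by move=> u _; rewrite derive1E; have [_ ->] := dA u.
Qed.

(** Fubini and the fundamental theorem of calculus; all explicit integrals below are
    of this form. *)
Lemma integral_cell_tensor (a b A B : R -> R) : continuous a -> continuous b ->
  (forall u : R, is_derive u (1 : R) A (a u)) ->
  (forall u : R, is_derive u (1 : R) B (b u)) ->
  \int[plane_lebesgue]_(y in unit_cell) (a y.1 * b y.2) = (A 1 - A 0) * (B 1 - B 0).
Proof.
move=> ca cb dA dB.
have ch : continuous (fun y : plane R => a y.1 * b y.2).
  move=> y; apply: (@continuousM R _ (fun y : plane R => a y.1) (fun y => b y.2)).
  - by apply: (@continuous_comp _ _ _ fst a); [exact: cvg_fst|exact: ca].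
  - by apply: (@continuous_comp _ _ _ snd b); [exact: cvg_snd|exact: cb].
have ih := continuous_integrable_cell ch.
rewrite /Rintegral integral_mkcond -integral12_prod_meas1; last first.
  by apply/(integrable_mkcond _ measurable_unit_cell).
pose h : mplane -> R := fun y => a y.1 * b y.2.
have E : (\int[@lebesgue_measure R]_u fubini_F (@lebesgue_measure R)
      ((EFin \o h) \_ unit_cell) u =
    \int[lebesgue_measure]_(u in `[0%R, 1%R[) ((a u)%:E * (B 1 - B 0)%:E))%E.
  rewrite [RHS]integral_mkcond; apply: eq_integral => u _; rewrite /fubini_F /=.
  rewrite [RHS]/patch; case: ifPn => uI.
    rewrite -(integral_unit_itv cb dB) -integralZl //; last exact: continuous_integrable_itv.
    rewrite [RHS]integral_mkcond; apply: eq_integral => v _; rewrite /patch.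
    by rewrite /unit_cell in_setX uI.
  by apply: integral0_eq => v _; rewrite /patch /unit_cell in_setX (negbTE uI).
rewrite [X in fine X]E integralZr //; last exact: continuous_integrable_itv.
by rewrite (integral_unit_itv ca dA).
Qed.
End PlaneIntegral.

(** * Trigonometric polynomials on the plane *)

Section TrigPolynomials.
Context {R : realType}.
Implicit Types (f g : plane R -> R) (y v : plane R).

(** Products of cosines of affine forms are closed under differentiation, which makes
    smoothness an induction; the frequencies are arbitrary, and periodicity is
    proved separately. *)
Inductive trig_poly : (plane R -> R) -> Prop :=
| trig_poly_cst c : trig_poly (fun=> c)
| trig_poly_cos a c : trig_poly (fun y => cos (dot a y + c))
| trig_polyD f g : trig_poly f -> trig_poly g -> trig_poly (fun y => f y + g y)
| trig_polyM f g : trig_poly f -> trig_poly g -> trig_poly (fun y => f y * g y).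

Lemma is_diff_dot a y : is_diff y (dot a) (dot a).
Proof.
have d1 : is_diff y (fst : plane R -> R) fst.
  by apply: DiffDef; [apply: linear_differentiable => ?; exact: cvg_fst
                     |rewrite diff_lin // => ?; exact: cvg_fst].
have d2 : is_diff y (snd : plane R -> R) snd.
  by apply: DiffDef; [apply: linear_differentiable => ?; exact: cvg_snd
                     |rewrite diff_lin // => ?; exact: cvg_snd].
have : is_diff y (a.1 *: (fst : plane R -> R) + a.2 *: (snd : plane R -> R))
               (a.1 *: (fst : plane R -> R) + a.2 *: (snd : plane R -> R)).
  exact: is_diffD.
by [].
Qed.

Lemma trig_poly_diff f : trig_poly f -> exists df : plane R -> plane R -> R,
  (forall y, is_diff y f (df y)) /\ forall v, trig_poly (df^~ v).
Proof.
elim=> [c|a c|f1 f2 tf [df [fD tdf]] tg [dg [gD tdg]]|f1 f2 tf [df [fD tdf]] tg [dg [gD tdg]]].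
- exists (fun _ _ => 0); split=> [y|v]; last exact: trig_poly_cst.
  exact: is_diff_cst.
- exists (fun y v => - dot a v * cos (dot a y + (c - pi / 2))); split=> [y|v]; last first.
    by apply: trig_polyM; [exact: trig_poly_cst|exact: trig_poly_cos].
  have d1 : is_diff y (fun y => dot a y + c) (dot a).
    have D := is_diff_dot a y.
    by apply: is_diff_eq; rewrite addr0.
  have d2 : is_diff (dot a y + c) (@cos R) (fun h => h *: - sin (dot a y + c)).
    have D := is_derive_cos (dot a y + c).
    have dc : differentiable (@cos R) (dot a y + c).
      by apply/derivable1_diffP; have [] := D.
    apply: DiffDef => //; rewrite diff1E //; apply/funext => h.
    by rewrite derive1E; have [_ ->] := D.
  have D := is_diff_comp d1 d2.
  have -> : (fun v => - dot a v * cos (dot a y + (c - pi / 2))) =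
            (fun h => h *: - sin (dot a y + c)) \o dot a.
    apply/funext => v /=; rewrite /GRing.scale /= addrA cosBpihalf; ring.
  exact: D.
- exists (fun y v => df y v + dg y v); split=> [y|v]; last exact: trig_polyD.
  by have := is_diffD (fD y) (gD y).
- exists (fun y v => f1 y * dg y v + f2 y * df y v); split=> [y|v]; last first.
    by apply: trig_polyD; apply: trig_polyM.
  by have := is_diffM (fD y) (gD y).
Qed.

Lemma trig_poly_differentiable f y : trig_poly f -> differentiable f y.
Proof. by move=> /trig_poly_diff[df [/(_ y)[]]]. Qed.

Lemma trig_poly_smooth f : trig_poly f -> smooth f.
Proof.
move=> + k; elim: k f => [|k IH] f tf.
  by move=> y; exact/differentiable_continuous/trig_poly_differentiable.
split=> [y|v]; first exact: trig_poly_differentiable.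
have [df [dfE tdf]] := trig_poly_diff tf.
apply: IH; rewrite (_ : (fun x => _) = df^~ v) //; apply/funext => y.
by have [_ ->] := dfE y.
Qed.

Lemma trig_polyZ c f : trig_poly f -> trig_poly (fun y => c * f y).
Proof. by move=> tf; apply: trig_polyM => //; exact: trig_poly_cst. Qed.

Lemma trig_poly_sum (I : Type) (r : seq I) (P : pred I) (F : I -> plane R -> R) :
  (forall i, P i -> trig_poly (F i)) -> trig_poly (fun y => \sum_(i <- r | P i) F i y).
Proof.
move=> tF; elim: r => [|i r IH].
  by under eq_fun do rewrite big_nil; exact: trig_poly_cst.
under eq_fun do rewrite big_cons.
by case Pi: (P i) => //; apply: trig_polyD => //; exact: tF.
Qed.

(** Both sides are limits of the same difference quotient. *)
Lemma is_derive_line f y v (t l : R) : is_derive (y + t *: v) v f l <->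
  is_derive t (1 : R) (fun t : R => f (y + t *: v)) l.
Proof.
pose q1 (h : R) := h^-1 *: ((f \o shift (y + t *: v)) (h *: v) - f (y + t *: v)).
pose q2 (h : R) := h^-1 *: (((fun t => f (y + t *: v)) \o shift t) (h *: (1 : R))
                          - f (y + t *: v)).
have E : q1 = q2.
  apply/funext => h; rewrite /q1 /q2 /=.
  have -> : h *: (1 : R) = h by exact: mulr1.
  by rewrite scalerDl addrCA.
have E1 : derivable f (y + t *: v) v <->
      derivable (fun t : R => f (y + t *: v)) t (1 : R).
  by rewrite /derivable -/q1 -/q2 E.
have E2 : 'D_v f (y + t *: v) = 'D_(1:R) (fun t : R => f (y + t *: v)) t.
  by rewrite /derive -/q1 -/q2 E.
split=> -[D1 D2].
  exact: (DeriveDef (E1.1 D1) (etrans (esym E2) D2)).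
exact: (DeriveDef (E1.2 D1) (etrans E2 D2)).
Qed.

Lemma diff_line f y v l : differentiable f y ->
  is_derive 0 (1 : R) (fun t : R => f (y + t *: v)) l -> 'd f y v = l.
Proof.
by move=> df /is_derive_line; rewrite scale0r addr0 => -[_ <-]; rewrite deriveE.
Qed.

Lemma diff_is_derive_line f y v t : differentiable f (y + t *: v) ->
  is_derive t (1 : R) (fun t : R => f (y + t *: v)) ('d f (y + t *: v) v).
Proof.
move=> df; apply/is_derive_line; apply: DeriveDef; last by rewrite deriveE.
exact: diff_derivable.
Qed.

End TrigPolynomials.

(** * The Fejer kernel *)

Section FejerKernel.
Context {R : realType}.
Implicit Types (u z : R) (N : nat).

Local Notation w := (pi *+ 2 : R).

Lemma cosD2pi_int z (k : int) : cos (z + w * k%:~R) = cos z.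
Proof.
have natE z' (n : nat) : cos (z' + w * n%:R) = cos z'.
  elim: n z' => [|n IH] z'; first by rewrite mulr0 addr0.
  by rewrite -natr1 mulrDr mulr1 addrA cosD2pi IH.
case: k => n; first exact: natE.
by rewrite NegzE mulrNz mulrN -[in RHS](subrK (w * n.+1%:R) z) natE.
Qed.

Lemma sinD2pi_int z (k : int) : sin (z + w * k%:~R) = sin z.
Proof. by rewrite -!cosBpihalf addrAC cosD2pi_int. Qed.

Definition fejer N u : R :=
  N%:R^-1 * ((\sum_(j < N) cos (w * j%:R * u)) ^+ 2
           + (\sum_(j < N) sin (w * j%:R * u)) ^+ 2).

Lemma fejer_ge0 N u : 0 <= fejer N u.
Proof. by rewrite mulr_ge0 ?invr_ge0 // addr_ge0 // sqr_ge0. Qed.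

(** Multiplying the geometric sum of e^(i w j u), j < N, by 1 - e^(i w u) leaves
    1 - e^(i w N u). Squared moduli give
    (1 - cos (w u)) * fejer N u = (1 - cos (w N u)) / N. *)
Lemma fejer_concentrated N u : (1 - cos (w * u)) * fejer N u <= 2 / N%:R.
Proof.
pose C n := \sum_(j < n) cos (w * j%:R * u).
pose S n := \sum_(j < n) sin (w * j%:R * u).
set c := cos (w * u); set s := sin (w * u).
have nS n : w * n.+1%:R * u = w * n%:R * u + w * u by rewrite -natr1; ring.
have CE n : (1 - c) * C n + s * S n = 1 - cos (w * n%:R * u).
  elim: n => [|n IH].
    by rewrite /C /S !big_ord0 !mulr0 mul0r cos0 subrr addr0.
  rewrite /C /S !big_ord_recr /= -/(C n) -/(S n) nS cosD -/c -/s.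
  by rewrite !mulrDr addrACA IH; ring.
have SE n : (1 - c) * S n - s * C n = - sin (w * n%:R * u).
  elim: n => [|n IH].
    by rewrite /C /S !big_ord0 !mulr0 mul0r sin0 subrr oppr0.
  rewrite /C /S !big_ord_recr /= -/(C n) -/(S n) nS sinD -/c -/s.
  rewrite !mulrDr opprD addrACA IH; ring.
have cs1 : c ^+ 2 + s ^+ 2 = 1 by exact: cos2Dsin2.
set cN := cos (w * N%:R * u); set sN := sin (w * N%:R * u).
have csN1 : cN ^+ 2 + sN ^+ 2 = 1 by exact: cos2Dsin2.
have E : (1 - c) * (C N ^+ 2 + S N ^+ 2) = 1 - cN.
  have : ((1 - c) * C N + s * S N) ^+ 2 + ((1 - c) * S N - s * C N) ^+ 2 =
    (1 - cN) ^+ 2 + sN ^+ 2 by rewrite CE SE sqrrN.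
  have -> : ((1 - c) * C N + s * S N) ^+ 2 + ((1 - c) * S N - s * C N) ^+ 2 =
    (1 - c *+ 2 + (c ^+ 2 + s ^+ 2)) * (C N ^+ 2 + S N ^+ 2) by ring.
  have -> : (1 - cN) ^+ 2 + sN ^+ 2 = 1 - cN *+ 2 + (cN ^+ 2 + sN ^+ 2) by ring.
  rewrite cs1 csN1; set D := C N ^+ 2 + _; lra.
rewrite /fejer -/(C N) -/(S N) mulrCA E mulrC.
apply: ler_wpM2r; first by rewrite invr_ge0.
have := cos_geN1 (w * N%:R * u); rewrite -/cN; lra.
Qed.

Lemma fejerE N u : fejer N u =
  N%:R^-1 * \sum_(i < N) \sum_(j < N) cos (w * (i%:R - j%:R) * u).
Proof.
rewrite /fejer !expr2 !mulr_suml -big_split /=; congr (_ * _).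
apply: eq_bigr => i _; rewrite !mulr_sumr -big_split /=; apply: eq_bigr => j _.
by rewrite -cosB; congr cos; ring.
Qed.

(** The primitive of [fejer N] is u plus a periodic function, because the kernel has
    mean one: the terms with i = j contribute the u. *)
Definition fejer_prim N u : R :=
  u + N%:R^-1 * \sum_(i < N) \sum_(j < N | j != i)
    (w * (i%:R - j%:R))^-1 * sin (w * (i%:R - j%:R) * u).

Let freq_neq0 N (i j : 'I_N) : j != i -> w * (i%:R - j%:R) != 0.
Proof.
move=> ji; rewrite mulf_neq0 //; first by rewrite mulrn_eq0 /= gt_eqF ?pi_gt0.
by rewrite subr_eq0 eqr_nat eq_sym.
Qed.

Lemma is_derive_scaled_sin (a u : R) : a != 0 ->
  is_derive u (1 : R) (fun u => a^-1 * sin (a * u)) (cos (a * u)).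
Proof.
move=> a0.
have D : is_derive u (1 : R) (fun u : R => a * u) a.
  by apply: is_derive_eq; rewrite /GRing.scale /= mulr1.
have D2 := is_derive1_comp (is_derive_sin (a * u)) D.
have D3 := is_deriveZ a^-1 D2.
by apply: (is_derive_eq D3); rewrite /GRing.scale /= mulrCA mulVf // mulr1.
Qed.

Lemma fejer_prim_derive N u : (0 < N)%N -> is_derive u (1 : R) (fejer_prim N) (fejer N u).
Proof.
move=> N0; rewrite fejerE /fejer_prim.
have D : is_derive u (1 : R) (fun u => \sum_(i < N) \sum_(j < N | j != i)
    (w * (i%:R - j%:R))^-1 * sin (w * (i%:R - j%:R) * u))
    (\sum_(i < N) \sum_(j < N | j != i) cos (w * (i%:R - j%:R) * u)).
  by do 2! apply: is_derive_bigsum => ? ?; apply: is_derive_scaled_sin; exact: freq_neq0.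
have D2 := is_deriveD (is_derive_id u (1 : R)) (is_deriveZ N%:R^-1 D).
apply: (is_derive_eq D2); rewrite /GRing.scale /=.
have -> : \sum_(i < N) \sum_(j < N) cos (w * (i%:R - j%:R) * u) =
  N%:R + \sum_(i < N) \sum_(j < N | j != i) cos (w * (i%:R - j%:R) * u).
  rewrite -[N in N%:R]card_ord -sumr_const -big_split /=; apply: eq_bigr => i _.
  by rewrite (bigD1 i) //= subrr mulr0 mul0r cos0.
by rewrite mulrDr mulVf // pnatr_eq0 -lt0n.
Qed.

(** A primitive of [fejer_prim N]; it gives the L^1 norm of the difference of two
    translates of [fejer_prim N]. *)
Definition fejer_prim2 N u : R :=
  u ^+ 2 / 2 - N%:R^-1 * \sum_(i < N) \sum_(j < N | j != i)
    (w * (i%:R - j%:R))^-1 * ((w * (i%:R - j%:R))^-1 * cos (w * (i%:R - j%:R) * u)).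

Lemma fejer_prim2_derive N u : is_derive u (1 : R) (fejer_prim2 N) (fejer_prim N u).
Proof.
have D : is_derive u (1 : R) (fun u => \sum_(i < N) \sum_(j < N | j != i)
    (w * (i%:R - j%:R))^-1 * ((w * (i%:R - j%:R))^-1 * cos (w * (i%:R - j%:R) * u)))
    (\sum_(i < N) \sum_(j < N | j != i)
       (w * (i%:R - j%:R))^-1 * - sin (w * (i%:R - j%:R) * u)).
  apply: is_derive_bigsum => i _; apply: is_derive_bigsum => j ji.
  have a0 := freq_neq0 ji; set a := w * _ in a0 *.
  have Da : is_derive u (1 : R) (fun u : R => a * u) a.
    by apply: is_derive_eq; rewrite /GRing.scale /= mulr1.
  have D2 := is_derive1_comp (is_derive_cos (a * u)) Da.
  have D3 := is_deriveZ a^-1 (is_deriveZ a^-1 D2).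
  by apply: (is_derive_eq D3); rewrite /GRing.scale /=; field.
have D1 : is_derive u (1 : R) (fun u : R => u ^+ 2 / 2) u.
  by apply: is_derive_eq; rewrite /GRing.scale /=; field.
have D2 := is_deriveB D1 (is_deriveZ N%:R^-1 D).
apply: (is_derive_eq D2); rewrite /GRing.scale /= /fejer_prim; congr (_ + _).
rewrite -mulrN; congr (_ * _); rewrite -sumrN; apply: eq_bigr => i _.
by rewrite -sumrN; apply: eq_bigr => j _; rewrite mulrN opprK.
Qed.

Lemma fejer_prim2_period N u : fejer_prim2 N (u + 1) - fejer_prim2 N u = u + 2^-1.
Proof.
rewrite /fejer_prim2.
have E (i j : 'I_N) : cos (w * (i%:R - j%:R) * (u + 1)) = cos (w * (i%:R - j%:R) * u).
  rewrite -[in RHS](cosD2pi_int _ ((i : nat)%:Z - (j : nat)%:Z)) intrB.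
  by congr cos; rewrite -!pmulrn; ring.
under [in X in X - _]eq_bigr => i _ do under eq_bigr => j _ do rewrite E.
by set B := N%:R^-1 * _; lra.
Qed.

Lemma fejer_int N u (k : int) : fejer N (u + k%:~R) = fejer N u.
Proof.
rewrite !fejerE; congr (_ * _); apply: eq_bigr => i _; apply: eq_bigr => j _.
rewrite -[in RHS](cosD2pi_int _ (((i : nat)%:Z - (j : nat)%:Z) * k)).
by congr cos; rewrite intrM intrB; ring.
Qed.

Lemma fejer_prim_int N u (k : int) : fejer_prim N (u + k%:~R) = fejer_prim N u + k%:~R.
Proof.
rewrite /fejer_prim addrAC; congr (_ + _ * _ + _).
apply: eq_bigr => i _; apply: eq_bigr => j _; congr (_ * _).
rewrite -[in RHS](sinD2pi_int _ (((i : nat)%:Z - (j : nat)%:Z) * k)).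
by congr sin; rewrite intrM intrB; ring.
Qed.

Lemma fejer_continuous N : continuous (fejer N).
Proof.
move=> u; rewrite /fejer_prim.
have -> : fejer N = fun u => N%:R^-1 * \sum_(i < N) \sum_(j < N) cos (w * (i%:R - j%:R) * u).
  by apply/funext => v; exact: fejerE.
apply: (@continuousM R _ (cst _)); first exact: cvg_cst.
do 2! apply: cvg_sum => ? _.
by apply: continuous_comp; [exact: mulrl_continuous|exact: continuous_cos].
Qed.

Lemma fejer_prim_le N u v : (0 < N)%N -> u <= v -> fejer_prim N u <= fejer_prim N v.
Proof.
move=> N0 uv; have [||c _] := @MVT_segment _ (fejer_prim N) (fejer N) _ _ uv.
- by move=> x _; exact: fejer_prim_derive.
- apply: continuous_subspaceT => x.
  by apply/differentiable_continuous/derivable1_diffP; have [] := fejer_prim_derive x N0.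
by move=> E; rewrite -subr_ge0 E mulr_ge0 ?fejer_ge0 ?subr_ge0.
Qed.

Lemma is_derive_subr (F F' : R -> R) (c u : R) :
  (forall u : R, is_derive u (1 : R) F (F' u)) ->
  is_derive u (1 : R) (fun u => F (u - c)) (F' (u - c)).
Proof.
move=> dF; have D : is_derive u (1 : R) (fun u => u - c) 1.
  by apply: is_derive_eq; rewrite subr0.
have := @is_derive1_comp _ F (fun u => u - c) u _ _ (dF (u - c)) D.
by rewrite mulr1.
Qed.

Lemma fejer_shift_continuous N (c : R) : continuous (fun u : R => fejer N (u - c)).
Proof.
move=> u; apply: (@continuous_comp R R R (fun u => u - c)); last exact: fejer_continuous.
by apply: cvgB; [exact: cvg_id|exact: cvg_cst].
Qed.

Lemma fejer_prim_shift_derive N (c : R) : (0 < N)%N -> forall u : R,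
  is_derive u (1 : R) (fun u => fejer_prim N (u - c)) (fejer N (u - c)).
Proof. by move=> N0 u; apply: is_derive_subr => v; exact: fejer_prim_derive. Qed.

Lemma fejer_mass N (c : R) : fejer_prim N (1 - c) - fejer_prim N (0 - c) = 1.
Proof.
have := fejer_prim_int N (- c) 1; rewrite mulr1z addrC => ->.
by rewrite sub0r addrAC subrr add0r.
Qed.

Let trig_poly_cos1 (e : plane R) (a c : R) : trig_poly (fun y => cos (a * (dot e y - c))).
Proof.
rewrite (_ : (fun y => _) = fun y => cos (dot (a *: e) y - a * c)); first exact: trig_poly_cos.
by apply/funext => y; congr cos; rewrite /dot /= /GRing.scale /=; ring.
Qed.

Lemma trig_poly_fejer N (e : plane R) c : trig_poly (fun y => fejer N (dot e y - c)).
Proof.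
under eq_fun do rewrite fejerE.
by apply: trig_polyZ; do 2! apply: trig_poly_sum => ? _; exact: trig_poly_cos1.
Qed.

(** The linear parts of the two primitives cancel. *)
Lemma trig_poly_fejer_prim N (e : plane R) c d :
  trig_poly (fun y => fejer_prim N (dot e y - c) - fejer_prim N (dot e y - d)).
Proof.
have H c' : trig_poly (fun y => fejer_prim N (dot e y - c') - dot e y).
  rewrite (_ : (fun y => _) = fun y => - c' + N%:R^-1 * \sum_(i < N) \sum_(j < N | j != i)
    (w * (i%:R - j%:R))^-1 * sin (w * (i%:R - j%:R) * (dot e y - c'))); last first.
    by apply/funext => y; rewrite /fejer_prim; ring.
  apply: trig_polyD; first exact: trig_poly_cst.
  apply: trig_polyZ; apply: trig_poly_sum => i _; apply: trig_poly_sum => j ji.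
  apply: trig_polyZ; set a := w * _.
  rewrite (_ : (fun y => _) = fun y => cos (a * (dot e y - (c' + pi / 2 / a)))) //.
  apply/funext => y; rewrite -cosBpihalf; congr cos; field.
  exact: freq_neq0.
rewrite (_ : (fun y => _) = fun y => (fejer_prim N (dot e y - c) - dot e y) +
  - 1 * (fejer_prim N (dot e y - d) - dot e y)); last by apply/funext => y; ring.
by apply: trig_polyD; [exact: H|apply: trig_polyZ; exact: H].
Qed.

End FejerKernel.

(** * Test functions of the dual norm are Lipschitz *)

Section TestFunctions.
Context {R : realType}.
Local Notation mplane := (measurableTypeR R * measurableTypeR R)%type.
Local Notation w := (pi *+ 2 : R).
Implicit Types (f psi : plane R -> R) (x y v : plane R).

Lemma dot_le_enorm x v : `|dot x v| <= enorm x * enorm v.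
Proof.
rewrite /enorm -sqrtrM; last by rewrite /dot -!expr2 addr_ge0 ?sqr_ge0.
rewrite -sqrtr_sqr; apply: ler_wsqrtr; rewrite -subr_ge0.
rewrite (_ : _ - _ = (x.1 * v.2 - x.2 * v.1) ^+ 2) ?sqr_ge0 // /dot; ring.
Qed.

Lemma plane_lebesgue_gt0 : (0 < (@plane_lebesgue R) [set: mplane])%E.
Proof.
apply: (@lt_le_trans _ _ ((@plane_lebesgue R) unit_cell)).
  by rewrite unit_cell_lebesgue lte_fin.
by apply: le_measure; rewrite ?inE //; exact: measurable_unit_cell.
Qed.

Lemma bl_test_le1 f : bl_test f -> forall x, `|f x| <= 1.
Proof.
move=> [_ _ [g _ fg1]] x.
suff : ((`|f x|)%:E <= 1%E)%E by rewrite lee_fin.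
apply: le_trans fg1; rewrite -[leLHS]adde0; apply: leeD.
  by apply: ereal_sup_ubound; exists x.
apply: ess_sup_gee; first exact: plane_lebesgue_gt0.
by apply: nearW => y; rewrite lee_fin sqrtr_ge0.
Qed.

(** The weak gradient is integrated against [psi], and is at most one almost
    everywhere. *)
Lemma bl_test_weak_bound f psi v : bl_test f -> Defs.periodic psi -> smooth psi ->
  enorm v <= 1 ->
  `|\int[plane_lebesgue]_(y in unit_cell) (f y * 'd psi y v)| <=
  \int[plane_lebesgue]_(y in unit_cell) `|psi y|.
Proof.
move=> [_ _ [g [gper gm _ gw] fg1]] pper psm v1.
rewrite gw // normrN.
have cpsi : continuous psi by exact: (psm 0%N).
have capsi : continuous (fun y => `|psi y|).
  by move=> y; apply: continuous_comp; [exact: cpsi|exact: norm_continuous].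
have iapsi := continuous_integrable_cell capsi.
have g1 : \forall y \ae (@plane_lebesgue R), ((enorm (g y))%:E <= 1)%E.
  apply/ess_supP; apply: le_trans fg1; rewrite -[leLHS]add0e; apply: leeD => //.
  apply: (@le_trans _ _ (`|f (0,0)|%:E)); first by rewrite lee_fin.
  by apply: ereal_sup_ubound; exists (0,0).
pose h : mplane -> R := fun y => dot (g y) v * psi y.
have mpsi : measurable_fun setT (psi : mplane -> measurableTypeR R).
  exact: continuous_measurable_plane.
have mh : measurable_fun setT h.
  apply: measurable_funM; last exact: mpsi.
  rewrite /dot; apply: measurable_funD; apply: measurable_funM => //.
  - by apply: (measurableT_comp measurable_fst gm).
  - by apply: (measurableT_comp measurable_snd gm).
have L : (`|\int[plane_lebesgue]_(y in unit_cell) (h y)%:E| <=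
  \int[plane_lebesgue]_(y in unit_cell) (`|psi y|)%:E)%E.
  apply: (@le_trans _ _ (\int[plane_lebesgue]_(y in unit_cell) `|(h y)%:E|)%E).
    apply: le_abse_integral; first exact: measurable_unit_cell.
    by apply/measurable_EFinP; exact: measurable_funTS.
  apply: ae_ge0_le_integral => //.
  - exact: measurable_unit_cell.
  - by apply: measurableT_comp => //; apply/measurable_EFinP; exact: measurable_funTS.
  - by apply/measurable_EFinP; apply: measurable_funTS; exact: continuous_measurable_plane.
  - have [Z [mZ Z0 gZ]] := g1; exists Z; split=> // y nle; apply: gZ => gy; apply: nle => _.
    rewrite /h abse_EFin lee_fin normrM ler_piMl //.
    apply: le_trans (dot_le_enorm _ _) _; have {}gy : enorm (g y) <= 1 by rewrite -lee_fin; exact: gy.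
    by rewrite mulr_ile1 ?sqrtr_ge0.
have Ifin : (\int[plane_lebesgue]_(y in unit_cell) (`|psi y|)%:E)%E \is a fin_num.
  by have X := integrable_fin_num measurable_unit_cell iapsi; exact X.
have hfin : (\int[plane_lebesgue]_(y in unit_cell) (h y)%:E)%E \is a fin_num.
  by rewrite -abse_fin_num fin_numElt (le_lt_trans L) ?ltey_eq ?Ifin // (lt_le_trans _ (abse_ge0 _)) ?ltNyr.
by rewrite /Rintegral -lee_fin -abse_EFin fineK // fineK.
Qed.

End TestFunctions.

Section Mollification.
Context {R : realType}.
Local Notation mplane := (measurableTypeR R * measurableTypeR R)%type.
Local Notation w := (pi *+ 2 : R).
Implicit Types (f psi : plane R -> R) (x y v : plane R) (N : nat).

Local Notation gap u := (1 - cos (w * u)).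

Lemma gap_ge0 (u : R) : 0 <= gap u.
Proof. by rewrite subr_ge0 cos_le1. Qed.

Lemma gap_int (u : R) (k : int) : gap (u - k%:~R) = gap u.
Proof. by rewrite mulrBr -mulrN -intrN cosD2pi_int. Qed.

Lemma gap_le (r u : R) : 0 < r -> r <= `|u| -> `|u| <= 2^-1 -> gap r <= gap u.
Proof.
move=> r0 ru u1; have p0 := @pi_gt0 R.
have wE : w = 2 * pi by rewrite mulr2n; ring.
have w0 : 0 < w by rewrite wE mulr_gt0.
have -> : cos (w * u) = cos (w * `|u|).
  by rewrite -(cos_norm (w * u)) normrM (gtr0_norm w0).
rewrite lerD2l lerN2.
have wu : w * `|u| <= pi by have := ler_wpM2l (ltW w0) u1; rewrite wE; lra.
have wr : w * r <= w * `|u| by rewrite ler_wpM2l // ltW.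
have wr0 : 0 < w * r by rewrite mulr_gt0.
move: wr; rewrite le_eqVlt => /predU1P[->//|wr].
by apply: ltW; rewrite ltr_cos // in_itv /=; apply/andP; split; lra.
Qed.

Lemma gap_gt0 (r : R) : 0 < r -> r <= 2^-1 -> 0 < gap r.
Proof.
move=> r0 r1; have p0 := @pi_gt0 R.
have wE : w = 2 * pi by rewrite mulr2n; ring.
have w0 : 0 < w by rewrite wE mulr_gt0.
rewrite subr_gt0 -[X in _ < X]cos0 ltr_cos ?mulr_gt0 // in_itv /=; apply/andP; split => //.
- exact: pi_ge0.
- by rewrite mulr_ge0 // ltW.
- by have := ler_wpM2l (ltW w0) r1; rewrite wE; lra.
Qed.

Lemma floor_half (u : R) : exists k : int, `|u - k%:~R| <= 2^-1.
Proof.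
exists (Num.floor (u + 2^-1)).
have := Num.Theory.floor_le (u + 2^-1); have := floorD1_gt (u + 2^-1).
rewrite intrD => h1 h2; rewrite ler_norml; apply/andP; split; lra.
Qed.

(** Continuity at [x] handles the points whose class modulo Z^2 is near that of [x].
    At the other points one of the gaps is bounded below, and the bound [2] on the
    oscillation is absorbed by [C]. *)
Lemma periodic_oscillation f x (eta : R) : Defs.periodic f -> continuous f ->
  (forall y, `|f y| <= 1) -> 0 < eta ->
  exists2 C : R, 0 <= C & forall y,
    `|f y - f x| <= eta + C * (gap (y.1 - x.1) + gap (y.2 - x.2)).
Proof.
move=> fper fc f1 eta0.
have /cvgrPdist_lt/(_ _ eta0)/nbhs_ballP[e /= e0 He] := fc x.
pose r := Num.min e 2^-1.
have r0 : 0 < r by rewrite lt_min e0 invr_gt0 ltr0n.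
have re : r <= e by rewrite ge_min lexx.
have r12 : r <= 2^-1 by rewrite ge_min lexx orbT.
have g0 := gap_gt0 r0 r12.
exists (2 / gap r); first by rewrite divr_ge0 // ltW.
move=> y.
have [k Hk] := floor_half (y.1 - x.1); have [l Hl] := floor_half (y.2 - x.2).
have far u : gap r <= u -> forall u', 0 <= u' -> `|f y - f x| <= eta + 2 / gap r * (u + u').
  move=> ru u' u0.
  apply: (@le_trans _ _ (2 / gap r * (u + u'))); last by rewrite lerDr ltW.
  apply: (@le_trans _ _ 2).
    by apply: le_trans (ler_normB _ _) _; have := f1 y; have := f1 x; lra.
  by rewrite -mulrA ler_pMr // mulrC ler_pdivlMr // mul1r; lra.
have [h1|h1] := leP r `|y.1 - x.1 - k%:~R|.
  apply: far; last exact: gap_ge0.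
  by rewrite -(gap_int (y.1 - x.1) k); apply: gap_le.
have [h2|h2] := leP r `|y.2 - x.2 - l%:~R|.
  rewrite [gap (y.1 - _) + _]addrC; apply: far; last exact: gap_ge0.
  by rewrite -(gap_int (y.2 - x.2) l); apply: gap_le.
have <- : f (y.1 - k%:~R, y.2 - l%:~R) = f y.
  by rewrite -(fper y (- k) (- l)) !intrN.
rewrite distrC; apply: (@le_trans _ _ eta).
  apply: ltW; apply: He; split; rewrite /ball /= distrC addrAC.
  - exact: lt_le_trans re.
  - exact: lt_le_trans re.
rewrite lerDl; apply: mulr_ge0; first by rewrite divr_ge0 // ltW.
by apply: addr_ge0; exact: gap_ge0.
Qed.

Definition fejer2 N x y : R := fejer N (y.1 - x.1) * fejer N (y.2 - x.2).

Let cont1 (a : R -> R) : continuous a -> continuous (fun y : plane R => a y.1).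
Proof. by move=> ca y; apply: (@continuous_comp _ _ _ fst a); [exact: cvg_fst|exact: ca]. Qed.

Let cont2 (a : R -> R) : continuous a -> continuous (fun y : plane R => a y.2).
Proof. by move=> ca y; apply: (@continuous_comp _ _ _ snd a); [exact: cvg_snd|exact: ca]. Qed.

Let k1_cont N x : continuous (fun y : plane R => fejer N (y.1 - x.1)).
Proof. exact: cont1 (@fejer_shift_continuous R N x.1). Qed.

Let k2_cont N x : continuous (fun y : plane R => fejer N (y.2 - x.2)).
Proof. exact: cont2 (@fejer_shift_continuous R N x.2). Qed.

Let contM (a b : plane R -> R) : continuous a -> continuous b ->
  continuous (fun y => a y * b y).
Proof. by move=> ca cb y; apply: continuousM; [exact: ca|exact: cb]. Qed.

Let contc (c : R) : continuous (fun _ : plane R => c).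
Proof. by move=> y; exact: cvg_cst. Qed.

Lemma fejer2_continuous N x : continuous (fejer2 N x).
Proof. exact: contM (@k1_cont N x) (@k2_cont N x). Qed.

Let one_derive (u : R) : is_derive u (1 : R) (@id R) ((fun=> 1) u).
Proof. exact: is_derive_id. Qed.

Let one_cont : continuous (fun _ : R => 1 : R).
Proof. by move=> u; exact: cvg_cst. Qed.

Let integral_k1 N x : (0 < N)%N ->
  \int[plane_lebesgue]_(y in @unit_cell R) fejer N (y.1 - x.1) = 1.
Proof.
move=> N0.
have := integral_cell_tensor (@fejer_shift_continuous R N x.1) one_cont (fejer_prim_shift_derive x.1 N0) one_derive.
rewrite fejer_mass subr0 mulr1 => E; rewrite -[RHS]E.
by apply: eq_Rintegral => y _; rewrite mulr1.
Qed.

Let integral_k2 N x : (0 < N)%N ->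
  \int[plane_lebesgue]_(y in @unit_cell R) fejer N (y.2 - x.2) = 1.
Proof.
move=> N0.
have := integral_cell_tensor one_cont (@fejer_shift_continuous R N x.2) one_derive (fejer_prim_shift_derive x.2 N0).
rewrite fejer_mass subr0 mulr1 => E; rewrite -[RHS]E.
by apply: eq_Rintegral => y _; rewrite mul1r.
Qed.

Let integral_kk N x : (0 < N)%N ->
  \int[plane_lebesgue]_(y in @unit_cell R) fejer2 N x y = 1.
Proof.
move=> N0.
have := integral_cell_tensor (@fejer_shift_continuous R N x.1) (@fejer_shift_continuous R N x.2) (fejer_prim_shift_derive x.1 N0) (fejer_prim_shift_derive x.2 N0).
by rewrite !fejer_mass mulr1.
Qed.

Let cellZ (c : R) (h : plane R -> R) : continuous h ->
  \int[plane_lebesgue]_(y in unit_cell) (c * h y) =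
  c * \int[plane_lebesgue]_(y in unit_cell) h y.
Proof. by move=> /continuous_integrable_cell; exact: RintegralZl _ measurable_unit_cell. Qed.

Let cellD (a b : plane R -> R) : continuous a -> continuous b ->
  \int[plane_lebesgue]_(y in unit_cell) (a y + b y) =
  \int[plane_lebesgue]_(y in unit_cell) a y + \int[plane_lebesgue]_(y in unit_cell) b y.
Proof.
move=> /continuous_integrable_cell ia /continuous_integrable_cell.
exact: RintegralD measurable_unit_cell ia.
Qed.

(** The oscillation of [f] at [x] is integrated against the kernel: [eta] keeps its
    mass, and each gap times the kernel is at most 2 / N by [fejer_concentrated]. *)
Lemma mollification_error f x (eta : R) : Defs.periodic f -> continuous f ->
  (forall y, `|f y| <= 1) -> 0 < eta ->
  exists2 C : R, 0 <= C & forall N, (0 < N)%N ->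
  `|\int[plane_lebesgue]_(y in unit_cell) (f y * fejer2 N x y) - f x| <=
     eta + C / N%:R.
Proof.
move=> fper fc f1 eta0.
have [C C0 HC] := periodic_oscillation x fper fc f1 eta0.
exists (4 * C); first by rewrite mulr_ge0.
move=> N N0; have mC := @measurable_unit_cell R.
have kkc := @fejer2_continuous N x.
have cfk : continuous (fun y : plane R => f y * fejer2 N x y).
  exact: contM fc kkc.
have cck : continuous (fun y : plane R => f x * fejer2 N x y).
  exact: contM (@contc _) kkc.
pose D : plane R -> R := fun y => f y * fejer2 N x y - f x * fejer2 N x y.
have cD : continuous D by move=> y; apply: cvgB; [exact: cfk|exact: cck].
have cAD : continuous (fun y : plane R => `|D y|).
  by move=> y; apply: continuous_comp; [exact: cD|exact: norm_continuous].
have -> : \int[plane_lebesgue]_(y in unit_cell) (f y * fejer2 N x y) - f x =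
  \int[plane_lebesgue]_(y in unit_cell) D y.
  rewrite RintegralB //; [|exact: continuous_integrable_cell..].
  rewrite RintegralZl //; last exact: continuous_integrable_cell.
  by rewrite integral_kk // mulr1.
apply: le_trans (le_normr_Rintegral _ _) _ => //; first exact: continuous_integrable_cell.
pose c := C * (2 / N%:R).
pose B : plane R -> R := fun y => eta * fejer2 N x y +
   (c * fejer N (y.2 - x.2) + c * fejer N (y.1 - x.1)).
have c1 : continuous (fun y : plane R => eta * fejer2 N x y).
  exact: contM (@contc _) kkc.
have c2 : continuous (fun y : plane R => c * fejer N (y.2 - x.2)).
  exact: contM (@contc _) (@k2_cont _ _).
have c3 : continuous (fun y : plane R => c * fejer N (y.1 - x.1)).
  exact: contM (@contc _) (@k1_cont _ _).
have c23 : continuous (fun y : plane R => c * fejer N (y.2 - x.2) + c * fejer N (y.1 - x.1)).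
  by move=> y; apply: cvgD; [exact: c2|exact: c3].
have cB : continuous B by move=> y; apply: cvgD; [exact: c1|exact: c23].
apply: (@le_trans _ _ (\int[plane_lebesgue]_(y in unit_cell) B y)).
  apply: le_Rintegral => //; [exact: continuous_integrable_cell..|].
  move=> y _; rewrite /D -mulrBl normrM.
  have k1 := fejer_ge0 N (y.1 - x.1); have k2 := fejer_ge0 N (y.2 - x.2).
  have kk0 : 0 <= fejer2 N x y by exact: mulr_ge0.
  rewrite [`|fejer2 _ _ _|]ger0_norm //.
  apply: le_trans (ler_wpM2r kk0 (HC y)) _.
  have h1 := ler_wpM2l C0 (ler_wpM2r k2 (fejer_concentrated N (y.1 - x.1))).
  have h2 := ler_wpM2l C0 (ler_wpM2r k1 (fejer_concentrated N (y.2 - x.2))).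
  rewrite /B /c /fejer2; lra.
have E : \int[plane_lebesgue]_(y in unit_cell) B y = eta * 1 + (c * 1 + c * 1).
  apply: etrans (cellD c1 c23) _; congr (_ + _).
    by apply: etrans (cellZ _ kkc) _; rewrite integral_kk.
  apply: etrans (cellD c2 c3) _; congr (_ + _).
    by apply: etrans (cellZ _ (@k2_cont N x)) _; rewrite integral_k2.
  by apply: etrans (cellZ _ (@k1_cont N x)) _; rewrite integral_k1.
rewrite E !mulr1 lerD2l /c.
by rewrite le_eqVlt; apply/orP; left; apply/eqP; ring.
Qed.

End Mollification.

Section BLLipschitz.
Context {R : realType}.
Implicit Types (f psi : plane R -> R) (x y v : plane R) (N : nat).

(** [psi] is an antiderivative in the direction [v] of the difference of the kernels
    at [x'] and [x]; as N grows, the kernels turn the weak bound into a bound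
    between the values of [f]. *)
Lemma bl_test_translate f x x' v (b : R) : bl_test f -> enorm v <= 1 ->
  (forall N, (0 < N)%N -> exists psi, [/\ trig_poly psi, Defs.periodic psi,
     forall y, 'd psi y v = fejer2 N x' y - fejer2 N x y &
     \int[plane_lebesgue]_(y in unit_cell) `|psi y| <= b]) ->
  `|f x' - f x| <= b.
Proof.
move=> fbl v1 Hpsi; have f1 := bl_test_le1 fbl; have [fper fc _] := fbl.
apply/ler_addgt0Pl => eta eta0.
have e40 : 0 < eta / 4 by rewrite divr_gt0.
have [C C0 HC] := mollification_error x fper fc f1 e40.
have [C' C'0 HC'] := mollification_error x' fper fc f1 e40.
pose N := (Num.truncn ((C + C') / (eta / 2))).+1.
have NE : (C + C') / N%:R <= eta / 2.
  rewrite ler_pdivrMr ?ltr0n // mulrC -ler_pdivrMr ?divr_gt0 //.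
  by apply: ltW; rewrite truncnS_gt.
have [psi [tpsi ppsi dpsi Ib]] := Hpsi N isT.
have W := bl_test_weak_bound fbl ppsi (trig_poly_smooth tpsi) v1.
have c1 : continuous (fun y => f y * fejer2 N x y).
  by move=> y; apply: (@continuousM R _ f); [exact: fc|exact: fejer2_continuous].
have c2 : continuous (fun y => f y * fejer2 N x' y).
  by move=> y; apply: (@continuousM R _ f); [exact: fc|exact: fejer2_continuous].
have E : \int[plane_lebesgue]_(y in unit_cell) (f y * 'd psi y v) =
    \int[plane_lebesgue]_(y in unit_cell) (f y * fejer2 N x' y) -
    \int[plane_lebesgue]_(y in unit_cell) (f y * fejer2 N x y).
  have := RintegralB measurable_unit_cell (continuous_integrable_cell c2)
    (continuous_integrable_cell c1) => E; apply: etrans E.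
  by apply: eq_Rintegral => y _; rewrite dpsi mulrBr.
rewrite E in W; have := HC N isT; have := HC' N isT.
have {}W := le_trans W Ib.
move: W NE; rewrite mulrDl; set I1 := Rintegral _ _ _; set I2 := Rintegral _ _ _.
rewrite !ler_norml => /andP[? ?] ? /andP[? ?] /andP[? ?].
apply/andP; split; lra.
Qed.

Let P := @fejer_prim R.
Let k := @fejer R.

Let dP := @fejer_prim_shift_derive R.
Let ck := @fejer_shift_continuous R.

Let cP N (c : R) : (0 < N)%N -> continuous (fun u : R => P N (u - c)).
Proof. by move=> N0 u; apply/differentiable_continuous/derivable1_diffP; have [] := dP c N0 u. Qed.

Let line (u c t a : R) : u + t *: a - c = (u - c) + t * a.
Proof. by rewrite /GRing.scale /=; ring. Qed.

(** In the direction of the translation the antiderivative is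
    [fejer_prim N (u - d) - fejer_prim N (u - c)], which is nonpositive, periodic and
    has the integral c - d over a period. *)
Let kernel_antiderivative N (c d e : R) : (0 < N)%N -> c <= d ->
  let psi1 := fun y : plane R => (P N (y.1 - d) - P N (y.1 - c)) * k N (y.2 - e) in
  let psi2 := fun y : plane R => k N (y.1 - e) * (P N (y.2 - d) - P N (y.2 - c)) in
  [/\ trig_poly psi1, Defs.periodic psi1,
     forall y, 'd psi1 y (1, 0) = (k N (y.1 - d) - k N (y.1 - c)) * k N (y.2 - e) &
     \int[plane_lebesgue]_(y in unit_cell) `|psi1 y| <= d - c] /\
  [/\ trig_poly psi2, Defs.periodic psi2,
     forall y, 'd psi2 y (0, 1) = k N (y.1 - e) * (k N (y.2 - d) - k N (y.2 - c)) &
     \int[plane_lebesgue]_(y in unit_cell) `|psi2 y| <= d - c].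
Proof.
move=> N0 cd psi1 psi2.
have E1 : psi1 = fun y => (P N (dot (1, 0) y - d) - P N (dot (1, 0) y - c)) *
    k N (dot (0, 1) y - e).
  by apply/funext => y; rewrite /psi1 /dot /= !mul1r !mul0r addr0 add0r.
have E2 : psi2 = fun y => k N (dot (1, 0) y - e) *
    (P N (dot (0, 1) y - d) - P N (dot (0, 1) y - c)).
  by apply/funext => y; rewrite /psi2 /dot /= !mul1r !mul0r addr0 add0r.
have t1 : trig_poly psi1.
  by rewrite E1; apply: trig_polyM; [exact: trig_poly_fejer_prim|exact: trig_poly_fejer].
have t2 : trig_poly psi2.
  by rewrite E2; apply: trig_polyM; [exact: trig_poly_fejer|exact: trig_poly_fejer_prim].
have Pi u c' l : P N (u + l%:~R - c') = P N (u - c') + l%:~R.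
  by rewrite addrAC; exact: fejer_prim_int.
have ki u c' l : k N (u + l%:~R - c') = k N (u - c').
  by rewrite addrAC; exact: fejer_int.
have Pcd u : P N (u - d) <= P N (u - c).
  by apply: fejer_prim_le => //; lra.
have M1 : (fejer_prim2 N (1 - c) - fejer_prim2 N (1 - d)) -
   (fejer_prim2 N (0 - c) - fejer_prim2 N (0 - d)) = d - c.
  have := @fejer_prim2_period R N (- c); have := @fejer_prim2_period R N (- d).
  by rewrite !sub0r ![1 - _]addrC; lra.
have M2 : P N (1 - e) - P N (0 - e) = 1 by exact: fejer_mass.
have dPP u : is_derive u (1 : R) (fun u => fejer_prim2 N (u - c) - fejer_prim2 N (u - d))
     (P N (u - c) - P N (u - d)) by apply: is_deriveB; apply: is_derive_subr; exact: fejer_prim2_derive.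
have cPP : continuous (fun u : R => P N (u - c) - P N (u - d)).
  by move=> u; apply: cvgB; exact: cP.
split; split=> //.
- move=> y l1 l2; rewrite /psi1 /= !Pi ki; ring.
- move=> y; apply: diff_line; first exact: trig_poly_differentiable.
  rewrite /psi1 /=.
  rewrite (_ : (fun t : R => _) = fun t : R =>
    k N (y.2 - e) * (P N (t - (d - y.1)) - P N (t - (c - y.1)))); last first.
    apply/funext => t; rewrite [LHS]mulrC (line y.1 d) (line y.1 c) (line y.2 e) mulr0 mulr1 addr0.
    by congr (_ * (P N _ - P N _)); ring.
  have D := is_deriveZ (k N (y.2 - e)) (is_deriveB (dP (d - y.1) N0 0) (dP (c - y.1) N0 0)).
  apply: (is_derive_eq D); rewrite /GRing.scale /= [RHS]mulrC !sub0r !opprB.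
  by [].
- have E := integral_cell_tensor cPP (@ck N e) dPP (dP e N0).
  rewrite M1 M2 mulr1 in E; rewrite -E le_eqVlt; apply/orP; left; apply/eqP.
  apply: eq_Rintegral => y _; rewrite /psi1 normrM [`|k N _|]ger0_norm ?fejer_ge0 //.
  by rewrite ler0_norm ?opprB // subr_le0.
- move=> y l1 l2; rewrite /psi2 /= !Pi ki; ring.
- move=> y; apply: diff_line; first exact: trig_poly_differentiable.
  rewrite /psi2 /=.
  rewrite (_ : (fun t : R => _) = fun t : R =>
    k N (y.1 - e) * (P N (t - (d - y.2)) - P N (t - (c - y.2)))); last first.
    apply/funext => t; rewrite (line y.2 d) (line y.2 c) (line y.1 e) mulr0 mulr1 addr0.
    by congr (_ * (P N _ - P N _)); ring.
  have D := is_deriveZ (k N (y.1 - e)) (is_deriveB (dP (d - y.2) N0 0) (dP (c - y.2) N0 0)).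
  apply: (is_derive_eq D); rewrite /GRing.scale /= !sub0r !opprB.
  by [].
- have E := integral_cell_tensor (@ck N e) cPP (dP e N0) dPP.
  rewrite M1 M2 mul1r in E; rewrite -E le_eqVlt; apply/orP; left; apply/eqP.
  apply: eq_Rintegral => y _; rewrite /psi2 normrM [`|k N _|]ger0_norm ?fejer_ge0 //.
  by rewrite ler0_norm ?opprB // subr_le0.
Qed.

Let enorm10 : enorm ((1, 0) : plane R) <= 1.
Proof. by rewrite /enorm /dot /= mulr1 mulr0 addr0 sqrtr1. Qed.

Let enorm01 : enorm ((0, 1) : plane R) <= 1.
Proof. by rewrite /enorm /dot /= mulr1 mulr0 add0r sqrtr1. Qed.

Lemma bl_test_lipschitz f (c d e : R) : bl_test f ->
  `|f (d, e) - f (c, e)| <= `|d - c| /\ `|f (e, d) - f (e, c)| <= `|d - c|.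
Proof.
move=> fbl; wlog cd : c d / c <= d.
  move=> H; have [/H//|/ltW/H] := leP c d.
  by rewrite distrC [`|f (e, _) - _|]distrC [`|c - d|]distrC.
rewrite [`|d - c|]ger0_norm ?subr_ge0 //; split.
- apply: (bl_test_translate fbl enorm10) => N N0.
  have [[t p D I] _] := kernel_antiderivative e N0 cd.
  eexists; split; [exact: t|exact: p| |exact: I].
  by move=> y; rewrite D /fejer2 /= mulrBl.
- apply: (bl_test_translate fbl enorm01) => N N0.
  have [_ [t p D I]] := kernel_antiderivative e N0 cd.
  eexists; split; [exact: t|exact: p| |exact: I].
  by move=> y; rewrite D /fejer2 /= mulrBr.
Qed.

End BLLipschitz.

(** * Bounds on the gradient of the potential *)

Section Potential.
Context {R : realType}.
Implicit Types (V F : plane R -> R) (x y v : plane R).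

Definition coord_lipschitz (L : R) F := forall c d e : R,
  `|F (d, e) - F (c, e)| <= L * `|d - c| /\ `|F (e, d) - F (e, c)| <= L * `|d - c|.

Definition basis_vector (v : plane R) : Prop := v = (1, 0) \/ v = (0, 1).

Lemma enorm_basis v : basis_vector v -> enorm v <= 1.
Proof.
by case=> ->; rewrite /enorm /dot /= !(mulr1, mulr0) ?addr0 ?add0r sqrtr1.
Qed.

Lemma enormN v : enorm (- v) = enorm v.
Proof. by rewrite /enorm /dot /= !mulrNN. Qed.

Lemma dk_norm1_bound V (c : R) : (dk_norm 1 V <= c%:E)%E ->
  (forall x, differentiable V x) ->
  forall x v, basis_vector v -> `|'d V x v| <= c.
Proof.
move=> Vc dV x v bv.
have H u : enorm u <= 1 -> 'd V x u <= c.
  move=> u1; rewrite -lee_fin; apply: le_trans Vc; apply: ereal_sup_ubound.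
  by exists x, [tuple u]; split => // i; rewrite ord1.
rewrite ler_norml lerNl H ?enorm_basis // andbT.
by rewrite -linearN; apply: H; rewrite enormN enorm_basis.
Qed.

Lemma dk_norm2_bound V (c : R) : (dk_norm 2 V <= c%:E)%E ->
  Ck 2 V -> forall x v v', basis_vector v -> basis_vector v' ->
  `|'d (fun y => 'd V y v) x v'| <= c.
Proof.
move=> Vc [dV cV] x v v' bv bv'.
have H u : enorm u <= 1 -> 'd (fun y => 'd V y v) x u <= c.
  move=> u1; rewrite -lee_fin; apply: le_trans Vc; apply: ereal_sup_ubound.
  exists x, [tuple u; v]; split => // i.
  rewrite (tnth_nth 0) /=; case: i => -[|[|//]] //= _.
  exact: enorm_basis.
have [dV2 _] := cV v.
rewrite ler_norml lerNl H ?enorm_basis // andbT.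
by rewrite -linearN; apply: H; rewrite enormN enorm_basis.
Qed.

(** Lipschitz bounds along the axes suffice on a lattice, and follow from the mean
    value theorem on lines. *)
Lemma partial_lipschitz F (c : R) : (forall x, differentiable F x) ->
  (forall x v, basis_vector v -> `|'d F x v| <= c) -> coord_lipschitz c F.
Proof.
move=> dF Fc.
have H x v t : basis_vector v -> 0 <= t -> `|F (x + t *: v) - F x| <= c * t.
  move=> bv t0.
  have dl (s : R) : is_derive s (1 : R) (fun s : R => F (x + s *: v)) ('d F (x + s *: v) v).
    exact: diff_is_derive_line.
  have [|s _] := MVT_segment t0 (fun s _ => dl s).
    apply: continuous_subspaceT => s.
    by apply/differentiable_continuous/derivable1_diffP; have [] := dl s.
  rewrite scale0r addr0 subr0 => ->; rewrite normrM (ger0_norm t0).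
  by apply: ler_wpM2r => //; exact: Fc.
move=> c' d e; wlog cd : c' d / c' <= d.
  move=> W; have [/W//|/ltW/W] := leP c' d.
  by rewrite distrC [`|F (e, _) - _|]distrC [`|c' - d|]distrC.
have dc : 0 <= d - c' by rewrite subr_ge0.
rewrite [`|d - c'|]ger0_norm //; split.
- have := H (c', e) (1, 0) (d - c') (or_introl erefl) dc.
  congr (`|F _ - _| <= _); congr pair; rewrite /= /GRing.scale /=; ring.
- have := H (e, c') (0, 1) (d - c') (or_intror erefl) dc.
  congr (`|F _ - _| <= _); congr pair; rewrite /= /GRing.scale /=; ring.
Qed.

Lemma periodic_diff V v : Defs.periodic V -> (forall x, differentiable V x) ->
  Defs.periodic (fun x => 'd V x v).
Proof.
move=> Vp dV x k l; apply: diff_line; first exact: dV.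
rewrite (_ : (fun t : R => _) = fun t : R => V (x + t *: v)); last first.
  apply/funext => t; rewrite -(Vp (x + t *: v) k l) /=.
  by congr (V (_, _)); rewrite /= addrAC.
have := @diff_is_derive_line R V x v 0; rewrite scale0r addr0; apply.
exact: dV.
Qed.

End Potential.

(** * Distance on the lattice *)

Section Sites.
Context {R : realType} (m : nat).
Implicit Types (i j k : 'I_m.+1) (l y : site m).
Local Notation eps := (mesh R m).

Lemma mesh_gt0 : 0 < eps.
Proof. by rewrite invr_gt0. Qed.

Lemma mesh_size : eps * m.+1%:R = 1.
Proof. by rewrite mulVf. Qed.

(** The graph distance from k to 0 on the cycle of length m + 1. *)
Definition cycle_norm k : nat := minn k (m.+1 - k).

Definition site_norm l : R := eps * (cycle_norm l.1 + cycle_norm l.2)%:R.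

Lemma val_subZp i j :
  nat_of_ord (i - j) = if (j <= i)%N then (i - j)%N else (i + m.+1 - j)%N.
Proof.
rewrite /= modnDmr; case: leqP => ji.
  rewrite (_ : (i + (m.+1 - j) = (i - j) + m.+1)%N); last first.
    by have := ltn_ord j; lia.
  by rewrite modnDr modn_small //; have := ltn_ord i; lia.
by rewrite modn_small; have := ltn_ord j; lia.
Qed.

Lemma site_norm_ge0 l : 0 <= site_norm l.
Proof. by rewrite mulr_ge0 // ltW // mesh_gt0. Qed.

Lemma cycle_normD1 k : (cycle_norm (k + Zp1)%R <= (cycle_norm k).+1)%N.
Proof.
rewrite /cycle_norm /= modnDmr; have km := ltn_ord k.
case: (ltnP k.+1 m.+1) => k1; first by rewrite addn1 modn_small //; lia.
have -> : (k + 1 = m.+1)%N by lia.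
by rewrite modnn; lia.
Qed.

Lemma cycle_normB1 k : (cycle_norm (k - Zp1)%R <= (cycle_norm k).+1)%N.
Proof.
rewrite /cycle_norm val_subZp /=; have km := ltn_ord k.
case: (posnP m) => [m0|m0].
  by move: k km; rewrite m0 => k km; rewrite modn1 /=; lia.
by rewrite modn_small //; case: ifP => h; lia.
Qed.

Lemma site_norm_step (h : int * int) l : h \in nbrs ->
  site_norm (l + step m h) <= site_norm l + eps.
Proof.
have e0 := mesh_gt0.
have H (a b : nat) : (a <= b.+1)%N -> eps * a%:R <= eps * b%:R + eps.
  by move=> ab; rewrite -[X in _ + X]mulr1 -mulrDr ler_pM2l // natr1 ler_nat.
rewrite !inE => /or4P[] /eqP->; rewrite /site_norm /step /=; apply: H.
- by rewrite addr0 -addSn leq_add2r; exact: cycle_normD1.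
- by rewrite addr0 -addSn leq_add2r mulrN1z; exact: cycle_normB1.
- by rewrite addr0 -addnS leq_add2l; exact: cycle_normD1.
- by rewrite addr0 -addnS leq_add2l mulrN1z; exact: cycle_normB1.
Qed.

(** The direct path from i to j and the path around the circle, closed up by the
    period [mesh R m * m.+1%:R = 1], both bound the increment. *)
Lemma periodic_cycle_norm (g : R -> R) (L : R) i j : 0 <= L ->
  (forall u (k : int), g (u + k%:~R) = g u) ->
  (forall u v, `|g u - g v| <= L * `|u - v|) ->
  `|g (eps * i%:R) - g (eps * j%:R)| <= L * (eps * (cycle_norm (i - j))%:R).
Proof.
move=> L0 gp gL; have e0 := mesh_gt0; have N1 := mesh_size.
have im := ltn_ord i; have jm := ltn_ord j.
have H (a : R) : `|g (eps * i%:R) - g (eps * j%:R)| <= L * a ->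
  forall b, a <= b -> `|g (eps * i%:R) - g (eps * j%:R)| <= L * b.
  by move=> h b ab; apply: le_trans h _; rewrite ler_wpM2l.
have gp1 u : g (u + eps * m.+1%:R) = g u by rewrite N1 -{1}(mulr1z 1) gp.
have natE (a : nat) (z : R) : 0 <= z -> z = a%:R -> `|eps * z| = eps * a%:R.
  by move=> z0 <-; rewrite ger0_norm // mulr_ge0 // ltW.
rewrite /cycle_norm val_subZp; case: leqP => ji.
- case: (leqP (i - j) (m.+1 - (i - j))) => c.
    apply: (H (eps * (i - j)%:R)); last by rewrite ler_pM2l // ler_nat; lia.
    rewrite -(natE (i - j)%N (i%:R - j%:R)) ?natrB ?subr_ge0 ?ler_nat //.
    by rewrite mulrBr; exact: gL.
  apply: (H (eps * (m.+1 - (i - j))%:R)); last by rewrite ler_pM2l // ler_nat; lia.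
  rewrite -(natE (m.+1 - (i - j))%N (m.+1%:R - (i%:R - j%:R))); last 2 first.
  + by rewrite subr_ge0 -natrB // ler_nat; lia.
  + by rewrite !natrB //; lia.
  rewrite -(gp1 (eps * j%:R)).
  rewrite (_ : eps * (_ - _) = - (eps * i%:R - (eps * j%:R + eps * m.+1%:R))); last by ring.
  by rewrite normrN; exact: gL.
- case: (leqP (i + m.+1 - j) (m.+1 - (i + m.+1 - j))) => c.
    apply: (H (eps * (i + m.+1 - j)%:R)); last by rewrite ler_pM2l // ler_nat; lia.
    rewrite -(natE (i + m.+1 - j)%N (i%:R + m.+1%:R - j%:R)); last 2 first.
    + by rewrite subr_ge0 -natrD ler_nat; lia.
    + by rewrite -natrD -natrB //; lia.
    rewrite -(gp1 (eps * i%:R)).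
    by rewrite mulrBr mulrDr; exact: gL.
  apply: (H (eps * (m.+1 - (i + m.+1 - j))%:R)); last by rewrite ler_pM2l // ler_nat; lia.
  rewrite -(natE (m.+1 - (i + m.+1 - j))%N (j%:R - i%:R)); last 2 first.
  + by rewrite subr_ge0 ler_nat; lia.
  + by rewrite -natrB ?(ltnW ji) //; congr (_%:R); lia.
  by rewrite mulrBr distrC; apply: le_trans (gL _ _) _; rewrite distrC.
Qed.

Lemma site_lipschitz (F : plane R -> R) (L : R) l y : 0 <= L ->
  Defs.periodic F -> coord_lipschitz L F ->
  `|F (pos l) - F (pos y)| <= L * site_norm (l - y).
Proof.
move=> L0 Fp FL; rewrite /pos.
have h1 := @periodic_cycle_norm (fun u => F (u, eps * l.2%:R)) L l.1 y.1 L0.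
have h2 := @periodic_cycle_norm (fun u => F (eps * y.1%:R, u)) L l.2 y.2 L0.
have {}h1 := h1 (fun u z => etrans (congr1 (fun v => F (_, v)) (esym (addr0 _)))
  (Fp (u, eps * l.2%:R) z 0)) (fun u v => (FL v u _).1).
have {}h2 := h2 (fun u z => etrans (congr1 (fun v => F (v, _)) (esym (addr0 _)))
  (Fp (eps * y.1%:R, u) 0 z)) (fun u v => (FL v u _).2).
rewrite -(subrK (F (eps * y.1%:R, eps * l.2%:R)) (F (eps * l.1%:R, _))) -addrA.
apply: le_trans (ler_normD _ _) _.
rewrite /site_norm natrD !mulrDr; exact: lerD.
Qed.

Lemma pos_sub (F : plane R -> R) l y : Defs.periodic F ->
  F (pos l - pos y) = F (pos (l - y)).
Proof.
move=> Fp; have N1 := mesh_size.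
have H i j : exists k : int, eps * i%:R - eps * j%:R + k%:~R = eps * (i - j)%R%:R.
  rewrite val_subZp; have jm := ltn_ord j; case: leqP => ji.
    by exists 0; rewrite addr0 natrB // mulrBr.
  exists 1; rewrite natrB; last lia.
  by rewrite (natrD R i) mulrBr mulrDr N1 mulr1z; ring.
have [k1 H1] := H l.1 y.1; have [k2 H2] := H l.2 y.2.
rewrite -(Fp (pos l - pos y) k1 k2); congr (F (_, _)); [exact: H1|exact: H2].
Qed.

End Sites.

(** * Fluctuations of the empirical measure at dyadic scales *)

Section DyadicChaining.
Context {R : realType} (m : nat).
Implicit Types (l : site m) (phi : plane R -> R) (sigma : site m -> R).

Definition dyadic_index (k i : nat) : nat := (2 ^ k * i) %/ m.+1.

Lemma dyadic_index_lt k (i : 'I_m.+1) : (dyadic_index k i < 2 ^ k)%N.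
Proof. by rewrite ltn_divLR // ltn_pmul2l ?expn_gt0. Qed.

Lemma dyadic_index_half k i : dyadic_index k i = (dyadic_index k.+1 i %/ 2)%N.
Proof. by rewrite /dyadic_index -divnMA expnSr mulnAC divnMr. Qed.

Definition cell k l : 'I_(2 ^ k) * 'I_(2 ^ k) :=
  (Ordinal (dyadic_index_lt k l.1), Ordinal (dyadic_index_lt k l.2)).

(** Cells are represented by their corner in the plane, which need not be a lattice
    site; test functions are defined there as well. *)
Definition dyadic_point k (a : nat * nat) : plane R :=
  (a.1%:R / 2 ^+ k, a.2%:R / 2 ^+ k).

Definition dyadic_site k l : plane R := dyadic_point k (dyadic_index k l.1, dyadic_index k l.2).

Definition cell_mass k sigma (Q : 'I_(2 ^ k) * 'I_(2 ^ k)) : R :=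
  \sum_(l | cell k l == Q) sigma l.

Arguments cell_mass k sigma Q : clear implicits.

Lemma lipschitz_plane phi x y (a : R) : coord_lipschitz 1 phi ->
  `|x.1 - y.1| <= a -> `|x.2 - y.2| <= a -> `|phi x - phi y| <= 2 * a.
Proof.
case: x y => [x1 x2] [y1 y2] /= L h1 h2.
have [+ _] := L y1 x1 x2; have [_] := L y2 x2 y1; rewrite !mul1r => g1 g2.
rewrite -(subrK (phi (y1, x2)) (phi (x1, x2))) -addrA.
by apply: le_trans (ler_normD _ _) _; lra.
Qed.

Let step_point k (a : nat) :
  `|a%:R / 2 ^+ k.+1 - (a %/ 2)%:R / 2 ^+ k| <= (2 ^+ k.+1)^-1 :> R.
Proof.
have p0 : 0 < 2 ^+ k.+1 :> R by exact: exprn_gt0.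
have -> : a%:R / 2 ^+ k.+1 - (a %/ 2)%:R / 2 ^+ k = (a %% 2)%:R / 2 ^+ k.+1 :> R.
  rewrite {1}(divn_eq a 2) natrD natrM exprS; field.
  by rewrite expf_neq0.
rewrite ger0_norm ?divr_ge0 ?(ltW p0) // ler_piMl ?invr_ge0 ?(ltW p0) //.
by rewrite lern1 -ltnS ltn_mod.
Qed.

Let site_point k (i : nat) :
  `|mesh R m * i%:R - (dyadic_index k i)%:R / 2 ^+ k| <= (2 ^+ k)^-1.
Proof.
have p0 : 0 < 2 ^+ k :> R by exact: exprn_gt0.
have N0 : 0 < m.+1%:R :> R by rewrite ltr0n.
have -> : mesh R m * i%:R - (dyadic_index k i)%:R / 2 ^+ k =
    ((2 ^ k * i) %% m.+1)%:R / m.+1%:R / 2 ^+ k.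
  rewrite /mesh /dyadic_index.
  have := congr1 (fun a => a%:R : R) (divn_eq (2 ^ k * i) m.+1).
  rewrite natrD !natrM natrX => E.
  rewrite (_ : m.+1%:R^-1 * i%:R = (2 ^+ k * i%:R) / m.+1%:R / 2 ^+ k); last first.
    by field; rewrite ?gt_eqF.
  by rewrite E; field; rewrite !gt_eqF.
rewrite ger0_norm ?divr_ge0 ?(ltW p0) // ler_piMl ?invr_ge0 ?(ltW p0) //.
by rewrite ler_pdivrMr // mul1r ler_nat ltnW // ltn_mod.
Qed.

(** Telescoping of [phi] along the corners of the cells that contain a site. Corners of
    consecutive levels differ by at most 2^-(k+1) in each coordinate, and the
    increment depends on the finer cell only, so sigma enters through its cell
    masses. *)
Lemma dyadic_chaining phi sigma J : coord_lipschitz 1 phi -> \sum_l sigma l = 0 ->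
  \sum_l sigma l * phi (pos l) <=
    \sum_(k < J) (2 ^+ k)^-1 * \sum_Q `|cell_mass k.+1 sigma Q|
    + 2 / 2 ^+ J * \sum_l `|sigma l|.
Proof.
move=> L s0.
have E l : phi (pos l) = phi (0, 0) +
    \sum_(k < J) (phi (dyadic_site k.+1 l) - phi (dyadic_site k l)) +
    (phi (pos l) - phi (dyadic_site J l)).
  rewrite -(big_mkord xpredT (fun k => phi (dyadic_site k.+1 l) - phi (dyadic_site k l))).
  rewrite telescope_sumr // (_ : dyadic_site 0 l = (0, 0)); first by ring.
  rewrite /dyadic_site /dyadic_point /dyadic_index expn0 !mul1n !divn_small ?ltn_ord //=.
  by rewrite mul0r.
under eq_bigr => l _ do rewrite E 2!mulrDr.
rewrite 2!big_split /= -mulr_suml s0 mul0r add0r; apply: lerD.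
- under eq_bigr => l _ do rewrite mulr_sumr.
  rewrite exchange_big /=; apply: ler_sum => k _.
  pose D (Q : 'I_(2 ^ k.+1) * 'I_(2 ^ k.+1)) : R := phi (dyadic_point k.+1 (val Q.1, val Q.2)) -
    phi (dyadic_point k (val Q.1 %/ 2, val Q.2 %/ 2)%N).
  rewrite (eq_bigr (fun l => sigma l * D (cell k.+1 l))); last first.
    by move=> l _; rewrite /D /dyadic_site /= -!dyadic_index_half.
  rewrite (partition_big (cell k.+1) xpredT) //= mulr_sumr; apply: ler_sum => Q _.
  rewrite (eq_bigr (fun l => sigma l * D Q)); last by move=> l /eqP ->.
  rewrite -mulr_suml -/(cell_mass _ _ _) mulrC.
  apply: le_trans (ler_norm _) _; rewrite normrM ler_wpM2r //.
  apply: le_trans (lipschitz_plane (a := (2 ^+ k.+1)^-1) L _ _) _; try exact: step_point.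
  by rewrite exprS invfM mulVKf.
- rewrite mulr_sumr; apply: ler_sum => l _.
  apply: le_trans (ler_norm _) _; rewrite normrM mulrC ler_wpM2r //.
  by apply: lipschitz_plane => //; exact: site_point.
Qed.

End DyadicChaining.
Arguments cell_mass {R m} k sigma Q.

Section EmpiricalMeasure.
Context {R : realType} (m n : nat).
Context (q : 'I_n -> site m -> R) (I : pred 'I_n).
Hypothesis n0 : (0 < n)%N.
Hypothesis q0 : forall i a, 0 <= q i a.
Hypothesis q1 : forall i, \sum_a q i a = 1.
Local Notation config := {ffun 'I_n -> site m}.
Implicit Types (x : config).

Definition fluctuation x (l : site m) : R :=
  n%:R^-1 * \sum_(i | I i) ((x i == l)%:R - q i l).

Lemma sum_indicator (T : finType) (a : T) : \sum_l (a == l)%:R = 1 :> R.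
Proof.
rewrite (bigD1 a) //= eqxx big1 ?addr0 // => l la.
by rewrite eq_sym (negbTE la).
Qed.

Lemma fluctuation_sum x : \sum_l fluctuation x l = 0.
Proof.
rewrite /fluctuation -mulr_sumr exchange_big /= big1 ?mulr0 // => i _.
by rewrite sumrB sum_indicator q1 subrr.
Qed.

Let nR : 0 < n%:R :> R. Proof. by rewrite ltr0n. Qed.

Let sumI_le (F : 'I_n -> R) (c : R) : (forall i, 0 <= F i) -> (forall i, F i <= c) ->
  \sum_(i | I i) F i <= n%:R * c.
Proof.
move=> F0 Fc; apply: (@le_trans _ _ (\sum_i F i)).
  by rewrite [leRHS](bigID I) /= lerDl sumr_ge0.
apply: le_trans (ler_sum _ (fun i _ => Fc i)) _.
by rewrite sumr_const card_ord mulr_natl.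
Qed.

Lemma fluctuation_norm x : \sum_l `|fluctuation x l| <= 2.
Proof.
apply: (@le_trans _ _ (\sum_l n%:R^-1 * \sum_(i | I i) ((x i == l)%:R + q i l))).
  apply: ler_sum => l _; rewrite normrM (ger0_norm (_ : 0 <= n%:R^-1)) ?invr_ge0 //.
  apply: ler_wpM2l; first by rewrite invr_ge0.
  apply: le_trans (ler_norm_sum _ _ _) _; apply: ler_sum => i _.
  by apply: le_trans (ler_normB _ _) _; rewrite !ger0_norm.
rewrite -mulr_sumr exchange_big /= ler_pdivrMl // [_ * 2]mulrC mulrC.
apply: le_trans (sumI_le (c := 2) _ _) _; last by rewrite mulrC.
- by move=> i; apply: sumr_ge0 => l _; rewrite addr_ge0.
- by move=> i; rewrite big_split /= sum_indicator q1.
Qed.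

Lemma cell_mass_fluctuation k x Q : cell_mass k (fluctuation x) Q =
  n%:R^-1 * \sum_(i | I i) ((cell k (x i) == Q)%:R - cell_mass k (q i) Q).
Proof.
rewrite /cell_mass -mulr_sumr; congr (_ * _); rewrite exchange_big /=.
apply: eq_bigr => i _; rewrite sumrB; congr (_ - _).
case: eqP => [E|E].
  rewrite (bigD1 (x i)) ?E //= eqxx big1 ?addr0 // => l /andP[_ lx].
  by rewrite eq_sym (negbTE lx).
rewrite big1 // => l /eqP lQ; case: eqP => // xl; case: E; by rewrite xl.
Qed.

Lemma cell_variance k Q :
  product_mean q (fun x => cell_mass k (fluctuation x) Q ^+ 2) <=
  n%:R^-2 * \sum_(i | I i) cell_mass k (q i) Q.
Proof.
pose Z i (x : config) := (cell k (x i) == Q)%:R - cell_mass k (q i) Q.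
have Qsum i : \sum_a q i a * (cell k a == Q)%:R = cell_mass k (q i) Q.
  rewrite /cell_mass [RHS]big_mkcond /=; apply: eq_bigr => a _.
  by case: ifP => _; rewrite ?mulr1 ?mulr0.
under eq_product_mean => x do rewrite cell_mass_fluctuation exprMn.
rewrite product_meanZ exprVn ler_wpM2l ?invr_ge0 ?exprn_ge0 //.
rewrite (@product_variance _ _ _ q I Z) //.
- apply: ler_sum => i Ii.
  rewrite (@product_mean_coord _ _ _ q i (fun a => ((cell k a == Q)%:R - cell_mass k (q i) Q) ^+ 2)) //.
  set c := cell_mass k (q i) Q.
  rewrite (eq_bigr (fun a => q i a * (cell k a == Q)%:R * (1 - 2 * c) + c ^+ 2 * q i a)).
    rewrite big_split /= -mulr_suml -mulr_sumr Qsum q1 -/c.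
    rewrite -subr_ge0 (_ : _ - _ = c ^+ 2) ?sqr_ge0 //; ring.
  by move=> a _; case: eqP => _ /=; ring.
- move=> j x Ij; under eq_bigr do rewrite /Z update_same mulrBr.
  by rewrite sumrB Qsum -mulr_suml q1 mul1r subrr.
- by move=> j i a x _ _ ij; rewrite /Z update_other.
Qed.

(** The variances of the 4^k cell masses add up to at most 1/n; splitting them evenly
    amounts to the choice [lam = 2 ^+ k * Num.sqrt n%:R]. *)
Lemma mean_cell_masses k :
  \sum_Q product_mean q (fun x => `|cell_mass k (fluctuation x) Q|) <=
  2 ^+ k / Num.sqrt n%:R.
Proof.
set r := Num.sqrt (n%:R : R).
have r0 : 0 < r by rewrite sqrtr_gt0.
have rE : r ^+ 2 = n%:R by rewrite sqr_sqrtr // ltW.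
have p0 : 0 < 2 ^+ k :> R by exact: exprn_gt0.
pose lam := 2 ^+ k * r.
have lam0 : 0 < lam by rewrite mulr_gt0.
apply: (@le_trans _ _ (\sum_(Q : 'I_(2 ^ k) * 'I_(2 ^ k))
   (lam * (n%:R^-2 * \sum_(i | I i) cell_mass k (q i) Q) + lam^-1) / 2)).
  apply: ler_sum => Q _; apply: product_mean_norm_le => //.
  exact: cell_variance.
rewrite -mulr_suml big_split /= -!mulr_sumr exchange_big /=.
have -> : \sum_(i | I i) \sum_Q cell_mass k (q i) Q = \sum_(i | I i) 1.
  by apply: eq_bigr => i _; rewrite -(q1 i) [RHS](partition_big (cell k) xpredT).
have c1 : \sum_(i | I i) (1 : R) <= n%:R by rewrite -[leRHS]mulr1; apply: sumI_le.
rewrite [\sum_(Q : 'I_(2 ^ k) * 'I_(2 ^ k)) _]sumr_const card_prod card_ord.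
have -> : lam^-1 *+ (2 ^ k * 2 ^ k)%N = 2 ^+ k / r.
  rewrite -[LHS]mulr_natl natrM natrX /lam; field.
  by rewrite !gt_eqF.
have c2 : lam * (n%:R^-2 * \sum_(i | I i) 1) <= 2 ^+ k / r.
  apply: (@le_trans _ _ (lam * (n%:R^-2 * n%:R))).
    by rewrite !ler_wpM2l ?invr_ge0 ?exprn_ge0 // ltW.
  rewrite -rE /lam le_eqVlt; apply/orP; left; apply/eqP; field.
  by rewrite gt_eqF.
lra.
Qed.

Definition fluctuation_bound J x : R :=
  \sum_(k < J) (2 ^+ k)^-1 * \sum_Q `|cell_mass k.+1 (fluctuation x) Q|
    + 4 / 2 ^+ J.

Lemma fluctuation_boundP J x phi : coord_lipschitz 1 phi ->
  \sum_l fluctuation x l * phi (pos l) <= fluctuation_bound J x.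
Proof.
move=> L; apply: le_trans (dyadic_chaining J L (fluctuation_sum x)) _.
rewrite /fluctuation_bound lerD2l.
have := fluctuation_norm x.
have p0 : 0 <= 2 / 2 ^+ J :> R by rewrite divr_ge0 ?exprn_ge0.
move=> /(ler_wpM2l p0); lra.
Qed.

Lemma mean_fluctuation_bound J :
  product_mean q (fluctuation_bound J) <= 2 * J%:R / Num.sqrt n%:R + 4 / 2 ^+ J.
Proof.
rewrite product_meanD product_mean_cst // lerD2r product_mean_sum.
apply: (@le_trans _ _ (\sum_(k < J) 2 / Num.sqrt n%:R)); last first.
  by rewrite sumr_const card_ord -mulr_natl; set r := Num.sqrt _; lra.
apply: ler_sum => k _; rewrite product_meanZ product_mean_sum.
have p0 : 0 < 2 ^+ k :> R by exact: exprn_gt0.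
rewrite ler_pdivrMl //; apply: le_trans (mean_cell_masses _) _.
by rewrite exprS mulrA [_ * 2]mulrC.
Qed.

End EmpiricalMeasure.

(** With J about log2 n, the J levels cost O(J / sqrt n), and the finest cells, of side
    less than 2/n, cost O(1/n). The constant absorbs ln 2 >= 1/2. *)
Lemma dyadic_rate (R : realType) (n : nat) : (2 <= n)%N ->
  exists J, 2 * J%:R / Num.sqrt n%:R + 4 / 2 ^+ J <= 20 * (ln n%:R / Num.sqrt n%:R) :> R.
Proof.
move=> n2; have n0 : (0 < n)%N by lia.
exists (trunc_log 2 n); set J := trunc_log 2 n.
have J1 : (1 <= J)%N by apply: trunc_log_max.
have Jn : (2 ^ J <= n)%N by apply: trunc_logP.
have nJ : (n < 2 ^ J.+1)%N by apply: trunc_log_ltn.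
set r := Num.sqrt (n%:R : R).
have nR : 0 < n%:R :> R by rewrite ltr0n.
have r0 : 0 < r by rewrite sqrtr_gt0.
have rE : r ^+ 2 = n%:R by rewrite sqr_sqrtr // ltW.
have r1 : 1 <= r by rewrite -sqrtr1 ler_wsqrtr // ler1n.
have ln2 : 2^-1 <= ln 2 :> R.
  have : ln (1 + - 2^-1) <= - 2^-1 :> R by apply: le_ln1Dx; lra.
  rewrite (_ : 1 + - 2^-1 = 2^-1 :> R); last by field.
  by rewrite lnV ?posrE // lerN2.
have lnn : J%:R / 2 <= ln n%:R :> R.
  apply: (@le_trans _ _ (J%:R * ln 2)); first by rewrite ler_wpM2l.
  by rewrite mulr_natl -lnXn // ler_ln ?posrE ?exprn_gt0 // -natrX ler_nat.
have J1R : 1 <= J%:R :> R by rewrite ler1n.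
have p0 : 0 < 2 ^+ J :> R by exact: exprn_gt0.
have h : (2 ^+ J)^-1 <= 2 / r.
  rewrite -[leRHS]invf_div lef_pV2 ?posrE ?divr_gt0 //.
  rewrite ler_pdivrMr // mulrC -exprS -natrX.
  apply: (@le_trans _ _ n%:R); last by rewrite ler_nat ltnW.
  by rewrite -rE expr2 ler_peMr // ltW.
have h2 : 2 * J%:R / r + 4 / 2 ^+ J <= (2 * J%:R + 8) / r by rewrite mulrDl; lra.
apply: le_trans h2 _; rewrite mulrA ler_pM2r ?invr_gt0 //; lra.
Qed.

(** * Pair forces and mean-field forces *)

Section Forces.
Context {R : realType} (m n : nat) (b : 'I_n -> bool).
Local Notation config := {ffun 'I_n -> site m}.
Implicit Types (x y : config) (g : site m -> R) (rho : bool -> site m -> R).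

(** One coordinate of [rw_force], resp. of [mf_force] below, with [g] standing for a
    partial derivative of the potential read on the lattice. *)
Definition pair_force g x (i : 'I_n) : R :=
  - (sgn (b i) / n%:R) * \sum_(j | j != i) sgn (b j) * g (x i - x j).

Definition field_force g rho (a : site m) (s : bool) : R :=
  - sgn s * \sum_y (rho true y - rho false y) * g (a - y).

Definition config_dist x y : R := \sum_i site_norm (x i - y i).

Hypothesis n0 : (0 < n)%N.

Let nR : 0 < n%:R :> R. Proof. by rewrite ltr0n. Qed.

Lemma normr_sgn (s : bool) : `|sgn s| = 1 :> R.
Proof. by case: s; rewrite /sgn ?normrN normr1. Qed.

Lemma pair_force_le g (G : R) x i : (forall l, `|g l| <= G) -> `|pair_force g x i| <= G.
Proof.
move=> gG; have G0 : 0 <= G by apply: le_trans (gG (x i)).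
rewrite /pair_force normrM normrN normrM normr_sgn mul1r ger0_norm ?invr_ge0 //.
rewrite ler_pdivrMl //; apply: le_trans (ler_norm_sum _ _ _) _.
apply: (@le_trans _ _ (\sum_(j < n) G)); last by rewrite sumr_const card_ord mulr_natl.
rewrite [leRHS](bigID (fun j => j != i)) /= -[leLHS]addr0; apply: lerD; last exact: sumr_ge0.
by apply: ler_sum => j _; rewrite normrM normr_sgn mul1r.
Qed.

Lemma field_force_le g (G : R) rho a s : (forall l, `|g l| <= G) -> is_probability rho ->
  `|field_force g rho a s| <= G.
Proof.
move=> gG [r0 r1]; have G0 : 0 <= G by apply: le_trans (gG a).
rewrite /field_force normrM normrN normr_sgn mul1r.
apply: le_trans (ler_norm_sum _ _ _) _.
apply: (@le_trans _ _ (\sum_y (rho true y + rho false y) * G)).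
  apply: ler_sum => y _; rewrite normrM; apply: ler_pM => //.
  by apply: le_trans (ler_normB _ _) _; rewrite !ger0_norm.
rewrite -mulr_suml big_split /=.
by move: r1; rewrite big_bool /= => ->; rewrite mul1r.
Qed.

Lemma pair_force_lipschitz g (L : R) x y : 0 <= L ->
  (forall l l', `|g l - g l'| <= L * site_norm (l - l')) ->
  \sum_i `|pair_force g x i - pair_force g y i| <= 2 * L * config_dist x y.
Proof.
move=> L0 gL; pose d i := site_norm (x i - y i) : R.
have d0 i : 0 <= d i by exact: site_norm_ge0.
have H i j : `|g (x i - x j) - g (y i - y j)| <= L * (d i + d j).
  rewrite -(subrK (g (y i - x j)) (g (x i - x j))) -addrA.
  apply: le_trans (ler_normD _ _) _; rewrite mulrDr; apply: lerD.
    by apply: le_trans (gL _ _) _; rewrite opprB addrA subrK.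
  rewrite distrC; apply: le_trans (gL _ _) _.
  by rewrite opprB addrC addrA subrK.
apply: (@le_trans _ _ (\sum_i n%:R^-1 * \sum_j L * (d i + d j))).
  apply: ler_sum => i _; rewrite /pair_force -mulrBr normrM normrN normrM normr_sgn mul1r.
  rewrite ger0_norm ?invr_ge0 // ler_wpM2l ?invr_ge0 //.
  rewrite -sumrB; apply: le_trans (ler_norm_sum _ _ _) _.
  rewrite [leRHS](bigID (fun j => j != i)) /= -[leLHS]addr0; apply: lerD.
    by apply: ler_sum => j _; rewrite -mulrBr normrM normr_sgn mul1r.
  by apply: sumr_ge0 => j _; rewrite mulr_ge0 // addr_ge0.
under eq_bigr do rewrite -mulr_sumr big_split /= sumr_const card_ord.
rewrite -mulr_sumr -mulr_sumr big_split /= sumr_const card_ord -/(config_dist x y).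
rewrite sumrMnl -/(config_dist x y) le_eqVlt; apply/orP; left; apply/eqP.
rewrite -!(mulr_natl (config_dist x y)); field.
by rewrite gt_eqF.
Qed.

Section MeanForceError.
Context (rho : bool -> site m -> R).
Hypothesis rhoP : is_probability rho.

Definition mass s : R := \sum_l rho s l.
Definition particle_law (i : 'I_n) (a : site m) : R := rho (b i) a / mass (b i).
Definition sign_count s : nat := #|[set i | b i == s]%SET|.
(** The quantity kappa; by [imbalanceE] it is the same for both signs. *)
Definition imbalance : R := `|mass true - (sign_count true)%:R / n%:R|.

Let rho0 s l : 0 <= rho s l. Proof. by have [] := rhoP. Qed.

Lemma mass_ge0 s : 0 <= mass s. Proof. exact: sumr_ge0. Qed.

Lemma mass_sum : mass true + mass false = 1.
Proof. by have [_] := rhoP; rewrite big_bool. Qed.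

Lemma mass0_rho s l : mass s = 0 -> rho s l = 0.
Proof. by move=> /psumr_eq0P; apply. Qed.

Lemma sign_count_sum : ((sign_count true)%:R + (sign_count false)%:R = n%:R :> R).
Proof.
rewrite -natrD; congr (_%:R); rewrite -[RHS](card_ord n) /sign_count.
rewrite -(cardsC [set i | b i == true]%SET); congr (_ + _)%N.
by apply: eq_card => i; rewrite !inE; case: (b i).
Qed.

Lemma imbalanceE s : `|(sign_count s)%:R / n%:R - mass s| = imbalance.
Proof.
case: s; first by rewrite distrC.
have := mass_sum; have := sign_count_sum => e1 e2.
have nN : n%:R != 0 :> R by rewrite gt_eqF.
have -> : mass false = 1 - mass true by rewrite -e2; ring.
have -> : (sign_count false)%:R = n%:R - (sign_count true)%:R :> R by rewrite -e1; ring.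
by rewrite /imbalance; congr (`|_|); field.
Qed.

Hypothesis massP : forall i, mass (b i) != 0.

Lemma particle_law_ge0 i a : 0 <= particle_law i a.
Proof. by rewrite divr_ge0 // mass_ge0. Qed.

Lemma particle_law_sum i : \sum_a particle_law i a = 1.
Proof. by rewrite -mulr_suml -/(mass _) divff. Qed.

(** With H s the mean of [g] under the normalized component of sign s, the pair force
    differs from the mean-field force by a sum of centred independent terms [W], by
    the mass defects of the two signs, and by the missing self-interaction of
    particle i. *)
Lemma mean_force_error g (G : R) i : 0 < G -> (forall l, `|g l| <= G) ->
  product_mean particle_law
    (fun x => `|field_force g rho (x i) (b i) - pair_force g x i|) <=
  3 * G * ((Num.sqrt n%:R)^-1 + imbalance).
Proof.
move=> G0 gG.
pose H s (a : site m) := (\sum_y rho s y * g (a - y)) / mass s.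
have HG s a : `|H s a| <= G.
  rewrite /H normrM; have [->|ms] := eqVneq (mass s) 0.
    by rewrite invr0 normr0 mulr0 ltW.
  have mp : 0 < mass s by rewrite lt_neqAle eq_sym ms mass_ge0.
  rewrite normfV (gtr0_norm mp) ler_pdivrMr // mulrC /mass mulr_suml.
  apply: le_trans (ler_norm_sum _ _ _) _; apply: ler_sum => y _.
  by rewrite normrM ger0_norm // ler_wpM2l.
have HE s a : \sum_y rho s y * g (a - y) = mass s * H s a.
  rewrite /H; have [ms|ms] := eqVneq (mass s) 0; last by rewrite mulrCA divff ?mulr1.
  by rewrite ms mul0r big1 // => y _; rewrite mass0_rho // mul0r.
pose Z (j : 'I_n) (x : config) : R := sgn (b j) * (g (x i - x j) - H (b j) (x i)).
pose W x := \sum_(j | j != i) Z j x.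
set r := Num.sqrt (n%:R : R).
have r0 : 0 < r by rewrite sqrtr_gt0.
have rE : r ^+ 2 = n%:R by rewrite sqr_sqrtr // ltW.
have r1 : 1 <= r by rewrite -sqrtr1 ler_wsqrtr // ler1n.
have ptw x : `|field_force g rho (x i) (b i) - pair_force g x i| <=
    n%:R^-1 * `|W x| + (2 * imbalance * G + G / n%:R).
  have E1 : field_force g rho (x i) (b i) =
      - sgn (b i) * (mass true * H true (x i) - mass false * H false (x i)).
    rewrite /field_force; congr (_ * _); rewrite -!HE -sumrB.
    by apply: eq_bigr => y _; rewrite mulrBl.
  have E2 : \sum_(j | j != i) sgn (b j) * g (x i - x j) = W x +
      ((sign_count true)%:R * H true (x i) - (sign_count false)%:R * H false (x i)
       - sgn (b i) * H (b i) (x i)).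
    have -> : (sign_count true)%:R * H true (x i) - (sign_count false)%:R * H false (x i) =
        \sum_j sgn (b j) * H (b j) (x i).
      rewrite (bigID (fun j => b j == true)) /=.
      rewrite (eq_bigr (fun=> H true (x i))); last first.
        by move=> j /eqP ->; rewrite mul1r.
      rewrite [X in _ = _ + X](eq_bigr (fun=> - H false (x i))); last first.
        by move=> j; case: (b j) => //= _; rewrite mulN1r.
      rewrite !sumr_const mulNrn !mulr_natl /sign_count !cardsE.
      by congr (_ *+ _ - _ *+ _); apply: eq_card => j; rewrite /in_mem /=; case: (b j).
    rewrite [X in _ = _ + (X - _)](bigD1 i) //= addrAC subrr add0r /W -big_split /=.
    by apply: eq_bigr => j _; rewrite /Z -mulrDr subrK.
  rewrite E1 /pair_force E2.
  have nN : n%:R != 0 :> R by rewrite gt_eqF.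
  rewrite (_ : _ - _ = sgn (b i) * (n%:R^-1 * W x +
     (((sign_count true)%:R / n%:R - mass true) * H true (x i)
      - ((sign_count false)%:R / n%:R - mass false) * H false (x i)
      - n%:R^-1 * sgn (b i) * H (b i) (x i)))); last by field.
  rewrite normrM normr_sgn mul1r; apply: le_trans (ler_normD _ _) _.
  rewrite normrM (ger0_norm (_ : 0 <= n%:R^-1)) ?invr_ge0 // lerD2l.
  apply: le_trans (ler_normB _ _) _; apply: lerD.
    apply: le_trans (ler_normB _ _) _.
    rewrite (normrM _ (H true _)) (normrM _ (H false _)) !imbalanceE.
    have i0 : 0 <= imbalance by exact: normr_ge0.
    have := ler_wpM2l i0 (HG true (x i)); have := ler_wpM2l i0 (HG false (x i)); lra.
  rewrite (normrM _ (H _ _)) normrM normr_sgn mulr1 ger0_norm ?invr_ge0 // mulrC.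
  by rewrite ler_wpM2r ?invr_ge0.
apply: le_trans (ler_product_mean particle_law_ge0 ptw) _.
have q1 := particle_law_sum.
rewrite product_meanD product_meanZ product_mean_cst //.
have Zle j x : Z j x ^+ 2 <= 4 * G ^+ 2.
  have h : `|Z j x| <= 2 * G.
    rewrite /Z normrM normr_sgn mul1r; apply: le_trans (ler_normB _ _) _.
    by have := gG (x i - x j); have := HG (b j) (x i); lra.
  rewrite -(real_normK (num_real (Z j x))).
  rewrite (_ : 4 * G ^+ 2 = (2 * G) ^+ 2); last by ring.
  by rewrite lerXn2r // nnegrE ?normr_ge0 // mulr_ge0 // ltW.
have varW : product_mean particle_law (fun x => W x ^+ 2) <= n%:R * (4 * G ^+ 2).
  rewrite /W product_variance //.
  - apply: (@le_trans _ _ (\sum_(j < n) 4 * G ^+ 2)); last first.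
      by rewrite sumr_const card_ord -[leLHS]mulr_natl.
    have c0 : 0 <= 4 * G ^+ 2 by rewrite mulr_ge0 // sqr_ge0.
    rewrite [leRHS](bigID (fun j => j != i)) /= -[leLHS]addr0; apply: lerD; last exact: sumr_ge0.
    apply: ler_sum => j _; rewrite -[leRHS](product_mean_cst _ q1).
    by apply: ler_product_mean; [exact: particle_law_ge0|exact: Zle].
  - move=> j x ji.
    rewrite (eq_bigr (fun a => sgn (b j) * (particle_law j a * g (x i - a) -
        particle_law j a * H (b j) (x i)))); last first.
      by move=> a _; rewrite /Z update_same update_other 1?eq_sym //; ring.
    rewrite -mulr_sumr sumrB -mulr_suml q1 mul1r.
    rewrite (_ : \sum_a _ = H (b j) (x i)) ?subrr ?mulr0 //.
    by rewrite /H mulr_suml; apply: eq_bigr => a _; rewrite /particle_law mulrAC.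
  - move=> j k a x ji ki kj.
    by rewrite /Z !update_other // eq_sym.
(* the variance of W is at most 4 n G^2; this is the optimal value of lam *)
have lam0 : 0 < (2 * G * r)^-1 by rewrite invr_gt0 !mulr_gt0.
have := product_mean_norm_le particle_law_ge0 q1 lam0 varW.
rewrite -rE (_ : _ / 2 = 2 * G * r); last first.
  by field; rewrite !gt_eqF.
have ni : 0 <= (r ^+ 2)^-1 by rewrite invr_ge0 sqr_ge0.
move=> /(ler_wpM2l ni).
have -> : (r ^+ 2)^-1 * (2 * G * r) = 2 * G / r by field; rewrite gt_eqF.
have rr : (r ^+ 2)^-1 <= r^-1.
  by rewrite lef_pV2 ?posrE ?exprn_gt0 // expr2 ler_peMr // ltW.
have := ler_wpM2l (ltW G0) rr.
have i0 : 0 <= imbalance by exact: normr_ge0.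
have := mulr_ge0 (ltW G0) i0.
lra.
Qed.

End MeanForceError.
End Forces.

(** * Jump rates *)

Section Rates.
Context {R : realType} (m : nat).
Local Notation eps := (mesh R m).
Implicit Types (V : plane R -> R) (F : plane R).

Definition site_partial V (v : plane R) (l : site m) : R := 'd V (pos l) v.

Lemma sum_nbrs (f : int * int -> R) :
  \sum_(h <- nbrs) f h = f (1, 0) + f (-1, 0) + f (0, 1) + f (0, -1).
Proof. by rewrite /nbrs !big_cons big_nil addr0 !addrA. Qed.

Lemma dot_hvec h F : dot (hvec R m h) F = eps * (h.1%:~R * F.1 + h.2%:~R * F.2).
Proof. by rewrite /dot /hvec /=; ring. Qed.

Lemma dot_hvec_nbrs F : [/\ dot (hvec R m (1, 0)) F = eps * F.1,
  dot (hvec R m (-1, 0)) F = - (eps * F.1), dot (hvec R m (0, 1)) F = eps * F.2 &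
  dot (hvec R m (0, -1)) F = - (eps * F.2)].
Proof.
have z0 : (0 : int)%:~R = 0 :> R by [].
have z1 : (1 : int)%:~R = 1 :> R by [].
have zN : (-1 : int)%:~R = -1 :> R by [].
by rewrite !dot_hvec /= z0 z1 zN; split; ring.
Qed.

Lemma sum_dot_hvec F F' :
  \sum_(h <- nbrs) `|dot (hvec R m h) F - dot (hvec R m h) F'| =
  2 * eps * (`|F.1 - F'.1| + `|F.2 - F'.2|).
Proof.
have e0 := @mesh_gt0 R m.
rewrite sum_nbrs.
have [-> -> -> ->] := dot_hvec_nbrs F; have [-> -> -> ->] := dot_hvec_nbrs F'.
rewrite -!opprD !normrN -!mulrBr !normrM (gtr0_norm e0); ring.
Qed.

Lemma dot_hvec_le h F (G : R) : h \in nbrs -> `|F.1| <= G -> `|F.2| <= G ->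
  `|dot (hvec R m h) F| <= eps * G.
Proof.
move=> hn g1 g2; have e0 := @mesh_gt0 R m.
have [d1 d2 d3 d4] := dot_hvec_nbrs F.
move: hn; rewrite !inE => /or4P[] /eqP->;
  by rewrite ?d1 ?d2 ?d3 ?d4 ?normrN normrM (gtr0_norm e0) ler_pM2l.
Qed.

Lemma expR_lipschitz (M a b : R) : a <= M -> b <= M ->
  `|expR a - expR b| <= expR M * `|a - b|.
Proof.
wlog ab : a b / b <= a.
  move=> W aM bM; have [/W|/ltW/W] := leP b a; first exact.
  by rewrite distrC [`|a - b|]distrC; exact.
move=> aM bM; rewrite !ger0_norm ?subr_ge0 ?ler_expR //.
apply: (@le_trans _ _ (expR a * (a - b))); last first.
  by rewrite ler_wpM2r ?subr_ge0 // ler_expR.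
have := ler_wpM2l (expR_ge0 a) (expR_ge1Dx (b - a)).
rewrite -expRD (_ : a + (b - a) = b); [lra|ring].
Qed.

(** The prefactor (beta eps^2)^-1 is compensated by beta times the mesh in the exponent
    and by the mesh in front, the distance covered by a jump. [M] bounds the
    exponents. *)
Lemma rate_difference (beta G M : R) F F' : 0 < beta ->
  `|F.1| <= G -> `|F.2| <= G -> `|F'.1| <= G -> `|F'.2| <= G ->
  2^-1 * beta * (eps * G) <= M ->
  \sum_(h <- nbrs)
    `|(beta * eps ^+ 2)^-1 * expR (2^-1 * beta * dot (hvec R m h) F) -
      (beta * eps ^+ 2)^-1 * expR (2^-1 * beta * dot (hvec R m h) F')| * eps <=
  expR M * (`|F.1 - F'.1| + `|F.2 - F'.2|).
Proof.
move=> b0 F1 F2 F1' F2' HM; have e0 := @mesh_gt0 R m.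
have c0 : 0 < (beta * eps ^+ 2)^-1 by rewrite invr_gt0 mulr_gt0 ?exprn_gt0.
have hb : 0 < 2^-1 * beta by rewrite mulr_gt0.
have le F0 h : h \in nbrs -> `|F0.1| <= G -> `|F0.2| <= G ->
    2^-1 * beta * dot (hvec R m h) F0 <= M.
  move=> hn f1 f2; apply: le_trans HM; rewrite ler_pM2l //.
  exact: le_trans (ler_norm _) (dot_hvec_le hn f1 f2).
apply: (@le_trans _ _ (\sum_(h <- nbrs) (beta * eps ^+ 2)^-1 * expR M * (2^-1 * beta) * eps
    * `|dot (hvec R m h) F - dot (hvec R m h) F'|)).
  rewrite big_seq [leRHS]big_seq; apply: ler_sum => h hn.
  have L := expR_lipschitz (le F h hn F1 F2) (le F' h hn F1' F2').
  rewrite -mulrBr normrM (gtr0_norm hb) in L.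
  have c1 : 0 <= (beta * eps ^+ 2)^-1 * eps by rewrite mulr_ge0 // ltW.
  by rewrite -mulrBr normrM (gtr0_norm c0); have := ler_wpM2l c1 L; lra.
rewrite -mulr_sumr sum_dot_hvec le_eqVlt; apply/orP; left; apply/eqP.
by field; rewrite !gt_eqF.
Qed.

Lemma rate_ge0 (beta u : R) : 0 < beta -> 0 <= (beta * eps ^+ 2)^-1 * expR u.
Proof.
move=> b0; rewrite mulr_ge0 ?expR_ge0 // invr_ge0 mulr_ge0 ?(ltW b0) //.
by rewrite exprn_ge0 // ltW // mesh_gt0.
Qed.

Let fst_sum (I : finType) (P : pred I) (F : I -> plane R) :
  (\sum_(i | P i) F i).1 = \sum_(i | P i) (F i).1.
Proof. by apply: (big_morph (fun x : plane R => x.1)). Qed.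

Let snd_sum (I : finType) (P : pred I) (F : I -> plane R) :
  (\sum_(i | P i) F i).2 = \sum_(i | P i) (F i).2.
Proof. by apply: (big_morph (fun x : plane R => x.2)). Qed.

Let fst_comb (I : finType) (P : pred I) (c : R) (d : I -> R) (F : I -> plane R) :
  (c *: \sum_(i | P i) d i *: F i).1 = c * \sum_(i | P i) d i * (F i).1.
Proof. by congr (_ * _); exact: fst_sum. Qed.

Let snd_comb (I : finType) (P : pred I) (c : R) (d : I -> R) (F : I -> plane R) :
  (c *: \sum_(i | P i) d i *: F i).2 = c * \sum_(i | P i) d i * (F i).2.
Proof. by congr (_ * _); exact: snd_sum. Qed.

Lemma grad_sub V a y : Defs.periodic V -> (forall x, differentiable V x) ->
  (grad V (pos a - pos y)).1 = site_partial V (1, 0) (a - y) /\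
  (grad V (pos a - pos y)).2 = site_partial V (0, 1) (a - y).
Proof.
by move=> Vp dV; split; apply: (pos_sub a y (periodic_diff _ Vp dV)).
Qed.

Lemma mf_forceE V (rho : bool -> site m -> R) a s : Defs.periodic V ->
  (forall x, differentiable V x) ->
  (mf_force V rho (pos a) s).1 = field_force (site_partial V (1, 0)) rho a s /\
  (mf_force V rho (pos a) s).2 = field_force (site_partial V (0, 1)) rho a s.
Proof.
move=> Vp dV; split.
  apply: etrans (fst_comb xpredT (- sgn s) _ (fun y => grad V (pos a - pos y))) _.
  apply: (congr1 (fun z => - sgn s * z)); apply: eq_bigr => y _.
  exact: (congr1 (fun z => _ * z) (grad_sub a y Vp dV).1).
apply: etrans (snd_comb xpredT (- sgn s) _ (fun y => grad V (pos a - pos y))) _.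
apply: (congr1 (fun z => - sgn s * z)); apply: eq_bigr => y _.
exact: (congr1 (fun z => _ * z) (grad_sub a y Vp dV).2).
Qed.

Lemma rw_forceE V n (b : 'I_n -> bool) (x : config m n) i : Defs.periodic V ->
  (forall x, differentiable V x) ->
  (rw_force V b x i).1 = pair_force b (site_partial V (1, 0)) x i /\
  (rw_force V b x i).2 = pair_force b (site_partial V (0, 1)) x i.
Proof.
move=> Vp dV; split.
  apply: etrans (fst_comb (fun j => j != i) (- (sgn (b i) / n%:R)) (fun j => sgn (b j))
    (fun j => grad V (pos (x i) - pos (x j)))) _.
  apply: (congr1 (fun z => - (sgn (b i) / n%:R) * z)); apply: eq_bigr => j _.
  exact: (congr1 (fun z => _ * z) (grad_sub (x i) (x j) Vp dV).1).
apply: etrans (snd_comb (fun j => j != i) (- (sgn (b i) / n%:R)) (fun j => sgn (b j))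
  (fun j => grad V (pos (x i) - pos (x j)))) _.
apply: (congr1 (fun z => - (sgn (b i) / n%:R) * z)); apply: eq_bigr => j _.
exact: (congr1 (fun z => _ * z) (grad_sub (x i) (x j) Vp dV).2).
Qed.

End Rates.

(** * The mean-field flow *)

Section MeanFieldFlow.
Context {R : realType} (m : nat) (beta T : R) (V : plane R -> R).
Context (rho0 : bool -> site m -> R) (rho : R -> bool -> site m -> R).
Local Notation eps := (mesh R m).
Hypothesis Vper : Defs.periodic V.
Hypothesis Vdiff : forall x, differentiable V x.
Hypothesis beta0 : 0 < beta.
Hypothesis T0 : 0 < T.
Hypothesis rho0P : is_probability rho0.
Hypothesis rhoS : mf_solution beta V T rho0 rho.

Definition unstep (h : int * int) (l : site m) : site m := l + step m (- h).

Lemma step_opp (h : int * int) : step m (- h) = - step m h.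
Proof. by rewrite /step /= !mulrNz. Qed.

Lemma stepK h : cancel (fun l : site m => l + step m h) (unstep h).
Proof. by move=> l; rewrite /unstep step_opp addrK. Qed.

Lemma unstepK h : cancel (unstep h) (fun l : site m => l + step m h).
Proof. by move=> l; rewrite /unstep step_opp subrK. Qed.

Let rate h (t : R) l s := mf_rate beta V h (rho t) l s.

Definition mf_drift (t : R) (s : bool) (l : site m) : R :=
  \sum_(h <- nbrs) (mf_rate beta V h (rho t) (unstep h l) s * rho t s (unstep h l)
                    - mf_rate beta V h (rho t) l s * rho t s l).

Lemma mf_derive t s l : 0 < t < T ->
  is_derive t (1 : R) (fun u => rho u s l) (mf_drift t s l).
Proof.
have [_ _ D] := rhoS => tT; apply: (is_derive_eq (D t s l tT)).
rewrite mulr_sumr; apply: eq_bigr => h _; rewrite /Dh mulrC divfK //.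
by rewrite gt_eqF // mesh_gt0.
Qed.

Lemma mf_continuous s l : {within `[0, T], continuous (fun t => rho t s l)}.
Proof. by have [] := rhoS. Qed.

Let rate_continuous h l s : {within `[0, T], continuous (fun t => rate h t l s)}.
Proof.
have ff v a s' : {within `[0, T], continuous (fun t => field_force (site_partial V v) (rho t) a s')}.
  move=> z; apply: cvgM; first exact: cvg_cst.
  apply: cvg_sum => y _; apply: cvgM; last exact: cvg_cst.
  by apply: cvgB; exact: mf_continuous.
have dc : {within `[0, T], continuous (fun t => dot (hvec R m h) (mf_force V (rho t) (pos l) s))}.
  rewrite (_ : (fun t => _) = fun t =>
    (hvec R m h).1 * field_force (site_partial V (1, 0)) (rho t) l s +
    (hvec R m h).2 * field_force (site_partial V (0, 1)) (rho t) l s); last first.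
    by apply/funext => t; rewrite /dot; have [-> ->] := mf_forceE (rho t) l s Vper Vdiff.
  by move=> z; apply: cvgD; apply: cvgM; [exact: cvg_cst|exact: ff|exact: cvg_cst|exact: ff].
move=> z; apply: cvgM; first exact: cvg_cst.
apply: continuous_cvg; first exact: continuous_expR.
by apply: cvgM; [exact: cvg_cst|exact: dc].
Qed.

Let rate_ge0' h t l s : 0 <= rate h t l s.
Proof. by rewrite /rate /mf_rate [eps ^+ 2 * _]mulrC; exact: rate_ge0. Qed.

(** At a negative minimum over the sites, gains are at least the rates times the
    minimum and losses are favourable. The rates are bounded since they are
    continuous in time along the given solution. *)
Lemma mf_ge0 t s l : 0 <= t <= T -> 0 <= rho t s l.
Proof.
have HK : exists K : R, forall t l', 0 <= t <= T ->
    \sum_(h <- nbrs) rate h t (unstep h l') s <= K.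
  have H l' : exists c : R, forall t, 0 <= t <= T ->
      \sum_(h <- nbrs) rate h t (unstep h l') s <= c.
    have C : {within `[0, T], continuous (fun t => \sum_(h <- nbrs) rate h t (unstep h l') s)}.
      by move=> z; apply: cvg_sum => h _; exact: rate_continuous.
    have [c _ Hc] := EVT_max (ltW T0) C.
    exists (\sum_(h <- nbrs) rate h c (unstep h l') s) => u uT.
    by apply: Hc; rewrite in_itv.
  have [c Hc] := choice H.
  exists (\sum_l' `|c l'|) => u l' uT; apply: le_trans (Hc l' u uT) _.
  apply: le_trans (ler_norm _) _.
  by rewrite (bigD1 l') //= lerDl sumr_ge0.
have [K HKb] := HK.
move: t l; apply: (@max_principle R (site m) T K (fun t l => rho t s l) (fun t l => mf_drift t s l)).
- by move=> l; exact: mf_continuous.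
- by move=> t l; exact: mf_derive.
- by move=> l; have [-> _ _] := rhoS; have [] := rho0P.
- move=> t l /andP[t0 tT] neg min; rewrite /mf_drift.
  have tT' : 0 <= t <= T by rewrite !ltW.
  apply: (@le_trans _ _ ((\sum_(h <- nbrs) rate h t (unstep h l) s) * rho t s l)).
    by rewrite ler_wnM2r // ?(ltW neg) // HKb.
  rewrite mulr_suml; apply: ler_sum => h _.
  have r1 := rate_ge0' h t (unstep h l) s; have r2 := rate_ge0' h t l s.
  apply: le_trans (ler_wpM2l r1 (min (unstep h l))) _.
  by rewrite lerDl oppr_ge0; exact: mulr_ge0_le0 r2 (ltW neg).
Qed.

Lemma mf_mass t s : 0 <= t <= T -> \sum_l rho t s l = \sum_l rho0 s l.
Proof.
move=> /andP[t0 tT].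
have drift0 u : \sum_l mf_drift u s l = 0.
  rewrite /mf_drift exchange_big /= big1 // => h _; rewrite sumrB.
  rewrite [X in _ - X](reindex_inj (can_inj (unstepK h))) /=.
  by rewrite subrr.
have D (u : R) : u \in `]0, t[ -> is_derive u (1 : R) (fun u => \sum_l rho u s l) 0.
  rewrite in_itv /= => /andP[u0 ut].
  have Dl l : xpredT l -> is_derive u (1 : R) (fun u => rho u s l) (mf_drift u s l).
    by move=> _; apply: mf_derive; rewrite u0 (lt_le_trans ut).
  exact: is_derive_eq (is_derive_bigsum (index_enum _) Dl) (drift0 u).
have [|c _] := MVT_segment t0 D.
  move=> z; apply: cvg_sum => l _.
  apply: (@continuous_subspaceW _ _ _ `[0, T]); last exact: mf_continuous.
  by apply: subset_itvl; rewrite bnd_simp.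
by rewrite mul0r => /eqP; rewrite subr_eq0 => /eqP ->; have [-> _ _] := rhoS.
Qed.

Lemma mf_probability t : 0 <= t <= T -> is_probability (rho t).
Proof.
move=> tT; split; first by move=> s l; exact: mf_ge0.
by under eq_bigr do rewrite mf_mass //; have [_] := rho0P.
Qed.

End MeanFieldFlow.

(** * Interpolation between the two dynamics *)

Lemma within_reverse (R : realType) (t : R) (g : R -> R) :
  {within `[0, t], continuous g} -> {within `[0, t], continuous (fun u => g (t - u))}.
Proof.
move=> /subspace_continuousP gc; apply/subspace_continuousP => u ut.
have ut' : [set` `[0, t]] (t - u).
  by move: ut; rewrite /= !in_itv /= => /andP[? ?]; apply/andP; split; lra.
apply: (@cvg_comp _ _ _ (fun u => t - u) g _ (within [set` `[0, t]] (nbhs (t - u)))); last exact: gc.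
move=> P; rewrite /within /= => HP.
have C : {for u, continuous (fun u => t - u)}.
  by apply: cvgB; [exact: cvg_cst|exact: cvg_id].
have H : \forall s \near u, [set` `[0, t]] (t - s) -> P (t - s) by exact: (C _ HP).
suff : \forall s \near u, [set` `[0, t]] s -> P (t - s) by [].
apply: filterS H => s H st; apply: H.
by move: st; rewrite /= !in_itv /= => /andP[? ?]; apply/andP; split; lra.
Qed.

Section Comparison.
Context {R : realType} (m n : nat) (beta T : R) (V : plane R -> R) (b : 'I_n -> bool).
Context (rho0 : bool -> site m -> R) (rho : R -> bool -> site m -> R).
Context (p : R -> config m n -> config m n -> R) (G L M : R).
Local Notation eps := (mesh R m).
Hypothesis n0 : (0 < n)%N.
Hypothesis Vper : Defs.periodic V.
Hypothesis Vdiff : forall x, differentiable V x.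
Hypothesis beta0 : 0 < beta.
Hypothesis T0 : 0 < T.
Hypothesis G0 : 0 < G.
Hypothesis L0 : 0 <= L.
Hypothesis VG : forall v, basis_vector v -> forall l : site m, `|site_partial V v l| <= G.
Hypothesis VL : forall v, basis_vector v -> forall l l' : site m,
  `|site_partial V v l - site_partial V v l'| <= L * site_norm (l - l').
Hypothesis betaM : 2^-1 * beta * (eps * G) <= M.
Hypothesis pS : transition_semigroup (rw_generator beta V b) p.

Let V1 := site_partial V (1, 0) : site m -> R.
Let V2 := site_partial V (0, 1) : site m -> R.
Let b1 : basis_vector ((1, 0) : plane R). Proof. by left. Qed.
Let b2 : basis_vector ((0, 1) : plane R). Proof. by right. Qed.

Definition transitions : seq ('I_n * (int * int)) :=
  [seq (i, h) | i <- enum 'I_n, h <- nbrs].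
Definition transition_rate (j : 'I_n * (int * int)) (x : config m n) : R := rw_rate beta V b j.1 j.2 x.
Definition transition_jump (j : 'I_n * (int * int)) (x : config m n) := jump j.1 j.2 x.

Lemma sum_transitions (f : 'I_n * (int * int) -> R) :
  \sum_(j <- transitions) f j = \sum_i \sum_(h <- nbrs) f (i, h).
Proof. by rewrite /transitions big_allpairs big_enum. Qed.

Lemma rw_generatorE : rw_generator beta V b = jump_generator transitions transition_rate transition_jump.
Proof.
by apply/funext => x; apply/funext => y; rewrite /jump_generator sum_transitions.
Qed.

Lemma mem_transitions j : j \in transitions -> j.2 \in nbrs.
Proof. by case/allpairsP => -[i h] /= [_ hn ->]. Qed.

Lemma nbrs_opp h : h \in nbrs -> - h \in nbrs.
Proof. by rewrite !inE => /or4P[] /eqP->. Qed.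

Let transition_rate_ge0 j x : 0 <= transition_rate j x.
Proof. exact: rate_ge0. Qed.

Lemma config_distxx (x : config m n) : config_dist x x = 0 :> R.
Proof.
rewrite /config_dist big1 // => i _; rewrite subrr /site_norm /cycle_norm /=.
by rewrite !min0n mulr0.
Qed.

Let dist_update (x y x' y' : config m n) i (c : R) :
  (forall j, j != i -> x' j - y' j = x j - y j) ->
  site_norm (x' i - y' i) <= site_norm (x i - y i) + c ->
  config_dist x' y' <= config_dist x y + c.
Proof.
move=> same h; rewrite /config_dist (bigD1 i) //= [in leRHS](bigD1 i) //= addrAC.
apply: lerD => //; rewrite le_eqVlt; apply/orP; left; apply/eqP.
by apply: eq_bigr => j ji; rewrite same.
Qed.

Lemma config_dist_jump2 j (x y : config m n) :
  config_dist (transition_jump j x) (transition_jump j y) <= config_dist x y :> R.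
Proof.
rewrite -[leRHS]addr0; apply: (dist_update (i := j.1)).
- by move=> k kj; rewrite !ffunE (negbTE kj).
- by rewrite !ffunE eqxx opprD addrACA subrr !addr0.
Qed.

Lemma config_dist_jumpl j (x y : config m n) : j \in transitions ->
  config_dist (transition_jump j x) y <= config_dist x y + eps.
Proof.
move=> /mem_transitions jn; apply: (dist_update (i := j.1)).
- by move=> k kj; rewrite !ffunE (negbTE kj).
- by rewrite !ffunE eqxx addrAC; exact: site_norm_step.
Qed.

Lemma config_dist_jumpr j (x y : config m n) : j \in transitions ->
  config_dist x (transition_jump j y) <= config_dist x y + eps.
Proof.
move=> /mem_transitions jn; apply: (dist_update (i := j.1)).
- by move=> k kj; rewrite !ffunE (negbTE kj).
- by rewrite !ffunE eqxx opprD addrA -step_opp; exact/site_norm_step/nbrs_opp.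
Qed.

Let eq_norm_le (u v c : R) : u = v -> `|v| <= c -> `|u| <= c.
Proof. by move=> ->. Qed.

Let eq_dist_le (u u' v v' : R) : u = u' -> v = v' -> `|u - v| <= `|u' - v'|.
Proof. by move=> -> ->. Qed.

Let rw_force_le (z : config m n) i : `|(rw_force V b z i).1| <= G /\ `|(rw_force V b z i).2| <= G.
Proof.
have [x1 x2] := rw_forceE b z i Vper Vdiff; split.
  exact: (eq_norm_le x1 (pair_force_le b n0 z i (VG b1))).
exact: (eq_norm_le x2 (pair_force_le b n0 z i (VG b2))).
Qed.

Let mf_force_le (nu : bool -> site m -> R) (a : site m) s : is_probability nu ->
  `|(mf_force V nu (pos a) s).1| <= G /\ `|(mf_force V nu (pos a) s).2| <= G.
Proof.
move=> nuP; have [x1 x2] := mf_forceE nu a s Vper Vdiff; split.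
  exact: (eq_norm_le x1 (field_force_le a s (VG b1) nuP)).
exact: (eq_norm_le x2 (field_force_le a s (VG b2) nuP)).
Qed.

(** The 4 counts the two coordinates of the force and the factor 2 of
    [pair_force_lipschitz]; the exponential comes from [rate_difference]. *)
Lemma coupling_rate (x y : config m n) :
  \sum_(j <- transitions) `|transition_rate j x - transition_rate j y| * eps <=
  4 * expR M * L * config_dist x y.
Proof.
rewrite sum_transitions.
apply: (@le_trans _ _ (\sum_i expR M * (`|pair_force b V1 x i - pair_force b V1 y i| +
    `|pair_force b V2 x i - pair_force b V2 y i|))).
  apply: ler_sum => i _.
  have [x1 x2] := rw_forceE b x i Vper Vdiff; have [y1 y2] := rw_forceE b y i Vper Vdiff.
  have [l1 l2] := rw_force_le x i; have [l3 l4] := rw_force_le y i.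
  have RD := rate_difference beta0 l1 l2 l3 l4 betaM.
  apply: le_trans RD _; apply: ler_wpM2l; first exact: expR_ge0.
  exact: lerD (eq_dist_le x1 y1) (eq_dist_le x2 y2).
rewrite -mulr_sumr big_split /=.
have h1 := pair_force_lipschitz b n0 x y L0 (VL b1).
have h2 := pair_force_lipschitz b n0 x y L0 (VL b2).
have := ler_wpM2l (expR_ge0 M) (lerD h1 h2).
by move=> /le_trans; apply; rewrite le_eqVlt; apply/orP; left; apply/eqP; ring.
Qed.

Let K : R := 4 * expR M * L.
Let K0 : 0 <= K. Proof. by rewrite mulr_ge0 // mulr_ge0 // expR_ge0. Qed.

Lemma rw_semigroup_lipschitz (f : config m n -> R) (L1 t : R) : 0 <= L1 ->
  (forall x y, f x - f y <= L1 * config_dist x y) -> 0 <= t ->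
  forall x y, semigroup_op p t f x - semigroup_op p t f y <=
    L1 * expR (K * t) * config_dist x y.
Proof.
move=> L10 fL t0 x y.
have pS' := pS; rewrite rw_generatorE in pS'.
apply: (semigroup_lipschitz transition_rate_ge0 pS' (e := eps)) => //.
- by move=> j x' y' _; exact: config_dist_jump2.
- by move=> j x' y' jn; exact: config_dist_jumpl.
- by move=> j x' y' jn; exact: config_dist_jumpr.
- exact: coupling_rate.
Qed.

Hypothesis rho0P : is_probability rho0.
Hypothesis rhoS : mf_solution beta V T rho0 rho.
Hypothesis massP : forall i, mass rho0 (b i) != 0.

(** The normalization uses the masses at time 0, which the flow preserves, so that the
    law is differentiable by linearity. *)
Definition flow_law (t : R) (i : 'I_n) (a : site m) : R := rho t (b i) a / mass rho0 (b i).

Let massE t s : 0 <= t <= T -> mass (rho t) s = mass rho0 s.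
Proof. by move=> tT; rewrite /mass (mf_mass rhoS). Qed.

Lemma flow_lawE t : 0 <= t <= T -> flow_law t = particle_law b (rho t).
Proof.
by move=> tT; apply/funext => i; apply/funext => a; rewrite /flow_law /particle_law massE.
Qed.

Let rhoP t : 0 <= t <= T -> is_probability (rho t).
Proof. exact: (mf_probability Vper Vdiff beta0 T0 rho0P rhoS). Qed.

Lemma flow_law_derive t i a : 0 < t < T ->
  is_derive t (1 : R) (fun t => flow_law t i a)
    (\sum_(h <- nbrs) (mf_rate beta V h (rho t) (unstep h a) (b i) * flow_law t i (unstep h a)
                    - mf_rate beta V h (rho t) a (b i) * flow_law t i a)).
Proof.
move=> tT; have D := is_deriveZ (mass rho0 (b i))^-1 (mf_derive rhoS (b i) a tT).
rewrite (_ : (fun t => _) = ((mass rho0 (b i))^-1 \*: (fun t => rho t (b i) a))); last first.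
  by apply/funext => u; rewrite /flow_law mulrC.
apply: (is_derive_eq D); rewrite [LHS]mulr_sumr; apply: eq_bigr => h _.
rewrite mulrBr; congr (_ - _); rewrite /flow_law mulrCA; congr (_ * _); exact: mulrC.
Qed.

Definition drift_error (t : R) (F : config m n -> R) (x : config m n) : R :=
  \sum_i \sum_(h <- nbrs) (mf_rate beta V h (rho t) (x i) (b i) - rw_rate beta V b i h x)
     * (F (jump i h x) - F x).

(** The time derivative of [flow_law] is moved to [F] by duality, and that of the
    semigroup is minus its generator, so only the difference of the rates
    remains. *)
Lemma interpolation_derive (f : config m n -> R) (t u : R) : 0 < u < t -> t <= T ->
  is_derive u (1 : R) (fun u => product_mean (flow_law u) (semigroup_op p (t - u) f))
    (product_mean (flow_law u) (drift_error u (semigroup_op p (t - u) f))).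
Proof.
move=> /andP[u0 ut] tT.
have uT : 0 < u < T by rewrite u0 (lt_le_trans ut).
have tu0 : 0 < t - u by rewrite subr_gt0.
have pS' := pS; rewrite rw_generatorE in pS'.
pose F := semigroup_op p (t - u) f.
pose gen x := \sum_(j <- transitions) transition_rate j x * (F (transition_jump j x) - F x).
have DF x : is_derive u (1 : R) (fun u => semigroup_op p (t - u) f x) (- gen x).
  have D1 : is_derive u (1 : R) (fun u => t - u) (- 1).
    apply: (is_derive_eq (is_deriveB (is_derive_cst t u (1 : R)) (is_derive_id u (1 : R)))).
    exact: sub0r.
  have := @is_derive1_comp _ (fun s => semigroup_op p s f x) (fun u => t - u) u _ _
    (semigroup_op_derive pS' f x tu0) D1.
  by rewrite jump_generator_apply mulrN1.
pose dq i a := \sum_(h <- nbrs) (mf_rate beta V h (rho u) (unstep h a) (b i) * flow_law u i (unstep h a)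
                    - mf_rate beta V h (rho u) a (b i) * flow_law u i a).
have DW x : is_derive u (1 : R) (fun u => product_weight (flow_law u) x)
    (\sum_i dq i (x i) * \prod_(k | k != i) flow_law u k (x k)).
  apply: (is_derive_bigprod (f := fun i u => flow_law u i (x i))).
    exact: index_enum_uniq.
  by move=> i; exact: flow_law_derive.
have D : is_derive u (1 : R) (fun u => product_mean (flow_law u) (semigroup_op p (t - u) f))
   (\sum_x (product_weight (flow_law u) x * - gen x +
     F x * (\sum_i dq i (x i) * \prod_(k | k != i) flow_law u k (x k)))).
  by apply: is_derive_bigsum => x _; exact: is_deriveM (DW x) (DF x).
apply: (is_derive_eq D); rewrite big_split /=.
under [X in _ + X]eq_bigr do rewrite mulrC.
rewrite (product_dual nbrs (@stepK m) (flow_law u)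
  (fun i h a => mf_rate beta V h (rho u) a (b i)) F) -product_meanD.
apply: eq_product_mean => x; rewrite /gen sum_transitions /drift_error -sumrN -big_split /=.
apply: eq_bigr => i _; rewrite -sumrN -big_split /=; apply: eq_bigr => h _.
rewrite mulrBl addrC; congr (_ - _).
Qed.

Lemma interpolation_continuous (f : config m n -> R) (t : R) : 0 < t -> t <= T ->
  {within `[0, t], continuous
     (fun u => product_mean (flow_law u) (semigroup_op p (t - u) f))}.
Proof.
move=> t0 tT z; apply: cvg_sum => x _; apply: cvgM.
  apply: cvg_prod => i; apply: cvgM; last exact: cvg_cst.
  apply: (@continuous_subspaceW _ _ _ `[0, T]); last exact: (mf_continuous rhoS).
  by apply: subset_itvl; rewrite bnd_simp.
by move: z; apply: (@within_reverse _ t (fun s => semigroup_op p s f x));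
  exact: (semigroup_op_continuous pS).
Qed.

(** A jump changes the semigroup by the mesh times its Lipschitz constant; the mesh is
    the factor that [rate_difference] consumes. The mean over independent
    particles is then [mean_force_error] for both coordinates. *)
Lemma drift_error_bound (f : config m n -> R) (L1 t u : R) : 0 <= L1 ->
  (forall x y, f x - f y <= L1 * config_dist x y) -> 0 <= u <= t -> t <= T ->
  `|product_mean (flow_law u) (drift_error u (semigroup_op p (t - u) f))| <=
  L1 * expR (K * t) * expR M * (n%:R * (6 * G * ((Num.sqrt n%:R)^-1 + imbalance b rho0))).
Proof.
move=> L10 fL /andP[u0 ut] tT.
have uT : 0 <= u <= T by rewrite u0 (le_trans ut).
have tu0 : 0 <= t - u by rewrite subr_ge0.
set F := semigroup_op p (t - u) f.
pose D := L1 * expR (K * t).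
have D0 : 0 <= D by rewrite mulr_ge0 // expR_ge0.
have e0 := @mesh_gt0 R m.
have dF (x y : config m n) : F x - F y <= D * config_dist x y.
  apply: le_trans (rw_semigroup_lipschitz L10 fL tu0 x y) _.
  apply: ler_wpM2r; first by apply: sumr_ge0 => i _; exact: site_norm_ge0.
  by rewrite ler_wpM2l // ler_expR ler_wpM2l // gerBl.
have jF i h (x : config m n) : h \in nbrs -> `|F (jump i h x) - F x| <= D * eps.
  move=> hn; have jn : (i, h) \in transitions.
    by apply/allpairsP; exists (i, h); rewrite mem_enum.
  have dl := config_dist_jumpl x x jn; have dr := config_dist_jumpr x x jn.
  rewrite config_distxx add0r in dl dr.
  rewrite ler_norml; apply/andP; split.
    rewrite lerNl opprB; apply: le_trans (dF x (jump i h x)) _.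
    by rewrite ler_wpM2l.
  by apply: le_trans (dF (jump i h x) x) _; rewrite ler_wpM2l.
have qE := flow_lawE uT.
have mP i : mass (rho u) (b i) != 0 by rewrite massE.
have q0 : forall i a, 0 <= flow_law u i a.
  by rewrite qE; exact: (particle_law_ge0 b (rhoP uT)).
have imbE : imbalance b (rho u) = imbalance b rho0 by rewrite /imbalance massE.
pose B (x : config m n) := \sum_i (`|field_force V1 (rho u) (x i) (b i) - pair_force b V1 x i| +
   `|field_force V2 (rho u) (x i) (b i) - pair_force b V2 x i|).
have ptw (x : config m n) : `|drift_error u F x| <= D * expR M * B x.
  apply: le_trans (ler_norm_sum _ _ _) _; rewrite /B mulr_sumr; apply: ler_sum => i _.
  have [f1 f2] := mf_forceE (rho u) (x i) (b i) Vper Vdiff.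
  have [x1 x2] := rw_forceE b x i Vper Vdiff.
  have [l1 l2] := mf_force_le (x i) (b i) (rhoP uT); have [l3 l4] := rw_force_le x i.
  have RD := rate_difference beta0 l1 l2 l3 l4 betaM.
  have {}RD := le_trans RD (ler_wpM2l (expR_ge0 M) (lerD
    (eq_dist_le f1 x1) (eq_dist_le f2 x2))).
  apply: le_trans (ler_norm_sum _ _ _) _.
  rewrite -mulrA; apply: le_trans (ler_wpM2l D0 RD).
  rewrite mulr_sumr big_seq [leRHS]big_seq; apply: ler_sum => h hn.
  rewrite normrM mulrCA; apply: ler_pM => //; last exact: jF.
  by rewrite /mf_rate /rw_rate [eps ^+ 2 * beta]mulrC.
have B1 : product_mean (flow_law u) B <=
    n%:R * (6 * G * ((Num.sqrt n%:R)^-1 + imbalance b rho0)).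
  rewrite /B product_mean_sum.
  apply: (@le_trans _ _ (\sum_(i < n) (6 * G * ((Num.sqrt n%:R)^-1 + imbalance b rho0)))); last first.
    by rewrite sumr_const card_ord -[leLHS]mulr_natl.
  apply: ler_sum => i _; rewrite product_meanD qE -imbE.
  have h1 := mean_force_error n0 (rhoP uT) mP i G0 (VG b1).
  have h2 := mean_force_error n0 (rhoP uT) mP i G0 (VG b2).
  apply: le_trans (lerD h1 h2) _.
  by rewrite le_eqVlt; apply/orP; left; apply/eqP; ring.
apply: le_trans (ler_norm_sum _ _ _) _.
apply: (@le_trans _ _ (product_mean (flow_law u) (fun x => D * expR M * B x))).
  apply: ler_sum => x _; rewrite normrM ger0_norm; last by apply: prodr_ge0 => i _.
  by apply: ler_wpM2l (ptw x); apply: prodr_ge0 => i _.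
rewrite product_meanZ; apply: ler_wpM2l => //.
by rewrite mulr_ge0 // expR_ge0.
Qed.

Lemma law_comparison (f : config m n -> R) (L1 t : R) : 0 <= L1 ->
  (forall x y, f x - f y <= L1 * config_dist x y) -> 0 <= t <= T ->
  product_mean (flow_law 0) (semigroup_op p t f) <=
  product_mean (flow_law t) f +
  L1 * expR (K * t) * expR M * (n%:R * (6 * G * ((Num.sqrt n%:R)^-1 + imbalance b rho0))) * t.
Proof.
move=> L10 fL /andP[]; rewrite le_eqVlt => /predU1P[<- _|t0 tT].
  rewrite mulr0 addr0 le_eqVlt; apply/orP; left; apply/eqP.
  by apply: eq_product_mean => x; rewrite (semigroup_op0 pS).
pose Phi u := product_mean (flow_law u) (semigroup_op p (t - u) f).
have D (u : R) : u \in `]0, t[ -> is_derive u (1 : R) Phi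
    (product_mean (flow_law u) (drift_error u (semigroup_op p (t - u) f))).
  by rewrite in_itv /= => ut; exact: interpolation_derive.
have [|c ct E] := MVT_segment (ltW t0) D; first exact: interpolation_continuous.
rewrite in_itv /= in ct.
have Bd := drift_error_bound L10 fL ct tT.
have Phit : Phi t = product_mean (flow_law t) f.
  by apply: eq_product_mean => x; rewrite subrr (semigroup_op0 pS).
have Phi0 : Phi 0 = product_mean (flow_law 0) (semigroup_op p t f) by rewrite /Phi subr0.
rewrite -Phi0 -Phit; rewrite subr0 in E.
rewrite -lerBlDl -opprB E -mulNr; apply: ler_wpM2r; first exact: ltW.
by apply: le_trans (ler_norm _) _; rewrite normrN.
Qed.

End Comparison.

(** * Expectations along a jump process *)

Section LawOfJumpProcess.
Context {R : realType} (S : finType) (d : measure_display) (Omega : measurableType d).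
Context (P : probability Omega R).
Implicit Types (Y : Omega -> S) (A : set Omega).

Let prob A : R := fine (P A).

Let probE A : measurable A -> P A = (prob A)%:E.
Proof. by move=> mA; rewrite /prob fineK // fin_num_measure. Qed.

Lemma expectation_finite Y (f : S -> R) : (forall x, measurable [set w | Y w = x]) ->
  ('E_P[fun w => f (Y w)] = (\sum_x f x * fine (P [set w | Y w = x]))%:E)%E.
Proof.
move=> mY; rewrite unlock.
have E w : (f (Y w))%:E = (\sum_x (f x)%:E * (\1_[set w | Y w = x] w)%:E)%E.
  rewrite (eq_bigr (fun x => (f x * \1_[set w | Y w = x] w)%:E)) // sumEFin; congr EFin.
  rewrite (bigD1 (Y w)) //= indicE mem_set // mulr1 big1 ?addr0 // => x xY.
  by rewrite indicE memNset ?mulr0 // => /= Yx; move: xY; rewrite Yx eqxx.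
under eq_integral do rewrite E.
have ii x : P.-integrable setT (fun w => (\1_[set w | Y w = x] w)%:E).
  by apply: integrable_indic => //; exact: measurableT.
rewrite integral_sum //; last by move=> x; exact: integrableZl.
rewrite -sumEFin; apply: eq_bigr => x _.
by rewrite integralZl // integral_indic // setIT EFinM -probE.
Qed.

Lemma probability_partition Y A : (forall x, measurable [set w | Y w = x]) -> measurable A ->
  fine (P A) = \sum_x fine (P (A `&` [set w | Y w = x])).
Proof.
move=> mY mA.
have mI x : measurable (A `&` [set w | Y w = x]) by exact: measurableI.
have ii x : P.-integrable setT (fun w => (\1_(A `&` [set w | Y w = x]) w)%:E).
  by apply: integrable_indic => //; exact: measurableT.
have E : (\int[P]_w (\1_A w)%:E = \int[P]_w (\sum_x (\1_(A `&` [set w | Y w = x]) w)%:E))%E.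
  apply: eq_integral => w _; rewrite sumEFin; congr EFin.
  rewrite (bigD1 (Y w)) //= big1 ?addr0; last first.
    move=> x xY; rewrite indicE memNset // => -[_ /= Yx].
    by move: xY; rewrite Yx eqxx.
  rewrite !indicE; congr (_%:R); congr nat_of_bool.
  by rewrite in_setI [w \in [set _ | _]]mem_set // andbT.
rewrite integral_indic // setIT integral_sum // in E.
have -> : fine (P A) = fine (\sum_x P (A `&` [set w | Y w = x]))%E.
  congr fine; rewrite E; apply: eq_bigr => x _.
  by rewrite integral_indic // setIT.
rewrite (eq_bigr (fun x => (prob (A `&` [set w | Y w = x]))%:E)); last by move=> x _; exact: probE.
by rewrite sumEFin.
Qed.

(** The Markov property is used from time 0 with an empty history. *)
Lemma jump_process_expectation (T : R) (Q : S -> S -> R) (X : R -> Omega -> S) :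
  markov_jump_process T Q P X -> exists2 p, transition_semigroup Q p &
  forall (f : S -> R) t, 0 <= t <= T ->
    ('E_P[fun w => f (X t w)] =
     (\sum_x fine (P [set w | X 0%R w = x]) * semigroup_op p t f x)%:E)%E.
Proof.
move=> [mX _ _ [p pS pX]]; exists p => // f t /andP[t0 tT].
have T0 : 0 <= T by exact: le_trans tT.
have m0 x : measurable [set w | X 0 w = x] by apply: mX; rewrite lexx T0.
have mt y : measurable [set w | X t w = y] by apply: mX; rewrite t0 tT.
rewrite expectation_finite //; congr EFin.
have H x y : fine (P ([set w | X t w = y] `&` [set w | X 0 w = x])) =
    fine (P [set w | X 0 w = x]) * p t x y.
  have := pX [::] 0 t x y isT (lexx 0) t0; rewrite add0r => /(_ tT) /=.
  rewrite (_ : [set _ | true] = setT); last by apply/seteqP; split.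
  by rewrite setTI setIC => ->; rewrite fineM ?fin_num_measure.
rewrite (eq_bigr (fun y => \sum_x fine (P [set w | X 0 w = x]) * (p t x y * f y))).
  rewrite exchange_big /=; apply: eq_bigr => x _.
  by rewrite -mulr_sumr.
move=> y _; rewrite (probability_partition m0) // mulr_sumr; apply: eq_bigr => x _.
by rewrite H; ring.
Qed.

End LawOfJumpProcess.

(** * The dual norm of the error *)

Section DualNorm.
Context {R : realType} (m : nat).
Implicit Types (sigma : site m -> R) (phi : plane R -> R).

Lemma bl_test_coord_lipschitz phi : bl_test phi -> coord_lipschitz 1 phi.
Proof. by move=> t c d e; rewrite !mul1r; exact: bl_test_lipschitz. Qed.

Lemma bl_dual_norm_le sigma (c : R) : 0 <= c ->
  (forall phi, bl_test phi -> \sum_l sigma l * phi (pos l) <= c) ->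
  bl_dual_norm sigma <= c.
Proof.
move=> c0 H; rewrite /bl_dual_norm; set A := (X in sup X).
have [->|/set0P A0] := eqVneq A set0; first by rewrite sup0.
by apply: ge_sup => // _ [phi tphi <-]; exact: H.
Qed.

Lemma bl_dual_norm_ge sigma phi : bl_test phi ->
  \sum_l sigma l * phi (pos l) <= bl_dual_norm sigma.
Proof.
move=> tphi; apply: ub_le_sup; last by exists phi.
exists (\sum_l `|sigma l|) => _ [psi tpsi <-]; apply: ler_sum => l _.
apply: le_trans (ler_norm _) _; rewrite normrM ler_piMr //.
exact: bl_test_le1.
Qed.

(** Test functions are bounded by one, so the suprema are finite; over an empty set of
    test functions both are 0. *)
Lemma bl_dual_norm_sub sigma sigma' (c : R) : 0 <= c ->
  (forall phi, bl_test phi ->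
     \sum_l sigma l * phi (pos l) <= \sum_l sigma' l * phi (pos l) + c) ->
  bl_dual_norm sigma - bl_dual_norm sigma' <= c.
Proof.
move=> c0 H; rewrite lerBlDl.
have [[phi tphi]|no] := pselect (exists phi : plane R -> R, bl_test phi); last first.
  have E tau : bl_dual_norm tau = 0 :> R.
    rewrite /bl_dual_norm; set A := (X in sup X).
    have -> : A = set0 by apply/seteqP; split => // u [psi tpsi _]; case: no; exists psi.
    exact: sup0.
  by rewrite !E add0r.
rewrite {1}/bl_dual_norm; apply: ge_sup; first by exists (\sum_l sigma l * phi (pos l)), phi.
move=> _ [psi tpsi <-]; apply: le_trans (H _ tpsi) _.
by rewrite lerD2r; exact: bl_dual_norm_ge.
Qed.

End DualNorm.

Section EmpiricalDualNorm.
Context {R : realType} (m n : nat) (b : 'I_n -> bool) (s : bool).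
Context (nu : bool -> site m -> R).
Hypothesis n0 : (0 < n)%N.
Local Notation err := (fun (x : config m n) (l : site m) => empirical b x s l - nu s l).

Lemma empirical_integral (x : config m n) (phi : plane R -> R) :
  \sum_l empirical b x s l * phi (pos l) = n%:R^-1 * \sum_(i | b i == s) phi (pos (x i)).
Proof.
rewrite /empirical; under eq_bigr do rewrite -mulrA mulr_suml.
rewrite -mulr_sumr exchange_big /=; congr (_ * _); apply: eq_bigr => i _.
rewrite (bigD1 (x i)) //= eqxx mul1r big1 ?addr0 // => l lx.
by rewrite eq_sym (negbTE lx) mul0r.
Qed.

Lemma dual_norm_lipschitz (x y : config m n) :
  bl_dual_norm (err x) - bl_dual_norm (err y) <= n%:R^-1 * config_dist x y.
Proof.
have ni : 0 <= n%:R^-1 :> R by rewrite invr_ge0.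
have dist0 : 0 <= config_dist x y :> R by apply: sumr_ge0 => i _; exact: site_norm_ge0.
apply: bl_dual_norm_sub; first by rewrite mulr_ge0.
move=> phi tphi; have [fper _ _] := tphi.
have E z : \sum_l err z l * phi (pos l) =
    n%:R^-1 * \sum_(i | b i == s) phi (pos (z i)) - \sum_l nu s l * phi (pos l).
  by rewrite -empirical_integral -sumrB; apply: eq_bigr => l _; rewrite mulrBl.
rewrite !E addrAC lerD2r -mulrDr ler_wpM2l //.
rewrite -lerBlDl -sumrB.
rewrite [leRHS](bigID (fun i => b i == s)) /= -[leLHS]addr0; apply: lerD.
  apply: ler_sum => i _; apply: le_trans (ler_norm _) _.
  rewrite -[leRHS]mul1r.
  by apply: site_lipschitz => //; exact: bl_test_coord_lipschitz.
by apply: sumr_ge0 => i _; exact: site_norm_ge0.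
Qed.

Hypothesis nuP : is_probability nu.
Hypothesis massP : forall i, mass nu (b i) != 0.

(** The empirical measure is its mean plus a fluctuation, and its mean is the component
    of [nu] rescaled to the mass n_s / n. If that component vanishes, so does the
    rescaled one, whatever the value of the quotient by 0. *)
Lemma dual_norm_le_fluctuation J (x : config m n) :
  bl_dual_norm (err x) <=
  imbalance b nu + fluctuation_bound (particle_law b nu) (fun i => b i == s) J x.
Proof.
have [nu0 _] := nuP.
have q1 := particle_law_sum massP.
have nN : n%:R != 0 :> R by rewrite pnatr_eq0 -lt0n.
apply: bl_dual_norm_le.
  rewrite addr_ge0 ?normr_ge0 // /fluctuation_bound addr_ge0 ?divr_ge0 ?exprn_ge0 //.
  by apply: sumr_ge0 => k _; rewrite mulr_ge0 ?invr_ge0 ?exprn_ge0 ?sumr_ge0.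
move=> phi tphi; have tL := bl_test_coord_lipschitz tphi.
pose c := (sign_count b s)%:R / n%:R - mass nu s.
have E l : err x l = fluctuation (particle_law b nu) (fun i => b i == s) x l
                     + c * (nu s l / mass nu s).
  rewrite /fluctuation /empirical sumrB mulrBr -addrA; congr (_ + _).
  have -> : \sum_(i | b i == s) particle_law b nu i l = (sign_count b s)%:R * (nu s l / mass nu s).
    rewrite (eq_bigr (fun=> nu s l / mass nu s)).
      by rewrite sumr_const -[LHS]mulr_natl /sign_count cardsE.
    by move=> i /eqP bs; rewrite /particle_law bs.
  have [m0|mN] := eqVneq (mass nu s) 0.
    by rewrite (mass0_rho nuP l m0) !mul0r !mulr0 oppr0 addr0.
  by rewrite /c; field; rewrite mN nN.
under eq_bigr do rewrite E mulrDl.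
rewrite big_split /= addrC; apply: lerD; last first.
  by apply: fluctuation_boundP => //; exact: particle_law_ge0.
under eq_bigr do rewrite -mulrA; rewrite -mulr_sumr.
apply: le_trans (ler_norm _) _; rewrite normrM imbalanceE // ler_piMr ?normr_ge0 //.
apply: le_trans (ler_norm_sum _ _ _) _.
have ms0 := mass_ge0 nuP s.
apply: (@le_trans _ _ (\sum_l nu s l / mass nu s)).
  apply: ler_sum => l _; rewrite normrM ger0_norm ?divr_ge0 // ler_piMr ?divr_ge0 //.
  exact: bl_test_le1.
rewrite -mulr_suml -/(mass nu s).
by have [->|mN] := eqVneq (mass nu s) 0; [rewrite mul0r|rewrite divff].
Qed.

Lemma mean_dual_norm : (2 <= n)%N ->
  product_mean (particle_law b nu) (fun x => bl_dual_norm (err x)) <=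
  imbalance b nu + 20 * (ln n%:R / Num.sqrt n%:R).
Proof.
move=> n2; have [J HJ] := dyadic_rate R n2.
have q0 := particle_law_ge0 b nuP; have q1 := particle_law_sum massP.
apply: le_trans (ler_product_mean q0 (dual_norm_le_fluctuation J)) _.
rewrite product_meanD product_mean_cst // lerD2l.
by apply: le_trans HJ; apply: mean_fluctuation_bound.
Qed.

End EmpiricalDualNorm.

Section InitialLaw.
Context {R : realType} (m n : nat) (d : measure_display) (Omega : measurableType d).
Context (P : probability Omega R) (X0 : Omega -> config m n) (b : 'I_n -> bool).
Context (rho0 : bool -> site m -> R).
Hypothesis mX : forall x, measurable [set w | X0 w = x].
Hypothesis indep : mutually_independent P (fun i w => X0 w i).
Hypothesis law : forall i, law_proportional_to P (rho0 (b i)) (fun w => X0 w i).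

Lemma coordinate_measurable i a : measurable [set w | X0 w i = a].
Proof.
rewrite (_ : [set w | _] = \bigcup_(x in [set x : config m n | x i = a]) [set w | X0 w = x]).
  by apply: fin_bigcup_measurable => [|x _]; [exact: finite_finset|exact: mX].
by apply/seteqP; split => [w /= wa|w [x /= xa ->]] //; exists (X0 w).
Qed.

(** A law proportional to [rho0 (b i)] has total mass one, so that component does not
    vanish and the factor is the inverse of its mass. *)
Lemma initial_coordinate i a : mass rho0 (b i) != 0 /\
  fine (P [set w | X0 w i = a]) = rho0 (b i) a / mass rho0 (b i).
Proof.
have [c Hc] := law i.
have : \sum_a fine (P [set w | X0 w i = a]) = 1.
  have := probability_partition P (coordinate_measurable i) measurableT.
  rewrite probability_setT /= => ->.
  by apply: eq_bigr => y _; rewrite setTI.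
under eq_bigr do rewrite Hc; rewrite -mulr_sumr -/(mass _ _) => cm.
have mN : mass rho0 (b i) != 0.
  by apply/negP => /eqP m0; move: cm; rewrite m0 mulr0 => /eqP; rewrite eq_sym oner_eq0.
split=> //; rewrite Hc -[c](mulfK mN) cm div1r mulrC.
by [].
Qed.

Lemma initial_law x : fine (P [set w | X0 w = x]) =
  product_weight (particle_law b rho0) x.
Proof.
have := indep (fun i => [set x i]%SET).
rewrite (_ : [set w | _] = [set w | X0 w = x]); last first.
  apply/seteqP; split => w /=.
    by move=> H; apply/ffunP => i; have := H i; rewrite inE => /eqP.
  by move=> -> i; rewrite inE.
move=> ->; apply: eq_bigr => i _.
rewrite /particle_law; have [_ <-] := initial_coordinate i (x i); congr (fine (P _)).
by apply/seteqP; split => w /=; rewrite inE => /eqP.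
Qed.

End InitialLaw.

(** * The mean-field estimate *)

Theorem theorem1p6 (R : realType) (CV cbeta Cbeta : R)
  (hCV : 0 < CV) (hcbeta : 0 < cbeta) (hCbeta : 0 < Cbeta)
  (* initial data for every mesh size eps = 1 / (m + 1) *)
  (rho0 : forall m : nat, bool -> site m -> R)
  (hrho0 : forall m, is_probability (rho0 m)) :
  exists C C' C'' : R, [/\ 0 < C, 0 < C', 0 < C'' &
    forall (m n : nat) (delta beta T : R) (V : plane R -> R),
      standing_assumptions CV cbeta Cbeta (mesh R m) delta n beta T V ->
    forall rho : R -> bool -> site m -> R,
      mf_solution beta V T (rho0 m) rho ->
    forall (b : 'I_n -> bool)
           (d : measure_display) (Omega : measurableType d)
           (P : probability Omega R) (X : R -> Omega -> config m n),
      mutually_independent P (fun i w => X 0 w i) ->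
      (forall i, law_proportional_to P (rho0 m (b i)) (fun w => X 0 w i)) ->
      markov_jump_process T (rw_generator beta V b) P X ->
    let nplus : nat := #|[set i | b i]%SET| in
    let kappa : R := `| \sum_l rho0 m true l - nplus%:R / n%:R | in
    forall (s : bool) (t : R), 0 <= t <= T ->
      ('E_P[fun w => bl_dual_norm
                       (fun l => empirical b (X t w) s l - rho t s l)%R]
       <= (kappa + C'' * (ln n%:R / Num.sqrt n%:R) +
           C' * ((Num.sqrt n%:R)^-1 + kappa) * (t / delta) *
             expR (C * delta ^- 2 * t))%:E)%E].
Proof.
pose M : R := Cbeta * CV / 2.
exists (4 * expR M * CV), (6 * expR M * CV), 20.
have eM := expR_gt0 M.
split; rewrite ?mulr_gt0 //.
move=> m n delta beta T V [eps0 /andP[epsd d1] n2 beta0 T1 /andP[_ betaC] Vper VC5 _ Vdk].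
move=> rho rhoS b d Omega P X indep law mX nplus kappa s t tT.
have n0 : (0 < n)%N by apply: leq_trans n2.
have T0 : 0 < T by apply: lt_le_trans T1.
have delta0 : 0 < delta by exact: lt_le_trans epsd.
have [Vdiff VC4] : Ck 5 V by [].
have VC2 : Ck 2 V.
  split=> // v; have [dV cV] := VC4 v; split=> // v'.
  by have [dV2 _] := cV v' => x; exact: differentiable_continuous.
pose G : R := CV / delta.
pose L : R := CV * delta ^- 2.
have G0 : 0 < G by rewrite divr_gt0.
have L0 : 0 <= L by rewrite mulr_ge0 ?invr_ge0 ?exprn_ge0 // ltW.
have VG v : basis_vector v -> forall l : site m, `|site_partial V v l| <= G.
  by move=> bv l; apply: dk_norm1_bound => //; exact: (Vdk 1%N isT).
have VL v : basis_vector v -> forall l l' : site m,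
    `|site_partial V v l - site_partial V v l'| <= L * site_norm (l - l').
  move=> bv l l'.
  apply: (site_lipschitz l l' L0 (periodic_diff v Vper Vdiff)).
  apply: partial_lipschitz; first by have [] := VC4 v.
  by move=> x v' bv'; apply: dk_norm2_bound => //; exact: (Vdk 2%N isT).
(* this is where beta <= Cbeta delta / eps enters: exponents stay bounded by M *)
have betaM : 2^-1 * beta * (mesh R m * G) <= M.
  have : beta * (mesh R m / delta) <= Cbeta.
    by rewrite mulrA ler_pdivrMr // -ler_pdivlMr.
  move=> /(ler_wpM2l (ltW hCV)); rewrite /M /G; lra.
have [p pS EX] := jump_process_expectation mX.
have [mXt _ _ _] := mX.
have mX0 x : measurable [set w | X 0 w = x] by apply: mXt; rewrite lexx ltW.
have massP i : mass (rho0 m) (b i) != 0.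
  by have [] := initial_coordinate mX0 law i (0 : site m).
have law0 x := initial_law mX0 indep law x.
pose f (x : config m n) := bl_dual_norm (fun l => empirical b x s l - rho t s l).
have fL x y : f x - f y <= n%:R^-1 * config_dist x y by exact: dual_norm_lipschitz.
have ni : 0 <= n%:R^-1 :> R by rewrite invr_ge0.
have CMP := law_comparison n0 Vper Vdiff beta0 T0 G0 L0 VG VL betaM pS (hrho0 m) rhoS massP ni fL tT.
have rhoP := mf_probability Vper Vdiff beta0 T0 (hrho0 m) rhoS tT.
have massE s' : mass (rho t) s' = mass (rho0 m) s' by rewrite /mass (mf_mass rhoS).
have imbE : imbalance b (rho t) = imbalance b (rho0 m) by rewrite /imbalance massE.
have kE : imbalance b (rho0 m) = kappa.
  by rewrite /imbalance /kappa /nplus /sign_count; congr (`|_ - _%:R / _|);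
     apply: eq_card => i; rewrite !inE eqb_id.
have massPt i : mass (rho t) (b i) != 0 by rewrite massE.
have MN := mean_dual_norm s n0 rhoP massPt n2.
rewrite -(flow_lawE b rhoS tT) imbE kE in MN; rewrite kE in CMP.
rewrite (EX f t tT) lee_fin.
have -> : \sum_x fine (P [set w | X 0 w = x]) * semigroup_op p t f x =
    product_mean (flow_law b (rho0 m) rho 0) (semigroup_op p t f).
  apply: eq_bigr => x _; rewrite law0 /product_weight /flow_law /particle_law.
  by have [-> _ _] := rhoS.
apply: le_trans CMP _; apply: lerD; first exact: MN.
rewrite le_eqVlt; apply/orP; left; apply/eqP.
have -> : 4 * expR M * L * t = 4 * expR M * CV * delta ^- 2 * t by rewrite /L; ring.
rewrite /G; set E := expR (_ * t); set r := Num.sqrt _.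
have nN : n%:R != 0 :> R by rewrite pnatr_eq0 -lt0n.
have r0 : r != 0 by rewrite gt_eqF // sqrtr_gt0 ltr0n.
by field; rewrite r0 nN gt_eqF.
Qed.
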